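(* Let $u\in H_0(\Delta,\Omega)$ with $\Delta u\in H(\Delta,\Omega)$. Then $u\in H^2_0(\Omega)$, so that, in particular, $\|\Delta u\|=\|D^2u\|$.
   Context: Let $d\in\{2,3\}$ and let $\Omega\subset\mathbb{R}^d$ be a bounded simply connected Lipschitz domain. $(\cdot,\cdot)$, $\|\cdot\|$ are the $L_2(\Omega)$ inner product and norm (for scalar and tensor functions); $D^2u$ is the Hessian of $u$. $H(\Delta,\Omega)$ is the closure of $\mathcal{D}(\overline\Omega)$ (functions smooth up to the boundary) with respect to $(\|z\|^2+\|\Delta z\|^2)^{1/2}$, and $$H_0(\Delta,\Omega)=\{z\in H(\Delta,\Omega): (z,\Delta v)-(\Delta z,v)=0\ \forall v\in H(\Delta,\Omega)\}.$$ $H^2_0(\Omega)$ is the closure of $C_c^\infty(\Omega)$ with respect to $(\|z\|^2+\|D^2z\|^2)^{1/2}$. *)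

(* Defs.v *)
From HB Require Import structures.
From mathcomp Require Import all_boot all_order all_algebra.
From mathcomp Require Import all_classical all_reals all_analysis.

Set Implicit Arguments.
Unset Strict Implicit.
Unset Printing Implicit Defensive.

Import Order.TTheory GRing.Theory Num.Theory.
Import numFieldNormedType.Exports.

Local Open Scope classical_set_scope.
Local Open Scope ring_scope.

(* Row vectors carry the product (= Borel) sigma-algebra, generated by the
   coordinate maps, as the library does for tuples. *)
Definition measure_rV_display : measure_display. Proof. exact. Qed.

Section measurable_rV.
Variables (R : realType) (n : nat).

Definition rV_coord (i : 'I_n) (x : 'rV[R]_n) : measurableTypeR R := x 0 i.

Let rV_set0 : g_sigma_preimage rV_coord set0.
Proof. exact: sigma_algebra0. Qed.

Let rV_setC A : g_sigma_preimage rV_coord A -> g_sigma_preimage rV_coord (~` A).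
Proof. exact: sigma_algebraC. Qed.

Let rV_bigcup (F : _^nat) : (forall i, g_sigma_preimage rV_coord (F i)) ->
  g_sigma_preimage rV_coord (\bigcup_i (F i)).
Proof. exact: sigma_algebra_bigcup. Qed.

HB.instance Definition _ := @isMeasurable.Build measure_rV_display
  'rV[R]_n (g_sigma_preimage rV_coord) rV_set0 rV_setC rV_bigcup.

Lemma measurable_rV_coord (i : 'I_n) : measurable_fun setT (rV_coord i).
Proof.
move=> _ Y mY; rewrite setTI; apply: sub_sigma_algebra => /=.
rewrite -bigcup_seq/=; exists i => /=; first by rewrite mem_index_enum.
by exists Y => //; rewrite setTI.
Qed.

Lemma measurable_fun_rV d (T : measurableType d) (f : T -> 'rV[R]_n) :
  (forall i, measurable_fun setT (rV_coord i \o f)) -> measurable_fun setT f.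
Proof.
move=> mf; apply: (@measurability _ _ _ _ _ _
  (\big[setU/set0]_(i < n) preimage_set_system setT (rV_coord i) measurable)) => //.
move=> _ [B + <-]; rewrite -bigcup_seq/= => -[i _ [C mC <-]].
by rewrite setTI -comp_preimage; exact: mf.
Qed.

End measurable_rV.

Section lebesgue_rV.
Variable R : realType.

Definition cons_rV n (p : measurableTypeR R * 'rV[R]_n) : 'rV[R]_n.+1 :=
  row_mx (p.1 : R)%:M p.2.

Definition uncons_rV n (x : 'rV[R]_n.+1) : measurableTypeR R * 'rV[R]_n :=
  (x 0 0, rsubmx (x : 'rV_(1 + n))).

Lemma cons_rVK n : cancel (@cons_rV n) (@uncons_rV n).
Proof.
move=> [a v]; rewrite /uncons_rV /cons_rV/= row_mxKr; congr pair.
transitivity (row_mx (a : R)%:M v 0 (lshift n 0)).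
  by congr (row_mx _ _ _ _); exact/val_inj.
by rewrite row_mxEl mxE eqxx mulr1n.
Qed.

Lemma measurable_cons_rV n : measurable_fun setT (@cons_rV n).
Proof.
apply: measurable_fun_rV => i.
case: (split_ordP (i : 'I_(1 + n))) => j ->.
- rewrite (_ : _ \o _ = fst)//; apply/funext => p /=.
  rewrite /comp /rV_coord /cons_rV.
  by rewrite (row_mxEl (p.1 : R)%:M p.2 0 j) mxE !ord1 eqxx mulr1n.
- rewrite (_ : _ \o _ = rV_coord j \o snd); last first.
    apply/funext => p; rewrite /comp /rV_coord /cons_rV.
    by rewrite (row_mxEr (p.1 : R)%:M p.2 0 j).
  by apply: measurableT_comp => //; exact: measurable_rV_coord.
Qed.

Lemma measurable_uncons_rV n : measurable_fun setT (@uncons_rV n).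
Proof.
apply: measurable_fun_pair; first exact: (measurable_rV_coord 0).
apply: measurable_fun_rV => i.
rewrite (_ : _ \o _ = rV_coord (rshift 1 i)); first exact: measurable_rV_coord.
by apply/funext => x; rewrite /rV_coord/= mxE.
Qed.

HB.instance Definition _ n :=
  isMeasurableFun.Build _ _ _ _ (@cons_rV n) (@measurable_cons_rV n).

Section step.
Variables (n : nat) (mu : {sigma_finite_measure set 'rV[R]_n -> \bar R}).

Definition cons_measure : set 'rV[R]_n.+1 -> \bar R :=
  pushforward (@lebesgue_measure R \x mu)%E (@cons_rV n).

Let cons_measure0 : cons_measure set0 = 0%E.
Proof. exact: measure0. Qed.

Let cons_measure_ge0 A : (0 <= cons_measure A)%E.
Proof. exact: measure_ge0. Qed.

Let cons_measure_sigma_additive : semi_sigma_additive cons_measure.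
Proof. exact: measure_semi_sigma_additive. Qed.

HB.instance Definition _ := isMeasure.Build _ _ _ cons_measure
  cons_measure0 cons_measure_ge0 cons_measure_sigma_additive.

Lemma cons_measureX (A : set (measurableTypeR R)) (B : set 'rV[R]_n) :
  measurable A -> measurable B ->
  cons_measure (@uncons_rV n @^-1` (A `*` B)) = (lebesgue_measure A * mu B)%E.
Proof.
move=> mA mB; rewrite /cons_measure /pushforward -comp_preimage.
rewrite (_ : _ \o _ = id) ?preimage_id; last exact/funext/cons_rVK.
exact: product_measure1E.
Qed.

Let cons_measure_sigma_finite : sigma_finite setT cons_measure.
Proof.
have /sigma_finiteP[F [TF ndF Foo]] := sigma_finiteT (@lebesgue_measure R).
have /sigma_finiteP[G [TG ndG Goo]] := sigma_finiteT mu.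
exists (fun k => @uncons_rV n @^-1` (F k `*` G k)).
  apply/esym; rewrite -subTset => x _.
  have [i _ Fi] : (\bigcup_k F k) (uncons_rV x).1 by rewrite -TF.
  have [j _ Gj] : (\bigcup_k G k) (uncons_rV x).2 by rewrite -TG.
  exists (maxn i j) => //; split.
    by move: Fi; exact/subsetPset/ndF/leq_maxl.
  by move: Gj; exact/subsetPset/ndG/leq_maxr.
move=> k; have [mF Fk] := Foo k; have [mG Gk] := Goo k; split.
  rewrite -[X in measurable X]setTI.
  by apply: measurable_uncons_rV => //; exact: measurableX.
by rewrite cons_measureX// lte_mul_pinfty// ge0_fin_numE.
Qed.

HB.instance Definition _ := Measure_isSigmaFinite.Build _ _ _ cons_measure
  cons_measure_sigma_finite.

End step.

(* Lebesgue measure on R^n, as the n-fold product measure. *)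
Fixpoint lebesgue_rV n : {sigma_finite_measure set 'rV[R]_n -> \bar R} :=
  if n is m.+1 then cons_measure (lebesgue_rV m) else dirac (0 : 'rV[R]_0).

End lebesgue_rV.

Section domains.
Variables (R : realType) (d : nat).
Implicit Types Omega : set 'rV[R]_d.

Definition domain Omega := [/\ Omega !=set0, open Omega & connected Omega].

Definition path_connected_set (T : topologicalType) (A : set T) :=
  forall x y, A x -> A y -> exists gamma : R -> T,
    [/\ {within `[0, 1], continuous gamma},
        gamma 0 = x, gamma 1 = y & gamma @` `[0, 1] `<=` A].

(* H (s, t): s runs along the loop, t along the homotopy, which fixes the
   base point gamma 0 and ends in the constant loop. *)
Definition null_homotopic_in (T : topologicalType) (A : set T)
    (gamma : R -> T) :=
  exists H : R * R -> T,
    [/\ {within `[0, 1] `*` `[0, 1], continuous H},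
        H @` (`[0, 1] `*` `[0, 1]) `<=` A,
        forall s, s \in `[0, 1] -> H (s, 0) = gamma s /\ H (s, 1) = gamma 0 &
        forall t, t \in `[0, 1] -> H (0, t) = gamma 0 /\ H (1, t) = gamma 0].

Definition simply_connected (T : topologicalType) (A : set T) :=
  path_connected_set A /\
  forall gamma : R -> T, {within `[0, 1], continuous gamma} ->
    gamma @` `[0, 1] `<=` A -> gamma 0 = gamma 1 -> null_homotopic_in A gamma.

(* Near each boundary point and in suitable orthonormal coordinates
   [x *m Q], Omega is the strict epigraph, in the direction of the k-th
   coordinate, of a Lipschitz function of the d.-1 other coordinates. *)
Definition lipschitz_boundary Omega :=
  forall x, (closure Omega `\` Omega°) x ->
  exists (Q : 'M[R]_d) (k : 'I_d) (gamma : 'rV[R]_d.-1 -> R),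
    [/\ Q *m Q^T = 1%:M, lipschitz gamma &
      \forall y \near x, Omega y <->
        gamma (col' k (y *m Q)) < (y *m Q) 0 k].

End domains.

Section smooth_functions.
Variables (R : realType) (d : nat).
Implicit Types (Omega : set 'rV[R]_d) (phi : 'rV[R]_d -> R).

(* pderiv [:: i1; ..; im] phi is d_i1 (.. (d_im phi)). *)
Definition pderiv (s : seq 'I_d) phi : 'rV[R]_d -> R :=
  foldr (fun i f x => 'D_(delta_mx 0 i) f x) phi s.

Definition laplacian phi (x : 'rV[R]_d) : R :=
  \sum_(i < d) pderiv [:: i; i] phi x.

(* C^oo on the whole space: all iterated partial derivatives exist and are
   Frechet differentiable, in particular continuous. *)
Definition smooth phi :=
  forall (s : seq 'I_d) (x : 'rV[R]_d), differentiable (pderiv s phi) x.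

(* C_c^oo(Omega), its elements being extended by 0. *)
Definition test_function Omega : set ('rV[R]_d -> R) :=
  [set phi | [/\ smooth phi, compact (closure [set x | phi x != 0]) &
                 closure [set x | phi x != 0] `<=` Omega]].

End smooth_functions.

(* Functions on Omega are represented by functions on the whole space; none of
   the notions below depends on their values outside Omega or on a null set,
   i.e. functions are implicitly considered up to almost everywhere equality. *)
Section spaces.
Variables (R : realType) (d : nat) (Omega : set 'rV[R]_d).
Local Notation mu := (lebesgue_rV R d).
Implicit Types u v z g : 'rV[R]_d -> R.

Definition L2 : set ('rV[R]_d -> R) :=
  [set z | z \_ Omega \in Lfun mu 2%:E].

Definition dotL2 u v : R := \int[mu]_(x in Omega) (u x * v x).

Definition normL2 z : R := fine ('N[mu]_2%:E[EFin \o (z \_ Omega)])%E.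

Definition normL2_tensor (H : 'rV[R]_d -> 'M[R]_d) : R :=
  Num.sqrt (\sum_(i < d) \sum_(j < d) normL2 (fun x => H x i j) ^+ 2).

(* g is the distributional Laplacian of z, and lies in L_2. *)
Definition is_weak_laplacian z g := L2 g /\
  forall phi, test_function Omega phi -> dotL2 z (laplacian phi) = dotL2 g phi.

(* H is the distributional Hessian of z, and lies in L_2. *)
Definition is_weak_hessian z (H : 'rV[R]_d -> 'M[R]_d) :=
  forall i j, L2 (fun x => H x i j) /\
    forall phi, test_function Omega phi ->
      dotL2 z (pderiv [:: i; j] phi) = dotL2 (fun x => H x i j) phi.

(* Unique up to a.e. equality when they exist. *)
Definition weak_laplacian z : 'rV[R]_d -> R :=
  xget (cst 0) [set g | is_weak_laplacian z g].

Definition weak_hessian z : 'rV[R]_d -> 'M[R]_d :=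
  xget (cst 0) [set H | is_weak_hessian z H].

(* The closure of A in the space E with respect to the norm N. *)
Definition norm_closure (E : set ('rV[R]_d -> R)) (N : ('rV[R]_d -> R) -> R)
    (A : set ('rV[R]_d -> R)) : set ('rV[R]_d -> R) :=
  [set z | E z /\ forall e, 0 < e -> exists2 phi, A phi & N (z \- phi) < e].

Definition laplacian_norm z : R :=
  Num.sqrt (normL2 z ^+ 2 + normL2 (weak_laplacian z) ^+ 2).

Definition hessian_norm z : R :=
  Num.sqrt (normL2 z ^+ 2 + normL2_tensor (weak_hessian z) ^+ 2).

(* H(Delta, Omega); the functions that are smooth up to the boundary are the
   restrictions to Omega of functions in C^oo(R^d). *)
Definition H_laplacian : set ('rV[R]_d -> R) :=
  norm_closure [set z | L2 z /\ exists g, is_weak_laplacian z g]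
    laplacian_norm (@smooth R d).

Definition H0_laplacian : set ('rV[R]_d -> R) :=
  [set z | H_laplacian z /\ forall v, H_laplacian v ->
     dotL2 z (weak_laplacian v) - dotL2 (weak_laplacian z) v = 0].

(* H^2_0(Omega) *)
Definition H20 : set ('rV[R]_d -> R) :=
  norm_closure [set z | L2 z /\ exists H, is_weak_hessian z H]
    hessian_norm (test_function Omega).

End spaces.

(* Main.v *)
(* Testing u in H_0(Delta) against C_c^oo(R^n), whose members need not vanish on the boundary,
   shows that the extension of u by zero has an L^2 Laplacian on R^n. Mollifying this extension
   and using ||D^2 w|| = ||Delta w|| and ||grad w||^2 = -(w, Delta w) for w in C_c^oo(R^n), one
   gets a Cauchy sequence of second derivatives, so the extension lies in H^2(R^n). Near each
   point of closure Omega some small translations push closure Omega inside Omega (the cone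
   property of an epigraph). With a finite cover and smooth cutoffs, each localized piece is
   mollified by a kernel centred at such a translation: the result is a test function of Omega,
   and it approximates the piece in H^2. Hence u is in H^2_0, and ||D^2 u|| = ||Delta u|| by
   passing to the limit. *)

Require Import Defs.
From HB Require Import structures.
From mathcomp Require Import all_boot all_order all_algebra.
From mathcomp Require Import all_classical all_reals all_analysis measurable_realfun.
From mathcomp Require Import ring lra.

Set Implicit Arguments.
Unset Strict Implicit.
Unset Printing Implicit Defensive.

Import Order.TTheory GRing.Theory Num.Theory.
Import numFieldNormedType.Exports.

Local Open Scope classical_set_scope.
Local Open Scope ring_scope.

(** * Lebesgue measure on row vectors *)

(** That the sum of the pure second derivatives is in L^2 says nothing about a single one as long as
    boundary terms can occur; the extension by zero moves the question to the whole space, where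
    integration by parts leaves none. The gradient has to be controlled too, although the conclusion
    only concerns second derivatives: the Hessian of a localized piece [chi * z] contains first
    derivatives of [z]. A mollification of a function supported in the closure of Omega spreads
    beyond Omega. A kernel centred off the origin translates and smooths in one stroke, and its
    position is harmless: a mollification is an average of translates of [z], so it is as close to
    [z] in L^2 as those translates are. Hence the weight given to the continuity of translations in
    L^2, which is proved from measure theory for every square-integrable function. Differentiation
    of mollifications and integration by parts both rest on the quadratic Taylor remainder of a
    smooth function with bounded support, integrated over a fixed ball. *)

Section rV_measure.
Variables (R : realType) (n : nat).
Implicit Types (U : set 'rV[R]_n) (x y : 'rV[R]_n).

Lemma rV_normE x (e : R) : 0 <= e -> (`|x| <= e) = [forall i, `|x 0 i| <= e].
Proof.
move=> e0; rewrite (_ : `|x| = mx_norm x)// mx_normrE; apply/bigmax_leP/forallP => /=.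
  by move=> [_ h] i; exact: (h (0, i)).
by move=> h; split => // -[i j] _ /=; rewrite ord1; exact: h.
Qed.

Lemma rV_norm_lt x (e : R) : 0 < e -> (`|x| < e) = [forall i, `|x 0 i| < e].
Proof.
move=> e0; rewrite (_ : `|x| = mx_norm x)// mx_normrE; apply/bigmax_ltP/forallP => /=.
  by move=> [_ h] i; exact: (h (0, i)).
by move=> h; split => // -[i j] _ /=; rewrite ord1; exact: h.
Qed.

Lemma measurable_box (A : 'I_n -> set (measurableTypeR R)) :
  (forall i, measurable (A i)) ->
  measurable [set x : 'rV[R]_n | forall i, A i (x 0 i)].
Proof.
move=> mA.
rewrite (_ : mkset _ = \bigcap_(i in [set: 'I_n]) (@rV_coord R n i @^-1` A i)).
  apply: fin_bigcap_measurable => // i _.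
  by rewrite -[X in measurable X]setTI; apply: measurable_rV_coord.
by apply/seteqP; split => x /= h i; [move=> _; exact: h|exact: h].
Qed.

Lemma measurable_rV_ball x (e : R) : measurable (ball x e).
Proof.
case: (ltP 0 e) => e0.
  rewrite (_ : ball x e = [set y : 'rV[R]_n | forall i, ball (x 0 i) e (y 0 i)]).
    by apply: (@measurable_box (fun i => ball (x 0 i) e)) => i; exact: measurable_ball.
  apply/seteqP; split => y.
    by rewrite -ball_normE /= rV_norm_lt// => /forallP h i; have := h i; rewrite !mxE -ball_normE.
  move=> h; rewrite -ball_normE /= rV_norm_lt//; apply/forallP => i.
  by have := h i; rewrite !mxE -ball_normE.
rewrite (_ : ball x e = set0)//; apply/seteqP; split => y //.
rewrite -ball_normE /= => h; have := le_lt_trans (normr_ge0 _) h.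
by rewrite ltNge e0.
Qed.

(** Second countability, with balls of rational centre and radius [k.+1%:R^-1]: an open set becomes
    a countable union of balls, and balls of the sup norm are boxes, hence measurable. *)
Lemma open_rV_ratP U x : open U -> U x ->
  exists q : 'rV[rat]_n * nat, ball (map_mx (ratr : rat -> R) q.1) q.2.+1%:R^-1 x /\
    ball (map_mx (ratr : rat -> R) q.1) q.2.+1%:R^-1 `<=` U.
Proof.
move=> oU Ux; have /nbhs_ballP[e /= e0 eU] : nbhs x U by exact: open_nbhs_nbhs.
have [k ke] : exists k : nat, k.+1%:R^-1 < e / 2 :> R.
  have := near_infty_natSinv_lt (PosNum (divr_gt0 e0 (ltr0n R 2))).
  by case=> k _ /(_ k (leqnn _)) /= h; exists k.
have k0 : 0 < k.+1%:R^-1 :> R by rewrite invr_gt0.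
have /choice[q hq] : forall i : 'I_n, exists q : rat, `|x 0 i - ratr q| < k.+1%:R^-1.
  move=> i; have /rat_in_itvoo[q /itvP qi] : x 0 i - k.+1%:R^-1 < x 0 i by rewrite ltrBlDr ltrDl.
  exists q; rewrite ger0_norm ?subr_ge0 ?qi//.
  by rewrite ltrBlDr -ltrBlDl qi.
have h : ball (map_mx (ratr : rat -> R) (\row_i q i)) k.+1%:R^-1 x.
  rewrite -ball_normE /= rV_norm_lt//; apply/forallP => i.
  by rewrite !mxE distrC.
exists (\row_i q i, k); split => //= y hy; apply: eU.
rewrite (splitr e); apply: (@ball_triangle _ _ (map_mx (ratr : rat -> R) (\row_i q i))).
  by apply: ball_sym; apply: le_ball h; exact: ltW.
by apply: le_ball hy; exact: ltW.
Qed.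

Lemma open_measurable_rV U : open U -> measurable U.
Proof.
move=> oU.
pose B (q : 'rV[rat]_n * nat) := ball (map_mx (ratr : rat -> R) q.1) q.2.+1%:R^-1.
rewrite (_ : U = \bigcup_(q in [set q | B q `<=` U]) B q).
  rewrite bigcup_mkcond; apply: countable_bigcupT_measurable => // q.
  by case: ifPn => // _; exact: measurable_rV_ball.
apply/seteqP; split => x.
  by move=> /(open_rV_ratP oU)[q [qx qU]]; exists q.
by case=> q /= + Bx; apply.
Qed.

Lemma rV_coord_continuous (i : 'I_n) : continuous (fun x : 'rV[R]_n => x 0 i).
Proof. by apply: coord_continuous. Qed.

(** The sigma-algebra is defined through the coordinates; this Borel description lets the Dynkin
    induction of [shift_continuous_indic] start from the open sets, which are stable under
    intersection. *)
Lemma measurable_rV_open :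
  @measurable _ 'rV[R]_n = <<s [set U : set 'rV[R]_n | open U] >>.
Proof.
apply/seteqP; split => A mA; last first.
  apply: mA; split; first exact: sigma_algebra_measurable.
  by move=> U oU; exact: open_measurable_rV.
suff : g_sigma_preimage (@rV_coord R n) `<=` <<s [set U : set 'rV[R]_n | open U] >>.
  by apply; exact: mA.
apply: smallest_sub; first exact: smallest_sigma_algebra.
move=> B; rewrite -bigcup_seq/= => -[i _ [C mC <-]].
pose S := [set C : set (measurableTypeR R) |
  <<s [set U : set 'rV[R]_n | open U] >> (@rV_coord R n i @^-1` C)].
rewrite setTI.
suff : @measurable _ (measurableTypeR R) `<=` S by apply; exact: mC.
rewrite RGenOpens.measurableE; apply: smallest_sub.
  split; rewrite /S /=.
  - by rewrite preimage_set0; exact: sigma_algebra0.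
  - by move=> D hD; rewrite setTD; exact: sigma_algebraC.
  - by move=> F hF; rewrite preimage_bigcup; exact: sigma_algebra_bigcup.
move=> D [a [b ->]]; apply: sub_sigma_algebra => /=.
apply: open_comp; last exact: interval_open.
by move=> x _; exact: rV_coord_continuous.
Qed.

Lemma measurable_fun_cont (f : 'rV[R]_n -> R) : continuous f -> measurable_fun setT f.
Proof.
move=> cf; apply: (measurability _ (RGenOpens.measurableE R)).
move=> _ [_ [a [b ->]] <-]; rewrite setTI; apply: open_measurable_rV.
by apply: open_comp => [x _|]; [exact: cf|exact: interval_open].
Qed.

End rV_measure.

Section lebesgue_rV_theory.
Variable R : realType.
Local Open Scope ereal_scope.
Local Notation lam := (@lebesgue_measure R).

Lemma cons_rV_head n (p : measurableTypeR R * 'rV[R]_n) : cons_rV p 0%R ord0 = p.1.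
Proof. by rewrite -[in RHS](cons_rVK p). Qed.

Lemma cons_rV_tail n (p : measurableTypeR R * 'rV[R]_n) j :
  cons_rV p 0%R (lift ord0 j) = p.2 0%R j.
Proof.
have -> : p.2 = rsubmx (cons_rV p : 'rV_(1 + n)) by rewrite -[in LHS](cons_rVK p).
by rewrite [RHS]mxE (_ : lift ord0 j = rshift 1 j)//; exact/val_inj.
Qed.

(** Tonelli, splitting off the first coordinate: the induction step that carries translation
    invariance from dimension one to dimension [n]. *)
Lemma lebesgue_rVS n (f : 'rV[R]_n.+1 -> \bar R) :
  measurable_fun setT f -> (forall x, 0 <= f x) ->
  \int[lebesgue_rV R n.+1]_x f x =
  \int[lam]_t \int[lebesgue_rV R n]_v f (cons_rV (t, v)).
Proof.
move=> mf f0.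
transitivity (\int[lam \x lebesgue_rV R n]_p f (cons_rV p)).
  rewrite -[RHS](@ge0_integral_pushforward _ _ _ _ _ (@cons_rV R n)
     (@measurable_cons_rV R n) _ setT)//.
rewrite fubini_tonelli1//=.
by apply: measurableT_comp => //; exact: measurable_cons_rV.
Qed.

(** Lebesgue measure is determined by its values on half-open intervals, whose length a translation
    preserves. *)
Lemma lebesgue_measure_shift (a : R) (A : set (measurableTypeR R)) : measurable A ->
  pushforward lam (fun t : measurableTypeR R => (t + a)%R : measurableTypeR R) A = lam A.
Proof.
have ms : measurable_fun setT (fun t : measurableTypeR R => (t + a)%R : measurableTypeR R).
  by apply: measurable_funD.
move=> mA.
pose ms_ := isMeasurableFun.Build _ _ _ _ _ ms.
pose s : {mfun measurableTypeR R >-> measurableTypeR R} :=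
  HB.pack (fun t : measurableTypeR R => (t + a)%R : measurableTypeR R) ms_.
apply/esym/(@lebesgue_measure_unique _ (pushforward lam s)) => //.
move=> _ [[x y] _ <-]; apply/esym; rewrite /pushforward.
rewrite [X in lam X = _](_ : _ = `](x - a), (y - a)]%classic)%R; last first.
  by apply/seteqP; split => t; rewrite /= !in_itv/= ltrBlDr lerBrDr.
rewrite !lebesgue_measure_itv/= !lte_fin ltrD2r.
by case: ifPn => // _; rewrite -!EFinD; congr (_%:E); ring.
Qed.

Lemma ge0_integral_shift (a : R) (f : measurableTypeR R -> \bar R) :
  measurable_fun setT f -> (forall x, 0 <= f x) ->
  \int[lam]_t f (t + a)%R = \int[lam]_t f t.
Proof.
move=> mf f0.
have ms : measurable_fun setT (fun t : measurableTypeR R => (t + a)%R : measurableTypeR R).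
  by apply: measurable_funD.
rewrite -[LHS](@ge0_integral_pushforward _ _ _ _ _ _ ms lam setT)//.
apply: eq_measure_integral => A mA _; exact: lebesgue_measure_shift.
Qed.

Lemma measurable_rV_shift n (a : 'rV[R]_n) : measurable_fun setT (fun x : 'rV[R]_n => x + a)%R.
Proof.
apply: measurable_fun_rV => i.
rewrite (_ : _ \o _ = fun x => @rV_coord R n i x + a 0 i)%R; last first.
  by apply/funext => x; rewrite /rV_coord /= mxE.
by apply: measurable_funD => //; exact: measurable_rV_coord.
Qed.

Lemma ge0_integral_rV_shift n (a : 'rV[R]_n) (f : 'rV[R]_n -> \bar R) :
  measurable_fun setT f -> (forall x, 0 <= f x) ->
  \int[lebesgue_rV R n]_x f (x + a)%R = \int[lebesgue_rV R n]_x f x.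
Proof.
elim: n a f => [|n ih] a f mf f0.
  by apply: eq_integral => x _; congr f; apply/rowP => -[].
rewrite [RHS](lebesgue_rVS mf f0) lebesgue_rVS; last 2 first.
- by apply: (measurableT_comp mf); exact: measurable_rV_shift.
- by move=> x; exact: f0.
transitivity (\int[lam]_t \int[lebesgue_rV R n]_v f (cons_rV ((t + a ord0 ord0)%R, v))).
  apply: eq_integral => t _.
  rewrite -(ih (rsubmx (a : 'rV_(1 + n))) (fun v => f (cons_rV ((t + a ord0 ord0)%R, v))))//.
    apply: eq_integral => v _; congr f.
    apply/rowP => i; rewrite mxE; case: (unliftP ord0 i) => [j ->|->].
      by rewrite !cons_rV_tail/= !mxE; congr (_ + a _ _)%R; exact/val_inj.
    by rewrite !cons_rV_head.
  apply: (@measurableT_comp _ _ _ _ _ _ f) => //.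
  apply: (@measurableT_comp _ _ _ _ _ _ (@cons_rV R n)); first exact: measurable_cons_rV.
  exact: measurable_pair1.
rewrite (ge0_integral_shift _ (f := fun t => \int[lebesgue_rV R n]_v f (cons_rV (t, v))))//.
  apply: (measurable_fun_fubini_tonelli_F (f \o @cons_rV R n)).
    apply: (measurableT_comp mf); exact: measurable_cons_rV.
  by move=> x; exact: f0.
by move=> x; apply: integral_ge0 => v _; exact: f0.
Qed.

Lemma lebesgue_rV_box n (A : 'I_n -> set (measurableTypeR R)) :
  (forall i, measurable (A i)) ->
  lebesgue_rV R n [set x : 'rV[R]_n | forall i, A i (x 0%R i)] = \prod_(i < n) lam (A i).
Proof.
elim: n A => [|n ih] A mA.
  rewrite big_ord0 /= (_ : mkset _ = setT) ?diracT//.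
  by apply/seteqP; split => // x _ [].
rewrite big_ord_recl/= -ih => [|i]; last exact: mA.
rewrite -cons_measureX//; last first.
  by apply: (@measurable_box _ _ (fun i => A (lift ord0 i))) => i; exact: mA.
congr (cons_measure _ _); apply/seteqP; split => x /=.
  move=> h; split => //= i; rewrite mxE; have := h (lift ord0 i).
  by congr (A _ (x _ _)); apply/val_inj.
move=> [h0 h] i; case: (unliftP ord0 i) => [j ->|->//].
by have := h j; rewrite mxE; congr (A _ (x _ _)); apply/val_inj.
Qed.

(** Balls of the sup norm are cubes of side [2 * e]. The value serves twice: finite, it bounds the
    measure of bounded sets; positive, it makes kernels normalizable. *)
Lemma lebesgue_rV_ball n (x : 'rV[R]_n) (e : R) : (0 < e)%R ->
  lebesgue_rV R n (ball x e) = ((e *+ 2) ^+ n)%:E.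
Proof.
move=> e0.
rewrite (_ : ball x e = [set y : 'rV[R]_n | forall i, ball (x 0 i) e (y 0 i)])%R.
  rewrite (@lebesgue_rV_box _ (fun i => ball (x 0%R i) e)); last first.
    by move=> i; exact: measurable_ball.
  under eq_bigr do rewrite lebesgue_measure_ball// ?ltW//.
  by rewrite prodEFin prodr_const card_ord.
apply/seteqP; split => y.
  by rewrite -ball_normE /= rV_norm_lt// => /forallP h i; have := h i; rewrite !mxE -ball_normE.
move=> h; rewrite -ball_normE /= rV_norm_lt//; apply/forallP => i.
by have := h i; rewrite !mxE -ball_normE.
Qed.

End lebesgue_rV_theory.

(** * Square-integrable functions *)

Section square_integrable.
Context d (T : measurableType d) (R : realType) (mu : {measure set T -> \bar R}).
Implicit Types f g h : T -> R.

Definition sqint f := measurable_fun setT f /\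
  mu.-integrable setT (EFin \o (fun x => f x ^+ 2)).

Definition dot f g : R := \int[mu]_x (f x * g x).

(** Squared norms are used throughout: [sqnB_tri], with its factors 2, replaces the triangle
    inequality, and square roots appear only next to Cauchy-Schwarz and in the norms of the
    statement. *)
Definition sqn f := dot f f.

Lemma sqintP f : sqint f <-> measurable_fun setT f /\
  (\int[mu]_x (f x ^+ 2)%:E < +oo)%E.
Proof.
split=> -[mf].
  move=> /integrableP[_ h]; split => //.
  by under eq_integral do rewrite -[X in X%:E]ger0_norm ?sqr_ge0//.
move=> h; split => //; apply/integrableP; split.
  by apply/measurable_EFinP; exact: measurable_funX.
by under eq_integral do rewrite /= ger0_norm ?sqr_ge0//.
Qed.

Lemma sqint_dom f g h : measurable_fun setT f -> sqint g -> sqint h ->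
  (forall x, `|f x| <= `|g x| + `|h x|) -> sqint f.
Proof.
move=> mf [mg ig] [mh ih] fgh; split => //.
apply: (@le_integrable _ _ _ mu setT measurableT _
    (fun x => (2 * (g x ^+ 2) + 2 * (h x ^+ 2))%:E)).
- by apply/measurable_EFinP; exact: measurable_funX.
- move=> x _ /=; rewrite lee_fin (ger0_norm (sqr_ge0 _)) ger0_norm; last first.
    by rewrite addr_ge0// mulr_ge0 ?sqr_ge0.
  rewrite -(real_normK (num_real (f x))).
  rewrite -(real_normK (num_real (g x))) -(real_normK (num_real (h x))).
  have := fgh x; have := normr_ge0 (f x); move: `|f x| `|g x| `|h x| => a b c a0 abc.
  have := sqr_ge0 (b - c); nra.
- apply: (integrableD measurableT (f := fun x => (2 * g x ^+ 2)%:E)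
    (g := fun x => (2 * h x ^+ 2)%:E)); under eq_fun do rewrite EFinM;
  exact: integrableZl.
Qed.

Lemma sqint0 : sqint (cst 0).
Proof.
split=> //; apply: (eq_integrable _ (cst 0%E)) => //; last exact: integrable0.
by move=> x _ /=; rewrite expr0n.
Qed.

Lemma sqint_le f g : measurable_fun setT f -> sqint g ->
  (forall x, `|f x| <= `|g x|) -> sqint f.
Proof.
move=> mf ig fg; apply: (sqint_dom mf ig sqint0) => x.
by rewrite /= normr0 addr0.
Qed.

Lemma sqintD f g : sqint f -> sqint g -> sqint (fun x => f x + g x).
Proof.
move=> if_ ig; apply: (sqint_dom _ if_ ig); last by move=> x; exact: ler_normD.
by apply: measurable_funD; [exact: if_.1|exact: ig.1].
Qed.

Lemma sqint_bnd f (b : T -> R) (M : R) : measurable_fun setT b -> (forall x, `|b x| <= M) ->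
  sqint f -> sqint (fun x => b x * f x).
Proof.
move=> mb bM [mf if_]; split; first exact: measurable_funM.
apply: (@le_integrable _ _ _ mu setT measurableT _ (fun x => (M ^+ 2 * f x ^+ 2)%:E)).
- by apply/measurable_EFinP; apply: measurable_funX; exact: measurable_funM.
- move=> x _; rewrite /= lee_fin (ger0_norm (sqr_ge0 _)) ger0_norm; last by apply: mulr_ge0; exact: sqr_ge0.
  rewrite exprMn ler_wpM2r ?sqr_ge0// -(real_normK (num_real (b x))).
  by rewrite lerXn2r ?nnegrE// (le_trans _ (bM x)).
- by under eq_fun do rewrite EFinM; exact: integrableZl.
Qed.

Lemma sqintZ (a : R) f : sqint f -> sqint (fun x => a * f x).
Proof. by apply: (@sqint_bnd f (cst a) `|a|). Qed.

Lemma sqintN f : sqint f -> sqint (fun x => - f x).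
Proof.
move=> sf; rewrite (_ : (fun _ => _) = fun x => (-1) * f x); first exact: sqintZ.
by apply/funext => x; rewrite mulN1r.
Qed.

Lemma sqintB f g : sqint f -> sqint g -> sqint (fun x => f x - g x).
Proof. by move=> sf sg; apply: sqintD => //; exact: sqintN. Qed.

Lemma sqint_sum n (f : 'I_n -> T -> R) : (forall i, sqint (f i)) ->
  sqint (fun x => \sum_(i < n) f i x).
Proof.
elim: n f => [|n ih] f hf.
  by under eq_fun do rewrite big_ord0; exact: sqint0.
under eq_fun do rewrite big_ord_recr; apply: sqintD; last exact: hf.
by apply: (ih (fun i => f (widen_ord (leqnSn n) i))) => i; exact: hf.
Qed.

Lemma sqint_restrict f (D : set T) : measurable D -> sqint f -> sqint (f \_ D).
Proof.
move=> mD sf; apply: (@sqint_le _ f) => //.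
  apply/(measurable_restrictT f mD); apply: measurable_funTS; exact: sf.1.
by move=> x; rewrite patchE; case: ifPn => // _; rewrite normr0.
Qed.

Lemma sqint_integrable f g : sqint f -> sqint g ->
  mu.-integrable setT (EFin \o (fun x => f x * g x)).
Proof.
move=> [mf if_] [mg ig].
apply: (@le_integrable _ _ _ mu setT measurableT _ (fun x => (f x ^+ 2 + g x ^+ 2)%:E)).
- by apply/measurable_EFinP; exact: measurable_funM.
- move=> x _; rewrite /= lee_fin [leRHS]ger0_norm ?addr_ge0 ?sqr_ge0//.
  rewrite ler_norml; apply/andP; split.
    have := sqr_ge0 (f x + g x); have := sqr_ge0 (f x); have := sqr_ge0 (g x); nra.
  have := sqr_ge0 (f x - g x); have := sqr_ge0 (f x); have := sqr_ge0 (g x); nra.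
- exact: (integrableD measurableT if_ ig).
Qed.

Lemma dotC f g : dot f g = dot g f.
Proof. by rewrite /dot; under eq_Rintegral do rewrite mulrC. Qed.

Lemma dotDl f g h : sqint f -> sqint g -> sqint h ->
  dot (fun x => f x + g x) h = dot f h + dot g h.
Proof.
move=> sf sg sh; rewrite /dot -RintegralD//; try exact: sqint_integrable.
by apply: eq_Rintegral => x _; rewrite mulrDl.
Qed.

Lemma dotZl (a : R) f h : sqint f -> sqint h ->
  dot (fun x => a * f x) h = a * dot f h.
Proof.
move=> sf sh; rewrite /dot -RintegralZl//; try exact: sqint_integrable.
by apply: eq_Rintegral => x _; rewrite mulrA.
Qed.

Lemma dotNl f h : sqint f -> sqint h -> dot (fun x => - f x) h = - dot f h.
Proof.
by move=> sf sh; rewrite -mulN1r -dotZl//; congr dot; apply/funext => x; rewrite mulN1r.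
Qed.

Lemma dotBl f g h : sqint f -> sqint g -> sqint h ->
  dot (fun x => f x - g x) h = dot f h - dot g h.
Proof. by move=> sf sg sh; rewrite dotDl ?dotNl//; exact: sqintN. Qed.

Lemma dotDr f g h : sqint f -> sqint g -> sqint h ->
  dot h (fun x => f x + g x) = dot h f + dot h g.
Proof. by move=> *; rewrite dotC dotDl// !(dotC h). Qed.

Lemma dotZr (a : R) f h : sqint f -> sqint h ->
  dot h (fun x => a * f x) = a * dot h f.
Proof. by move=> *; rewrite dotC dotZl// (dotC h). Qed.

Lemma dotBr f g h : sqint f -> sqint g -> sqint h ->
  dot h (fun x => f x - g x) = dot h f - dot h g.
Proof. by move=> *; rewrite dotC dotBl// !(dotC h). Qed.

Lemma dotNr f h : sqint f -> sqint h -> dot h (fun x => - f x) = - dot h f.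
Proof. by move=> *; rewrite dotC dotNl// (dotC h). Qed.

Lemma dot0l h : dot (cst 0) h = 0.
Proof. by rewrite /dot; under eq_Rintegral do rewrite /= mul0r; rewrite Rintegral_cst//= mul0r. Qed.

Lemma dot_suml n (f : 'I_n -> T -> R) h : (forall i, sqint (f i)) -> sqint h ->
  dot (fun x => \sum_(i < n) f i x) h = \sum_(i < n) dot (f i) h.
Proof.
elim: n f => [|n ih] f hf hh.
  by under eq_fun do rewrite big_ord0; rewrite big_ord0; exact: dot0l.
under eq_fun do rewrite big_ord_recr; rewrite big_ord_recr dotDl//; last first.
  by apply: sqint_sum => i; exact: hf.
by rewrite (ih (fun i => f (widen_ord (leqnSn n) i))).
Qed.

Lemma sqn_ge0 f : 0 <= sqn f.
Proof. by apply: Rintegral_ge0 => x _; rewrite -expr2 sqr_ge0. Qed.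

Lemma sqnE f : sqint f -> (sqn f)%:E = (\int[mu]_x (f x ^+ 2)%:E)%E.
Proof.
move=> [mf if_]; rewrite /sqn /dot /Rintegral fineK.
  by apply: eq_integral => x _; rewrite expr2.
by apply: integrable_fin_num => //.
Qed.

Lemma sqnZ (a : R) f : sqint f -> sqn (fun x => a * f x) = a ^+ 2 * sqn f.
Proof. by move=> sf; rewrite /sqn dotZl ?dotZr ?mulrA ?expr2//; exact: sqintZ. Qed.

Lemma sqnN f : sqn (fun x => - f x) = sqn f.
Proof. by apply: eq_Rintegral => x _; rewrite mulrNN. Qed.

Lemma sqnBC f g : sqn (fun x => f x - g x) = sqn (fun x => g x - f x).
Proof. by apply: eq_Rintegral => x _; rewrite -mulrNN !opprB. Qed.

Lemma sqnDE f g : sqint f -> sqint g ->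
  sqn (fun x => f x + g x) = sqn f + 2 * dot f g + sqn g.
Proof.
move=> sf sg; have sfg := sqintD sf sg.
rewrite /sqn dotDl// !dotDr// (dotC g f); ring.
Qed.

Lemma sqnBE f g : sqint f -> sqint g ->
  sqn (fun x => f x - g x) = sqn f - 2 * dot f g + sqn g.
Proof.
move=> sf sg; rewrite (sqnDE sf (sqintN sg)) dotNr// sqnN; ring.
Qed.

Lemma le_sqn f g : sqint f -> sqint g -> (forall x, `|f x| <= `|g x|) -> sqn f <= sqn g.
Proof.
move=> sf sg fg; apply: le_Rintegral => //; try exact: sqint_integrable.
move=> x _; rewrite -!expr2 -(real_normK (num_real (f x))) -(real_normK (num_real (g x))).
by rewrite lerXn2r ?nnegrE.
Qed.

Lemma sqnD_le f g : sqint f -> sqint g ->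
  sqn (fun x => f x + g x) <= 2 * sqn f + 2 * sqn g.
Proof.
move=> sf sg; have := sqn_ge0 (fun x => f x - g x).
rewrite (sqnDE sf sg) (sqnBE sf sg); lra.
Qed.

Lemma sqnB_tri f g h : sqint f -> sqint g -> sqint h ->
  sqn (fun x => f x - h x) <= 2 * sqn (fun x => f x - g x) + 2 * sqn (fun x => g x - h x).
Proof.
move=> sf sg sh; rewrite (_ : (fun x => f x - h x) = fun x => (f x - g x) + (g x - h x)).
  by apply: sqnD_le; exact: sqintB.
by apply/funext => x; ring.
Qed.

(** The quadratic polynomial of [t] given by the squared norm of [t * f - g] is nonnegative. *)
Lemma cauchy_schwarz f g : sqint f -> sqint g -> dot f g ^+ 2 <= sqn f * sqn g.
Proof.
move=> sf sg.
have h t : 0 <= t ^+ 2 * sqn f - 2 * t * dot f g + sqn g.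
  have := sqn_ge0 (fun x => t * f x - g x).
  by rewrite (sqnBE (sqintZ t sf) sg) sqnZ// dotZl// mulrA.
have [f0|f0] := eqVneq (sqn f) 0.
  rewrite f0 mul0r; have [->|a0] := eqVneq (dot f g) 0; first by rewrite expr0n.
  (* With [sqn f = 0] the polynomial is affine in [t], and this value of [t] would make it equal to
     -1. *)
  have := h ((sqn g + 1) / (2 * dot f g)); rewrite f0.
  rewrite (_ : _ + sqn g = -1) ?oppr_ge0 ?ler10//.
  by field; rewrite a0.
have fp : 0 < sqn f by rewrite lt_neqAle eq_sym f0 sqn_ge0.
(* The minimizer of the polynomial. *)
have := h (dot f g / sqn f).
move/(ler_wpM2l (ltW fp)); rewrite mulr0 => {}h.
rewrite -subr_ge0; apply: le_trans h _; rewrite le_eqVlt; apply/orP; left; apply/eqP.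
by field.
Qed.

Lemma norm_dot_le f g : sqint f -> sqint g ->
  `|dot f g| <= Num.sqrt (sqn f) * Num.sqrt (sqn g).
Proof.
move=> sf sg; rewrite -sqrtrM ?sqn_ge0// -sqrtr_sqr.
by rewrite ler_sqrt ?mulr_ge0 ?sqn_ge0//; exact: cauchy_schwarz.
Qed.

Lemma dot_sqn0 f g : sqint f -> sqint g -> sqn f = 0 -> dot f g = 0.
Proof.
move=> sf sg f0; apply/eqP; rewrite -sqrf_eq0 eq_le sqr_ge0 andbT.
by have := cauchy_schwarz sf sg; rewrite f0 mul0r.
Qed.

(** Almost everywhere equality is expressed as [sqn (f - g) = 0]. This form suits weak derivatives,
    which are chosen by [xget] and so are known only up to a null set. *)
Lemma sqn_eq f g : sqint f -> sqint g -> sqn (fun x => f x - g x) = 0 -> sqn f = sqn g.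
Proof.
move=> sf sg fg0.
have hf : dot f f = dot g f.
  by apply/eqP; rewrite -subr_eq0 -dotBl// (dot_sqn0 _ _ fg0)//; exact: sqintB.
have hg : dot f g = dot g g.
  by apply/eqP; rewrite -subr_eq0 -dotBl// (dot_sqn0 _ _ fg0)//; exact: sqintB.
by rewrite /sqn hf dotC hg.
Qed.

End square_integrable.

Lemma geometric_step_cvg (R : realType) (u : R ^nat) (C : R) :
  (forall k, `|u k.+1 - u k| <= C / 2 ^+ k) -> cvgn u.
Proof.
move=> hu; have C0 : 0 <= C.
  by have := le_trans (normr_ge0 _) (hu 0%N); rewrite expr0 divr1.
have : cvgn (series (telescope u)).
  apply: normed_cvg; apply: (@series_le_cvg _ _ (geometric C 2^-1)).
  - by move=> n; exact: normr_ge0.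
  - by move=> n; rewrite /geometric /= mulr_ge0// exprn_ge0// invr_ge0.
  - by move=> n; rewrite /geometric /= exprVn; exact: hu.
  - by apply: is_cvg_geometric_series; rewrite ger0_norm ?invr_ge0// invf_lt1// ltr1n.
rewrite telescopeK => h.
rewrite (_ : u = (fun n => (u n - u 0%N) + u 0%N)).
  by apply: is_cvgD => //; exact: is_cvg_cst.
by apply/funext => n; rewrite subrK.
Qed.

(** * Completeness of L^2 *)

Section completeness.
Context d (T : measurableType d) (R : realType) (mu : {measure set T -> \bar R}).
Implicit Types (f : nat -> T -> R) (g : T -> R).

Lemma ae_cvg_of_geometric_steps f : (forall n, sqint mu (f n)) ->
  (forall k, sqn mu (fun x => f k.+1 x - f k x) <= (2 * 8 ^+ k)^-1) ->
  {ae mu, forall x, cvgn (fun k => f k x)}.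
Proof.
move=> sf hf.
(* The weight [4 ^+ k] still leaves integrals at most [1 / 2 ^ (k + 1)], with a finite sum [h].
   Where [h x] is finite, the k-th step is at most [Num.sqrt (h x) / 2 ^+ k], hence summable. *)
pose t k x : R := 4 ^+ k * (f k.+1 x - f k x) ^+ 2.
have t0 k x : 0 <= t k x by apply: mulr_ge0; [rewrite exprn_ge0|exact: sqr_ge0].
have sB k : sqint mu (fun x => f k.+1 x - f k x) by apply: sqintB.
have mt k : measurable_fun setT (t k).
  by apply: measurable_funM => //; apply: measurable_funX; exact: (sB k).1.
pose h x := (\sum_(k <oo) (t k x)%:E)%E.
have mh : measurable_fun setT h.
  apply: ge0_emeasurable_sum => // k; first by move=> x _ _; rewrite lee_fin.
  by move=> _; apply/measurable_EFinP.
have h0 x : (0 <= h x)%E by apply: nneseries_ge0 => k _ _; rewrite lee_fin.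
have ih : mu.-integrable setT h.
  apply/integrableP; split => //.
  under eq_integral do rewrite gee0_abs//.
  rewrite integral_nneseries//; last 2 first.
  - by move=> k; apply/measurable_EFinP.
  - by move=> k x _; rewrite lee_fin.
  apply: (@le_lt_trans _ _ (\sum_(k <oo) (1 / (2 ^ (k + 1))%:R)%:E)%E); last first.
    by rewrite (cvg_lim _ (@cvg_geometric_eseries_half R 1 0))// ltry.
  apply: lee_nneseries => k _; first by move=> _; apply: integral_ge0 => x _; rewrite lee_fin.
  under eq_integral do rewrite /t EFinM.
  rewrite integralZl//; last exact: (sB k).2.
  rewrite -sqnE// -EFinM lee_fin.
  apply: (@le_trans _ _ (4 ^+ k * (2 * 8 ^+ k)^-1)).
    by rewrite ler_wpM2l// exprn_ge0.
  rewrite natrX exprD expr1 (_ : 8 = 4 * 2) -?natrM// natrM exprMn.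
  rewrite le_eqVlt; apply/orP; left; apply/eqP; field.
  by rewrite !expf_neq0.
have := integrable_ae measurableT ih.
apply: filterS => x /(_ I) hx; apply: (@geometric_step_cvg _ _ (Num.sqrt (fine (h x)))) => k.
have tk : t k x <= fine (h x).
  rewrite -lee_fin fineK//.
  apply: le_trans (nneseries_lim_ge k.+1 _); last by move=> i _; rewrite lee_fin.
  rewrite sumEFin lee_fin big_nat_recr//= lerDr.
  by apply: sumr_ge0 => i _; exact: t0.
rewrite ler_pdivlMr ?exprn_gt0// -(@ger0_norm _ (2 ^+ k)) ?exprn_ge0// -normrM -sqrtr_sqr.
rewrite ler_sqrt ?fine_ge0//; apply: le_trans tk; rewrite /t exprMn mulrC.
by rewrite -exprM mulnC exprM (_ : 2 ^+ 2 = 4)//; ring.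
Qed.

(** Fatou's lemma: an L^2 bound survives an almost everywhere limit, and the limit need not be
    assumed square-integrable. *)
Lemma fatou_sqn f g (e : R) : (forall n, sqint mu (f n)) -> measurable_fun setT g ->
  {ae mu, forall x, f n x @[n --> \oo] --> g x} ->
  (\forall n \near \oo, sqn mu (f n) <= e) ->
  sqint mu g /\ sqn mu g <= e.
Proof.
move=> sf mg fg fe.
have e0 : 0 <= e.
  by near \oo => n; apply: (le_trans (sqn_ge0 mu (f n))); near: n.
have mf2 n : measurable_fun setT (fun x => (f n x ^+ 2)%:E).
  by apply/measurable_EFinP; apply: measurable_funX; exact: (sf n).1.
have mg2 : measurable_fun setT (fun x => (g x ^+ 2)%:E).
  by apply/measurable_EFinP; apply: measurable_funX.
have le : (\int[mu]_x (g x ^+ 2)%:E <= e%:E)%E.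
  apply: (@le_trans _ _ (\int[mu]_x limn_einf (fun n => (f n x ^+ 2)%:E))%E).
    apply: ae_ge0_le_integral => //.
    - by move=> x _; rewrite lee_fin sqr_ge0.
    - move=> x _; rewrite limn_einf_lim; apply: lime_ge; first exact: is_cvg_einfs.
      apply: nearW => n; apply: le_ereal_inf_tmp => _ [m /= nm <-].
      by rewrite lee_fin sqr_ge0.
    - rewrite (_ : (fun x => _) = (fun x => - limn_esup (fun n => - (f n x ^+ 2)%:E)))%E.
        apply: (measurableT_comp (@oppe_measurable R setT)).
        apply: measurable_fun_limn_esup => n.
        by apply: (measurableT_comp (@oppe_measurable R setT)).
      apply/funext => x; rewrite -limn_einfN; congr limn_einf.
      by apply/funext => n; rewrite [RHS]oppeK.
    - apply: filterS fg => x fx _.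
      have h : (f n x ^+ 2)%:E @[n --> \oo] --> (g x ^+ 2)%:E.
        by apply: cvg_EFin; [exact: nearW|under eq_fun do rewrite /= expr2; rewrite expr2; exact: cvgM].
      rewrite is_cvg_limn_einfE; last by apply/cvg_ex; eexists; exact: h.
      by rewrite (cvg_lim _ h).
  apply: le_trans (fatou mu measurableT mf2 _) _.
    by move=> n x _; rewrite lee_fin sqr_ge0.
  rewrite limn_einf_lim; apply: lime_le; first exact: is_cvg_einfs.
  apply: filterS fe => n hn; apply: (@le_trans _ _ (\int[mu]_x (f n x ^+ 2)%:E)%E).
    by apply: ereal_inf_lbound; exists n => /=.
  by rewrite -sqnE// lee_fin.
have sg : sqint mu g by apply/sqintP; split => //; apply: le_lt_trans le _; rewrite ltry.
by split => //; rewrite -lee_fin sqnE.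
Unshelve. all: by end_near. Qed.

(** Riesz-Fischer: a fast subsequence converges almost everywhere, and Fatou applied to
    [f m - f (s n)] in [n] turns the Cauchy property into convergence in norm of the whole
    sequence. *)
Lemma sqint_complete f : (forall n, sqint mu (f n)) ->
  (forall e, 0 < e -> exists N, forall m n, (N <= m)%N -> (N <= n)%N ->
    sqn mu (fun x => f m x - f n x) < e) ->
  exists g, sqint mu g /\ forall e, 0 < e ->
    exists N, forall n, (N <= n)%N -> sqn mu (fun x => f n x - g x) < e.
Proof.
move=> sf cf.
have /choice[N hN] : forall k, exists N, forall m n, (N <= m)%N -> (N <= n)%N ->
    sqn mu (fun x => f m x - f n x) < (2 * 8 ^+ k)^-1.
  by move=> k; apply: cf; rewrite invr_gt0 mulr_gt0// exprn_gt0.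
(* The sum puts [s k] above [N k] and makes [s] monotone; the summand [k] makes it tend to infinity
   even when all [N j] vanish. *)
pose s k := (k + \sum_(j < k.+1) N j)%N.
have sS k : (s k <= s k.+1)%N by rewrite /s [in leqRHS]big_ord_recr/= leq_add// leq_addr.
have sN k : (N k <= s k)%N by rewrite /s big_ord_recr/= addnA leq_addl.
have sk k : (k <= s k)%N by rewrite /s leq_addr.
(* An upper limit is measurable without knowing where the subsequence converges, and [fine] makes it
   real-valued everywhere. *)
pose G x := fine (limn_esup (fun k => (f (s k) x)%:E)).
have mG : measurable_fun setT G.
  apply: (measurableT_comp (@fine_measurable R setT measurableT)).
  by apply: measurable_fun_limn_esup => k; apply/measurable_EFinP; exact: (sf _).1.
have cG : {ae mu, forall x, f (s k) x @[k --> \oo] --> G x}.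
  have := @ae_cvg_of_geometric_steps (fun k => f (s k)) (fun k => sf _).
  move=> /(_ _)/filterS; apply.
    move=> x /cvg_ex[/= l hl].
  have h : (f (s k) x)%:E @[k --> \oo] --> l%:E by apply: cvg_EFin => //; exact: nearW.
  rewrite /G is_cvg_limn_esupE; last by apply/cvg_ex; eexists; exact: h.
    by rewrite (cvg_lim _ h).
  by move=> k; apply: ltW; apply: hN; [exact: leq_trans (sN k) (sS k)|exact: sN].
have key m e : (\forall n \near \oo, sqn mu (fun x => f m x - f (s n) x) <= e) ->
    sqint mu (fun x => f m x - G x) /\ sqn mu (fun x => f m x - G x) <= e.
  apply: (@fatou_sqn (fun k x => f m x - f (s k) x)).
  - by move=> n; exact: sqintB.
  - by apply: measurable_funB => //; exact: (sf m).1.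
  - by apply: filterS cG => x hx; apply: cvgB => //; exact: cvg_cst.
have cs m e N0 : (forall n, (N0 <= n)%N -> sqn mu (fun x => f m x - f n x) < e) ->
    sqint mu (fun x => f m x - G x) /\ sqn mu (fun x => f m x - G x) <= e.
  move=> h; apply: key; exists N0 => // n /= nN; apply/ltW/h; exact: leq_trans (sk n).
have sG : sqint mu G.
  have [N0 hN0] := cf 1 ltr01.
  have [h _] := cs N0 1 N0 (fun n => hN0 N0 n (leqnn _)).
  have := sqintB (sf N0) h; rewrite (_ : (fun x => _) = G)//.
  by apply/funext => x; ring.
exists G; split => // e e0; have [N0 hN0] := cf _ (divr_gt0 e0 (ltr0n R 2)).
exists N0 => n nN; have [_ h] := cs n _ N0 (fun m => hN0 n m nN).
by apply: le_lt_trans h _; lra.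
Qed.

End completeness.

Section sqn_limits.
Context d (T : measurableType d) (R : realType) (mu : {measure set T -> \bar R}).

Lemma sqn_dominated (f : nat -> T -> R) (l g : T -> R) :
  (forall n, measurable_fun setT (f n)) -> measurable_fun setT l -> sqint mu g ->
  (forall x, f n x @[n --> \oo] --> l x) -> (forall n x, `|f n x| <= `|g x|) ->
  sqn mu (fun x => f n x - l x) @[n --> \oo] --> (0 : R).
Proof.
move=> mf ml sg fl fg.
have lg x : `|l x| <= `|g x|.
  by apply: (ler_cvg_to (cvg_norm (fl x)) (cvg_cst _)); apply: nearW => n; exact: fg.
have sf n : sqint mu (f n) by apply: (sqint_le _ sg).
have sl : sqint mu l by apply: (sqint_le _ sg).
have := @dominated_convergence _ _ _ mu setT measurableT
  (fun n x => ((f n x - l x) ^+ 2)%:E) (cst 0%E) (fun x => (4 * g x ^+ 2)%:E).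
case.
- by move=> n; apply/measurable_EFinP/measurable_funX/measurable_funB.
- by [].
- apply: aeW => x _; apply: cvg_EFin; first exact: nearW.
  have h : f n x - l x @[n --> \oo] --> 0.
    by rewrite -[X in _ --> X](subrr (l x)); apply: cvgB; [exact: fl|exact: cvg_cst].
  rewrite -[0](mulr0 0); under eq_fun do rewrite /= expr2; exact: cvgM.
- under eq_fun do rewrite EFinM; apply: integrableZl => //; exact: sg.2.
- apply: aeW => x n _; rewrite /= lee_fin (ger0_norm (sqr_ge0 _)).
  rewrite -(real_normK (num_real (g x))) -(real_normK (num_real (f n x - l x))).
  rewrite (_ : 4 = 2 ^+ 2); last by ring.
  rewrite -exprMn lerXn2r ?nnegrE ?mulr_ge0//.
  by rewrite (le_trans (ler_normB _ _))// mulr_natl mulr2n lerD.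
move=> _ _; rewrite integral0 => h.
have -> : (fun n => sqn mu (fun x => f n x - l x)) =
    fine \o (fun n => (\int[mu]_x ((f n x - l x) ^+ 2)%:E)%E).
  by apply/funext => n /=; rewrite -sqnE//; exact: sqintB.
by apply: fine_cvg; exact: h.
Qed.

Lemma sqint_indic (A : set T) : measurable A -> (mu A < +oo)%E -> sqint mu (\1_A : T -> R).
Proof.
move=> mA Aoo; apply/sqintP; split; first exact: measurable_indic.
rewrite (_ : (\int[mu]_x _)%E = mu A)//.
transitivity (mu (A `&` setT)); last by rewrite setIT.
rewrite -integral_indic//; apply: eq_integral => x _.
by rewrite indicE; case: (x \in A); rewrite ?expr1n ?expr0n.
Qed.

End sqn_limits.

(** * Translation invariance and continuity of translations in L^2 *)

Section translation.
Variables (R : realType) (n : nat).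
Local Notation mu := (lebesgue_rV R n).
Implicit Types (f z : 'rV[R]_n -> R) (v : 'rV[R]_n).

Lemma integral_rV_shift v (f : 'rV[R]_n -> \bar R) : measurable_fun setT f ->
  (\int[mu]_x f (x + v)%R = \int[mu]_x f x)%E.
Proof.
move=> mf; rewrite integralE [RHS]integralE.
have h (g : 'rV[R]_n -> \bar R) : measurable_fun setT g ->
    (forall x, 0 <= g x)%E -> (\int[mu]_x g (x + v)%R = \int[mu]_x g x)%E.
  by move=> mg g0; exact: ge0_integral_rV_shift.
congr (_ - _)%E.
  rewrite -(h (f^\+)%E (measurable_funepos mf) (funepos_ge0 f)).
  by apply: eq_integral => x _; rewrite !funeposE.
rewrite -(h (f^\-)%E (measurable_funeneg mf) (funeneg_ge0 f)).
by apply: eq_integral => x _; rewrite !funenegE.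
Qed.

Lemma Rintegral_rV_shift v f : measurable_fun setT f ->
  \int[mu]_x f (x + v) = \int[mu]_x f x.
Proof.
move=> mf; congr fine; apply: (@integral_rV_shift v (EFin \o f)).
exact/measurable_EFinP.
Qed.

Lemma measurable_shift v f : measurable_fun setT f -> measurable_fun setT (fun x : 'rV[R]_n => f (x + v)).
Proof. by move=> mf; apply: (measurableT_comp mf); exact: measurable_rV_shift. Qed.

Lemma sqint_shift v f : sqint mu f -> sqint mu (fun x => f (x + v)).
Proof.
move=> /sqintP[mf foo]; apply/sqintP; split; first exact: measurable_shift.
rewrite (@integral_rV_shift v (fun x => (f x ^+ 2)%:E))//.
by apply/measurable_EFinP; exact: measurable_funX.
Qed.

Lemma sqn_shift v f : measurable_fun setT f -> sqn mu (fun x => f (x + v)) = sqn mu f.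
Proof.
by move=> mf; apply: (@Rintegral_rV_shift v (fun x => f x * f x)); exact: measurable_funM.
Qed.

Definition shift_continuous f := forall e, 0 < e -> exists2 D, 0 < D &
  forall v, `|v| < D -> sqn mu (fun x => f (x + v) - f x) < e.

Lemma shift_continuousD f z : sqint mu f -> sqint mu z ->
  shift_continuous f -> shift_continuous z -> shift_continuous (fun x => f x + z x).
Proof.
move=> sf sz cf cz e e0; have e4 : 0 < e / 4 by rewrite divr_gt0.
have [D D0 hD] := cf _ e4; have [D' D'0 hD'] := cz _ e4.
exists (Num.min D D'); first by rewrite lt_min D0.
move=> v; rewrite lt_min => /andP[vD vD'].
rewrite (_ : (fun x => _) = fun x => (f (x + v) - f x) + (z (x + v) - z x)); last first.
  by apply/funext => x; ring.
apply: (le_lt_trans (sqnD_le _ _)).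
- by apply: sqintB => //; exact: sqint_shift.
- by apply: sqintB => //; exact: sqint_shift.
- by have := hD _ vD; have := hD' _ vD'; lra.
Qed.

Lemma shift_continuousZ (a : R) f : sqint mu f ->
  shift_continuous f -> shift_continuous (fun x => a * f x).
Proof.
move=> sf cf e e0; have a1 : 0 < a ^+ 2 + 1 by rewrite ltr_wpDl// sqr_ge0.
have [D D0 hD] := cf _ (divr_gt0 e0 a1); exists D => // v /hD.
rewrite (_ : (fun x => a * _ - _) = fun x => a * (f (x + v) - f x)); last first.
  by apply/funext => x; ring.
rewrite sqnZ; last by apply: sqintB => //; exact: sqint_shift.
rewrite ltr_pdivlMr// => h; apply: le_lt_trans h.
by rewrite mulrC ler_wpM2l ?sqn_ge0// lerDl.
Qed.

Lemma shift_continuous_sum m (f : 'I_m -> 'rV[R]_n -> R) :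
  (forall i, sqint mu (f i)) -> (forall i, shift_continuous (f i)) ->
  shift_continuous (fun x => \sum_(i < m) f i x).
Proof.
elim: m f => [|m ih] f sf cf.
  move=> e e0; exists 1 => // v _; rewrite (_ : (fun x => _) = cst 0).
    by rewrite /sqn dot0l.
  by apply/funext => x; rewrite !big_ord0 subrr.
under [X in shift_continuous X]eq_fun do rewrite big_ord_recr.
apply: shift_continuousD => //; first by apply: sqint_sum => i; exact: sf.
by apply: (ih (fun i => f (widen_ord (leqnSn m) i))) => i; [exact: sf|exact: cf].
Qed.

(** The difference [f (x + v) - f x] splits through [z (x + v)] and [z x]; by translation invariance
    its two outer parts have the same norm. The factors 2 of [sqnB_tri] add up to 10, below the 16
    of [e / 16]. *)
Lemma shift_continuous_closed f : sqint mu f ->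
  (forall e, 0 < e -> exists z, [/\ sqint mu z, shift_continuous z &
     sqn mu (fun x => z x - f x) < e]) -> shift_continuous f.
Proof.
move=> sf hf e e0; have e8 : 0 < e / 16 by rewrite divr_gt0.
have [z [sz cz zf]] := hf _ e8; have [D D0 hD] := cz _ e8; exists D => // v /hD h.
have sfv := sqint_shift v sf; have szv := sqint_shift v sz.
have h1 := sqnB_tri sfv szv sf; have h2 := sqnB_tri szv sz sf.
have h3 : sqn mu (fun x => f (x + v) - z (x + v)) = sqn mu (fun x => z x - f x).
  by rewrite sqnBC (@sqn_shift v (fun x => z x - f x))//; exact: (sqintB sz sf).1.
by move: h1 h2 zf h; rewrite h3; lra.
Qed.

Lemma rV_measure_bounded (A : set 'rV[R]_n) (r : R) : measurable A ->
  (forall x, A x -> `|x| < r) -> (mu A < +oo)%E.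
Proof.
move=> mA Ar; case: (ltP 0 r) => r0; last first.
  rewrite (_ : A = set0) ?measure0 ?ltry//; apply/seteqP; split => // x /Ar.
  by move=> h; have := le_lt_trans (normr_ge0 x) h; rewrite ltNge r0.
apply: (@le_lt_trans _ _ (mu (ball 0 r))).
  apply: le_measure; rewrite ?inE//; first exact: measurable_rV_ball.
  by move=> x /Ar; rewrite -ball_normE /= sub0r normrN.
by rewrite lebesgue_rV_ball// ltry.
Qed.

Lemma indic_cvg1 (A : set 'rV[R]_n) (x : 'rV[R]_n) (v : nat -> 'rV[R]_n) :
  open A -> A x -> v k @[k --> \oo] --> (0 : 'rV[R]_n) ->
  \forall k \near \oo, A (x + v k).
Proof.
move=> oA Ax v0.
have : x + v k @[k --> \oo] --> x.
  by rewrite -[X in _ --> X]addr0; apply: cvgD => //; exact: cvg_cst.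
by apply; exact: open_nbhs_nbhs.
Qed.

(** By translation invariance the squared norm of [\1_A (x + v) - \1_A x] is twice the integral over
    [A] of [\1_A x - \1_A (x + v)]. Only points of [A] count, and there openness gives pointwise
    convergence as [v] tends to 0. *)
Lemma shift_continuous_open (A : set 'rV[R]_n) : open A -> (mu A < +oo)%E ->
  shift_continuous (\1_A : 'rV[R]_n -> R).
Proof.
move=> oA Aoo e e0; apply: contrapT => hN.
have mA : measurable A by exact: open_measurable_rV.
have sA := sqint_indic mA Aoo.
have /choice[v hv] : forall k : nat, exists v : 'rV[R]_n, `|v| < k.+1%:R^-1 /\
    e <= sqn mu (fun x => \1_A (x + v) - \1_A x).
  move=> k; apply: contrapT => h; apply: hN; exists k.+1%:R^-1; first by rewrite invr_gt0.
  by move=> v vk; rewrite ltNge; apply/negP => ev; apply: h; exists v.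
have v0 : v k @[k --> \oo] --> (0 : 'rV[R]_n).
  apply/cvgr0Pnorm_lt => d d0.
  have := near_infty_natSinv_lt (PosNum d0); apply: filterS => k /=.
  by apply: lt_trans; exact: (hv k).1.
(* The factor [\1_A x] discards the boundary points outside [A], where [\1_A (x + v k)] may fail to
   converge. [F] takes the values 0 and 1 only, so its squared norm is its integral. *)
pose F k x : R := (\1_A x - \1_A (x + v k)) * \1_A x.
have mF k : measurable_fun setT (F k).
  apply: measurable_funM; last exact: sA.1.
  by apply: measurable_funB; [exact: sA.1|exact: (sqint_shift _ sA).1].
have /cvgr0_norm_lt h0 : sqn mu (fun x => F k x - cst 0 x) @[k --> \oo] --> (0 : R).
  apply: (sqn_dominated mF _ sA); first exact: measurable_cst.
  - move=> x; apply: (@cvg_trans _ ((fun=> 0) @ \oo)); last exact: cvg_cst.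
    apply: near_eq_cvg; have [Ax|Ax] := pselect (A x); last first.
      by apply: nearW => k; rewrite /F !indicE (memNset Ax) mulr0.
    apply: filterS (indic_cvg1 oA Ax v0) => k Axk.
    by rewrite /F !indicE !mem_set// subrr mul0r.
  - move=> k x; rewrite /F !indicE; case: (x \in A); case: (_ \in A);
    by rewrite ?mulr0 ?mul0r ?subrr ?subr0 ?mul1r ?sub0r ?mulr1 ?mul0r ?normr0.
have [k _ /(_ k (leqnn _)) /=] := h0 _ (divr_gt0 e0 (ltr0n R 2)).
have sAv := sqint_shift (v k) sA.
have -> : sqn mu (fun x => F k x - cst 0 x) = dot mu (fun x => \1_A x - \1_A (x + v k)) \1_A.
  apply: eq_Rintegral => x _; rewrite /F /= subr0 !indicE.
  by case: (x \in A); case: (_ \in A); rewrite /=; ring.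
rewrite dotBl// => h; have := (hv k).2; rewrite sqnBE// sqn_shift ?sA.1//.
rewrite leNgt => /negP; apply.
have := ler_norm (dot mu (\1_A) (\1_A) - dot mu (fun x => \1_A (x + v k)) \1_A).
rewrite -/(sqn mu (\1_A)) in h *; lra.
Qed.

(** Dynkin induction from the open sets. Cutting by the bounded open set [B] keeps all measures
    finite, so that complements become differences in L^2 and disjoint unions become L^2 limits of
    finite sums. *)
Lemma shift_continuous_indic (A B : set 'rV[R]_n) (r : R) : open B ->
  (forall x, B x -> `|x| < r) -> measurable A ->
  shift_continuous (\1_(A `&` B) : 'rV[R]_n -> R).
Proof.
move=> oB Br mA; have mB : measurable B by exact: open_measurable_rV.
have foo (C : set 'rV[R]_n) : measurable C -> (mu (C `&` B) < +oo)%E.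
  move=> mC; apply: (@rV_measure_bounded _ r); first exact: measurableI.
  by move=> x [_]; exact: Br.
have sC (C : set 'rV[R]_n) : measurable C -> sqint mu (\1_(C `&` B) : 'rV[R]_n -> R).
  by move=> mC; apply: sqint_indic; [exact: measurableI|exact: foo].
rewrite measurable_rV_open in mA; move: A mA.
apply: (@dynkin_induction _ 'rV[R]_n _ (fun A => shift_continuous (\1_(A `&` B) : _ -> R))).
- exact: measurable_rV_open.
- by move=> U V /= oU oV; exact: openI.
- rewrite setTI; apply: shift_continuous_open; first exact: oB.
  by rewrite -(setTI B); exact: foo.
- move=> A oA; apply: shift_continuous_open; last by apply: foo; exact: open_measurable_rV.
  by apply: openI => //; exact: oB.
- move=> A mA cA.
  rewrite (_ : \1_(~` A `&` B) = fun x => \1_(setT `&` B) x + (-1) * \1_(A `&` B) x).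
    apply: shift_continuousD; first exact: sC.
    - by apply: sqintZ; exact: sC.
    - apply: shift_continuous_open; first by rewrite setTI; exact: oB.
      exact: foo.
    - by apply: shift_continuousZ => //; exact: sC.
  apply/funext => x; rewrite !indicI /= !indicE in_setC in_setT.
  by case: (x \in A) => /=; ring.
- move=> F mF tF cF; apply: shift_continuous_closed.
    by apply: sC; exact: bigcupT_measurable.
  move=> e e0.
  pose G k : 'rV[R]_n -> R := fun x => \sum_(i < k) \1_(F i `&` B) x.
  have sG k : sqint mu (G k) by apply: sqint_sum => i; exact: sC.
  have GE k x : G k x = \1_((\bigcup_(i < k) F i) `&` B) x.
    elim: k => [|k ih].
      by rewrite /G big_ord0 bigcup_mkord big_ord0 set0I indic0.
    have -> : \bigcup_(i < k.+1) F i = \bigcup_(i < k) F i `|` F k.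
      by rewrite !bigcup_mkord big_ord_recr.
    rewrite /G big_ord_recr/= -/(G k x) ih.
    rewrite !indicE !in_setI in_setU.
    case: (x \in B); rewrite ?andbF ?addr0// ?andbT.
    case: (boolP (x \in F k)) => xF; last by rewrite orbF addr0.
    rewrite orbT; case: (boolP (x \in _)) => //; last by rewrite add0r.
    rewrite inE => -[i /= ik Fix]; move/set_mem in xF.
    have ik' : i = k by apply: tF => //; exists x.
    by rewrite ik' ltnn in ik.
  have cG : sqn mu (fun x => G k x - \1_((\bigcup_k F k) `&` B) x) @[k --> \oo] --> (0 : R).
    apply: (sqn_dominated _ _ (sC setT measurableT)).
    - by move=> k; exact: (sG k).1.
    - by apply: measurable_indic; apply: measurableI => //; exact: bigcupT_measurable.
    - move=> x; apply: (@cvg_trans _ ((fun=> \1_((\bigcup_k F k) `&` B) x) @ \oo)); last exact: cvg_cst.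
      apply: near_eq_cvg; have [[k _ Fk]|Fx] := pselect ((\bigcup_k F k) x).
        exists k.+1 => // l /= kl; rewrite GE !indicE !in_setI; congr (_ && _)%:R.
        by rewrite !mem_set//; exists k.
      apply: nearW => l; rewrite GE !indicE !in_setI; congr (_ && _)%:R.
      by rewrite !memNset// => -[k _ Fk]; apply: Fx; exists k.
    - move=> k x; rewrite GE !indicE !in_setI in_setT.
      by case: (x \in B); case: (x \in _); rewrite /= ?normr0 ?normr1.
  move/cvgr0_norm_lt : cG => /(_ _ e0)[k _ /(_ k (leqnn _)) hk].
  exists (G k); split => //; first by apply: shift_continuous_sum => i; [exact: sC|exact: cF].
  by apply: le_lt_trans hk; exact: ler_norm.
Qed.

Import HBNNSimple.

Lemma shift_continuous_ge0 f : sqint mu f -> (forall x, 0 <= f x) -> shift_continuous f.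
Proof.
move=> sf f0; apply: shift_continuous_closed => // e e0.
have mf : measurable_fun setT (EFin \o f) by apply/measurable_EFinP; exact: sf.1.
pose a := nnsfun_approx measurableT mf.
(* Truncation to a ball makes the level sets bounded, as [shift_continuous_indic] requires; the
   balls exhaust the space, so [G] still converges to [f]. *)
pose G k x := a k x * \1_(ball 0 k%:R) x.
have Gf k x : `|G k x| <= `|f x|.
  rewrite /G ger0_norm ?mulr_ge0// ger0_norm//.
  apply: (@le_trans _ _ (a k x)); first by rewrite ler_piMr// indicE; case: (_ \in _).
  by rewrite -lee_fin /a nnsfun_approxE; apply: (@le_approx _ _ _ setT (EFin \o f)) => // y _; rewrite lee_fin.
have mG k : measurable_fun setT (G k) by apply: measurable_funM => //;
  apply: measurable_indic; exact: measurable_rV_ball.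
have : sqn mu (fun x => G k x - f x) @[k --> \oo] --> (0 : R).
  apply: (sqn_dominated mG sf.1 sf) => // x.
  rewrite -[X in _ --> X]mulr1; apply: cvgM.
    have := @cvg_nnsfun_approx _ _ _ _ measurableT _ mf (fun y _ => f0 y) x I.
    by move/fine_cvgP => -[_]; exact.
  apply: (@cvg_trans _ ((fun=> 1) @ \oo)); last exact: cvg_cst.
  apply: near_eq_cvg; exists (Num.bound `|x|) => // l /= xl.
  rewrite indicE mem_set// -ball_normE /= sub0r normrN.
  by apply: lt_le_trans (archi_boundP (normr_ge0 x)) _; rewrite ler_nat.
move/cvgr0_norm_lt => /(_ _ e0)[k _ /(_ k (leqnn _)) hk].
exists (G k); split => //; last by apply: le_lt_trans hk; exact: ler_norm.
  exact: (sqint_le (mG k) sf).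
pose s : seq R := finmap.enum_fset (fset_set (range (a k))).
have -> : G k = fun x => \sum_(i < size s) s`_i * \1_(a k @^-1` [set s`_i] `&` ball 0 k%:R) x.
  apply/funext => x; rewrite /G fimfunEord big_distrl/=; apply: eq_bigr => i _.
  by rewrite -mulrA indicI.
have foo (C : set 'rV[R]_n) : measurable C -> sqint mu (\1_(C `&` ball 0 k%:R) : _ -> R).
  move=> mC; apply: sqint_indic; first by apply: measurableI => //; exact: measurable_rV_ball.
  apply: (@rV_measure_bounded _ k%:R).
    by apply: measurableI => //; exact: measurable_rV_ball.
  by move=> x [_]; rewrite -ball_normE /= sub0r normrN.
apply: shift_continuous_sum => i.
  by apply: sqintZ; exact: foo.
apply: shift_continuousZ; first exact: foo.
apply: (@shift_continuous_indic _ _ k%:R) => //; first exact: ball_open.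
by move=> x; rewrite -ball_normE /= sub0r normrN.
Qed.

Theorem sqint_shift_continuous f : sqint mu f -> shift_continuous f.
Proof.
move=> sf.
have fE x : `|f x| = (f ^\+) x + (f ^\-) x by rewrite -[LHS]/((Num.norm \o f) x) -funrposDneg.
have sp : sqint mu (f ^\+).
  apply: (sqint_le _ sf); first by apply: measurable_funrpos; exact: sf.1.
  by move=> x; rewrite fE ger0_norm ?funrpos_ge0// lerDl funrneg_ge0.
have sn : sqint mu (f ^\-).
  apply: (sqint_le _ sf); first by apply: measurable_funrneg; exact: sf.1.
  by move=> x; rewrite fE ger0_norm ?funrneg_ge0// lerDr funrpos_ge0.
rewrite (_ : f = fun x => (f ^\+) x + (-1) * (f ^\-) x).
  apply: shift_continuousD => //; first exact: sqintZ.
  - by apply: shift_continuous_ge0 => // x; exact: funrpos_ge0.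
  - by apply: shift_continuousZ => //; apply: shift_continuous_ge0 => // x; exact: funrneg_ge0.
by apply/funext => x; rewrite mulN1r -[in LHS](funrposBneg f).
Qed.

End translation.

(** * Smooth functions *)

Section quadratic_remainder.
Context {R : realType} {V : normedModType R}.

(** A quadratic bound on the remainder can be integrated, unlike a little-o. The criterion serves
    both to differentiate [mollify] under the integral and to treat the flat function at 0. *)
Lemma quadratic_remainder_diff (f : V -> R) (df : {linear V -> R}) (x : V) (C r : R) :
  continuous df -> 0 < r ->
  (forall h, `|h| < r -> `|f (x + h) - f x - df h| <= C * `|h| ^+ 2) ->
  differentiable f x /\ 'd f x = df :> (V -> R).
Proof.
move=> cdf r0 H.
have e : f \o shift x = cst (f x) + df +o_ 0 id.
  apply/eqaddoP => _/posnumP[e]; near=> h.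
  have C1 : 0 < `|C| + 1 by rewrite ltr_wpDl.
  have hr : `|h| < r by near: h; apply: nbhs0_lt.
  have he : `|h| <= e%:num / (`|C| + 1) by near: h; apply: nbhs0_le; rewrite divr_gt0.
  rewrite /= -[X in `|X|]/(f (h + x) - (f x + df h)) opprD addrA addrC [X in _ + X]addrC.
  rewrite (_ : _ + _ = f (x + h) - f x - df h); last by rewrite (addrC h x); ring.
  apply: le_trans (H _ hr) _; rewrite expr2 mulrA ler_wpM2r//.
  apply: le_trans (_ : (`|C| + 1) * `|h| <= _).
    by rewrite ler_wpM2r// (le_trans (ler_norm _))// lerDl.
  by rewrite mulrC -ler_pdivlMr.
have dE := diff_unique cdf e; split => //.
by apply/diff_locallyP; rewrite dE.
Unshelve. all: by end_near. Qed.

Lemma quadratic_remainder_differentiable (f df : V -> R) (x : V) (C r : R) :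
  linear df -> continuous df -> 0 < r ->
  (forall h, `|h| < r -> `|f (x + h) - f x - df h| <= C * `|h| ^+ 2) ->
  differentiable f x /\ forall v, 'D_v f x = df v.
Proof.
move=> lin cdf r0 H.
pose M := GRing.isLinear.Build _ _ _ _ _ lin.
pose L : {linear V -> R} := HB.pack df M.
have [d dE] := @quadratic_remainder_diff f L x C r cdf r0 H.
by split => // v; rewrite deriveE// dE.
Qed.

End quadratic_remainder.

(* Unfolding [derive] makes failing conversion tests prohibitively expensive,
   hence this locked copy of [pderiv]. *)
HB.lock Definition pd {R : realType} {n : nat} (s : seq 'I_n)
  (f : 'rV[R]_n -> R) : 'rV[R]_n -> R := pderiv s f.

Section smooth_theory.
Variables (R : realType) (n : nat).
Local Notation V := 'rV[R]_n.
Local Notation e_ i := (delta_mx 0 i : V).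
Implicit Types (f g : V -> R).

Lemma pdE s f : pd s f = pderiv s f.
Proof. by rewrite pd.unlock. Qed.

Lemma pderiv0 f : pd [::] f = f.
Proof. by rewrite pdE. Qed.

Lemma pderiv1E i f : pd [:: i] f = fun x => 'D_(e_ i) f x.
Proof. by rewrite pdE. Qed.

Lemma pderiv_cat s t f : pd (s ++ t) f = pd s (pd t f).
Proof. by rewrite !pdE /pderiv foldr_cat. Qed.

Lemma smooth_pderiv s f : smooth f -> smooth (pd s f).
Proof. by move=> sf t x; rewrite -pdE -pderiv_cat pdE; exact: sf. Qed.

Lemma smooth_differentiable f x : smooth f -> differentiable f x.
Proof. by move=> /(_ [::] x). Qed.

Lemma smooth_continuous f : smooth f -> continuous f.
Proof. by move=> sf x; apply: differentiable_continuous; exact: smooth_differentiable. Qed.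

(** Induction on the multi-index from its innermost derivative. [S] acts as a coinductive invariant,
    so smoothness of a family reduces to its stability under one derivative. *)
Lemma smooth_coind (S : set (V -> R)) :
  (forall f, S f -> (forall x, differentiable f x) /\ forall i, S (pd [:: i] f)) ->
  S `<=` @smooth R n.
Proof.
move=> hS f Sf s; elim/last_ind: s f Sf => [|s i ih] f Sf x; first exact: (hS _ Sf).1.
by rewrite -pdE -cats1 pderiv_cat pdE; apply: ih; exact: (hS _ Sf).2.
Qed.

(** Leibniz's rule turns one product into a sum of two, so products of smooth functions are not a
    stable class; the algebra generated by them is, and [smooth_coind] applies to it. *)
Inductive alg_closure (S : set (V -> R)) : (V -> R) -> Prop :=
| alg_base f : S f -> alg_closure S f
| alg_cst c : alg_closure S (fun=> c)
| alg_add f g : alg_closure S f -> alg_closure S g -> alg_closure S (fun x => f x + g x)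
| alg_mul f g : alg_closure S f -> alg_closure S g -> alg_closure S (fun x => f x * g x).

Lemma pderivD i f g : (forall x, differentiable f x) -> (forall x, differentiable g x) ->
  pd [:: i] (fun x => f x + g x) = fun x => pd [:: i] f x + pd [:: i] g x.
Proof.
move=> df dg; apply/funext => x.
by rewrite !pderiv1E (deriveD (f := f) (g := g))//; exact: diff_derivable.
Qed.

Lemma pderivM i f g : (forall x, differentiable f x) -> (forall x, differentiable g x) ->
  pd [:: i] (fun x => f x * g x) =
  fun x => pd [:: i] f x * g x + f x * pd [:: i] g x.
Proof.
move=> df dg; apply/funext => x.
rewrite !pderiv1E (@deriveM _ _ f g x _ (@diff_derivable _ _ _ f x _ (df x)) (@diff_derivable _ _ _ g x _ (dg x))).
by rewrite [LHS]addrC; congr (_ + _); exact: mulrC.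
Qed.

Lemma pderiv_cst (i : 'I_n) (c : R) : pd [:: i] (fun=> c) = fun=> 0.
Proof. by apply/funext => x; rewrite pderiv1E derive_cst. Qed.

Lemma alg_closure_smooth (S : set (V -> R)) :
  (forall f, S f -> (forall x, differentiable f x) /\
     forall i, alg_closure S (pd [:: i] f)) ->
  alg_closure S `<=` @smooth R n.
Proof.
move=> hS; apply: smooth_coind => f; elim=> {f}.
- by move=> f /hS.
- move=> c; split=> [x|i]; first exact: differentiable_cst.
  by rewrite pderiv_cst; exact: alg_cst.
- move=> f g Sf [df cf] Sg [dg cg]; split=> [x|i]; first exact: differentiableD.
  by rewrite pderivD//; apply: alg_add.
- move=> f g Sf [df cf] Sg [dg cg]; split=> [x|i]; first exact: differentiableM.
  by rewrite pderivM//; apply: alg_add; apply: alg_mul.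
Qed.

Lemma smooth_alg : alg_closure (@smooth R n) `<=` @smooth R n.
Proof.
apply: alg_closure_smooth => f sf; split=> [x|i]; first exact: smooth_differentiable.
by apply: alg_base; exact: smooth_pderiv.
Qed.

Lemma smooth_cst (c : R) : @smooth R n (fun=> c).
Proof. by apply: smooth_alg; exact: alg_cst. Qed.

Lemma smoothD f g : smooth f -> smooth g -> smooth (fun x => f x + g x).
Proof. by move=> sf sg; apply: smooth_alg; apply: alg_add; apply: alg_base. Qed.

Lemma smoothM f g : smooth f -> smooth g -> smooth (fun x => f x * g x).
Proof. by move=> sf sg; apply: smooth_alg; apply: alg_mul; apply: alg_base. Qed.

Lemma smoothZ (c : R) f : smooth f -> smooth (fun x => c * f x).
Proof. by move=> sf; apply: smoothM => //; exact: smooth_cst. Qed.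

Lemma smoothN f : smooth f -> smooth (fun x => - f x).
Proof.
move=> sf; rewrite (_ : (fun _ => _) = fun x => (-1) * f x); first exact: smoothZ.
by apply/funext => x; rewrite mulN1r.
Qed.

Lemma smoothB f g : smooth f -> smooth g -> smooth (fun x => f x - g x).
Proof. by move=> sf sg; apply: smoothD => //; exact: smoothN. Qed.

Lemma pderivD_smooth i f g : smooth f -> smooth g ->
  pd [:: i] (fun x => f x + g x) = fun x => pd [:: i] f x + pd [:: i] g x.
Proof. by move=> sf sg; apply: pderivD => x; exact: smooth_differentiable. Qed.

Lemma pderivM_smooth i f g : smooth f -> smooth g ->
  pd [:: i] (fun x => f x * g x) =
  fun x => pd [:: i] f x * g x + f x * pd [:: i] g x.
Proof. by move=> sf sg; apply: pderivM => x; exact: smooth_differentiable. Qed.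

Lemma pderivZ_smooth i (c : R) f : smooth f ->
  pd [:: i] (fun x => c * f x) = fun x => c * pd [:: i] f x.
Proof.
move=> sf; rewrite pderivM_smooth//; last exact: smooth_cst.
by apply/funext => x; rewrite pderiv_cst mul0r add0r.
Qed.

Lemma pderivB_smooth i f g : smooth f -> smooth g ->
  pd [:: i] (fun x => f x - g x) = fun x => pd [:: i] f x - pd [:: i] g x.
Proof.
move=> sf sg; rewrite (_ : (fun _ => _ - _) = fun x => f x + (-1) * g x); last first.
  by apply/funext => x; rewrite mulN1r.
rewrite pderivD_smooth//; last exact: smoothZ.
by apply/funext => x; rewrite pderivZ_smooth// mulN1r.
Qed.

Lemma affine_is_diff (c : R) (a x : V) :
  is_diff x (fun y : V => c *: y + a) (fun y => c *: y).
Proof.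
have := @is_diffD _ _ _ (c *: (id : V -> V)) (cst a) (c *: (id : V -> V)) 0 x _ _.
by rewrite addr0; apply.
Qed.

Lemma affine_differentiable f (c : R) (a x : V) : (forall x, differentiable f x) ->
  differentiable (fun y => f (c *: y + a)) x.
Proof.
move=> df; apply: (@differentiable_comp _ _ _ _ (fun y : V => c *: y + a) f) => //.
Qed.

Lemma pderiv_affine i f (c : R) (a : V) : (forall x, differentiable f x) ->
  pd [:: i] (fun y => f (c *: y + a)) = fun y => c * pd [:: i] f (c *: y + a).
Proof.
move=> df; apply/funext => x; rewrite !pderiv1E deriveE; last exact: affine_differentiable.
have ga := affine_is_diff c a x.
rewrite (@diff_comp _ _ _ _ (fun y : V => c *: y + a) f) //.
by rewrite /= diff_val linearZ /= deriveE.
Qed.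

Lemma smooth_affine f (c : R) (a : V) : smooth f -> smooth (fun y => f (c *: y + a)).
Proof.
(* The invariant carries a factor [d] because every derivative brings out another factor [c]. *)
move=> sf; apply: (@smooth_coind [set g | exists f (d : R), smooth f /\
  g = fun y => d * f (c *: y + a)]); last first.
  by exists f, 1; split => //; apply/funext => y; rewrite mul1r.
move=> _ {f sf} [f [d [sf ->]]].
have df x := smooth_differentiable x sf.
have D x : differentiable (fun y => f (c *: y + a)) x by exact: affine_differentiable.
split=> [x|i].
  by apply: (@differentiableM _ _ (cst d)) => //; exact: differentiable_cst.
exists (pd [:: i] f), (d * c); split; first exact: smooth_pderiv.
rewrite pderivM//.
by apply/funext => x; rewrite pderiv_cst mul0r add0r pderiv_affine// mulrA.
Qed.

Lemma smooth_reflect f (a : V) : smooth f -> smooth (fun y => f (a - y)).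
Proof.
move=> sf; rewrite (_ : (fun _ => _) = fun y => f ((-1) *: y + a)); first exact: smooth_affine.
by apply/funext => y; rewrite scaleN1r addrC.
Qed.

Lemma pderiv_reflect i f (a : V) : smooth f ->
  pd [:: i] (fun y => f (a - y)) = fun y => - pd [:: i] f (a - y).
Proof.
move=> sf; have E : (fun y => f (a - y)) = fun y => f ((-1) *: y + a).
  by apply/funext => y; rewrite scaleN1r addrC.
rewrite E pderiv_affine; last by move=> x; exact: smooth_differentiable.
by apply/funext => y; rewrite scaleN1r addrC mulN1r.
Qed.

Lemma smooth_shift f (a : V) : smooth f -> smooth (fun y => f (y + a)).
Proof.
move=> sf; rewrite (_ : (fun _ => _) = fun y => f (1 *: y + a)); first exact: smooth_affine.
by apply/funext => y; rewrite scale1r.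
Qed.

Lemma derive_coordE (f : V -> R) x v : differentiable f x ->
  'D_v f x = \sum_(i < n) v 0 i * pd [:: i] f x.
Proof.
move=> df; rewrite deriveE// {1}(row_sum_delta v) linear_sum.
by apply: eq_bigr => i _; rewrite linearZ /= -deriveE// pderiv1E.
Qed.

Lemma derive_along_line (f : V -> R) (x v : V) (t : R) : differentiable f (t *: v + x) ->
  is_derive t 1 (fun s : R => f (s *: v + x)) ('D_v f (t *: v + x)).
Proof.
move=> df; have E : (fun h : R => h^-1 *: (((fun s : R => f (s *: v + x)) \o shift t) (h *: (1 : R))
     - f (t *: v + x))) =
   (fun h : R => h^-1 *: ((f \o shift (t *: v + x)) (h *: v) - f (t *: v + x))).
  by apply/funext => h; rewrite /= -[h%:A]/(h * 1) mulr1 scalerDl addrA.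
split; last by rewrite /derive E.
by rewrite /derivable E; exact: diff_derivable.
Qed.

Lemma line_mean_value (f : V -> R) x v : (forall y, differentiable f y) ->
  exists2 c, 0 < c < 1 & f (x + v) - f x = 'D_v f (x + c *: v).
Proof.
move=> df; pose g (t : R) := f (t *: v + x).
have dg (t : R) : is_derive t (1 : R) g ('D_v f (t *: v + x)) by exact: derive_along_line.
have [|c c01 e] := @MVT R g (fun t => 'D_v f (t *: v + x)) 0 1 ltr01 (fun t _ => dg t).
  apply: continuous_subspaceT => t; apply: differentiable_continuous.
  by apply/derivable1_diffP; exact: (@ex_derive _ _ _ _ _ _ _ (dg t)).
exists c; first by move: c01; rewrite in_itv.
by move: e; rewrite /g scale0r scale1r add0r subr0 mulr1 !(addrC x).
Qed.

Lemma mx_entry_le (v : V) i : `|v 0 i| <= `|v|.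
Proof. by have := rV_normE v (normr_ge0 v); rewrite lexx => /esym/forallP. Qed.

Lemma lipschitz_pderiv (f : V -> R) (M : R) : (forall y, differentiable f y) ->
  (forall i y, `|pd [:: i] f y| <= M) ->
  forall x v, `|f (x + v) - f x| <= n%:R * M * `|v|.
Proof.
move=> df hM x v; have [c _ ->] := line_mean_value x v df; rewrite derive_coordE//.
apply: (le_trans (ler_norm_sum _ _ _)).
apply: (@le_trans _ _ (\sum_(i < n) M * `|v|)); last first.
  by rewrite sumr_const card_ord -[leLHS]mulr_natl mulrA.
by apply: ler_sum => i _; rewrite normrM mulrC ler_pM// mx_entry_le.
Qed.

(** The mean value theorem along the segment, then the Lipschitz bound for each first derivative.
    The bound is uniform in [x], which is what integrating the remainder requires. *)
Lemma taylor_pderiv (f : V -> R) (M : R) : smooth f ->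
  (forall i j y, `|pd [:: i; j] f y| <= M) ->
  forall x v, `|f (x + v) - f x - \sum_(i < n) v 0 i * pd [:: i] f x| <=
    n%:R * (n%:R * M) * `|v| ^+ 2.
Proof.
move=> sf hM x v.
have [c /andP[c0 c1] ->] := line_mean_value x v (fun y => smooth_differentiable y sf).
rewrite derive_coordE; last exact: smooth_differentiable.
rewrite -sumrB; apply: (le_trans (ler_norm_sum _ _ _)).
apply: (@le_trans _ _ (\sum_(i < n) `|v| * (n%:R * M * `|v|))); last first.
  by rewrite sumr_const card_ord -[leLHS]mulr_natl le_eqVlt; apply/orP; left; apply/eqP; ring.
apply: ler_sum => i _; rewrite -mulrBr normrM ler_pM ?mx_entry_le//.
have sfi : smooth (pd [:: i] f) by exact: smooth_pderiv.
apply: le_trans (lipschitz_pderiv (fun y => smooth_differentiable y sfi) _ x (c *: v)) _.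
  by move=> j y; rewrite -pderiv_cat; exact: hM.
have M0 : 0 <= M by apply: le_trans (normr_ge0 _) (hM i i x).
rewrite ler_wpM2l ?mulr_ge0// normrZ gtr0_norm// ler_piMl// ltW//.
Qed.

End smooth_theory.

(** * Commutation of partial derivatives *)

Section schwarz.
Variables (R : realType) (n : nat).
Local Notation V := 'rV[R]_n.
Local Notation e_ i := (delta_mx 0 i : V).
Implicit Types (f g : V -> R).

Lemma derive_deltaZ f (h : R) i y : differentiable f y ->
  'D_(h *: e_ i) f y = h * pd [:: i] f y.
Proof. by move=> df; rewrite deriveE// linearZ /= -deriveE// pderiv1E. Qed.

Lemma norm_delta_le i : `|e_ i| <= 1.
Proof.
rewrite rV_normE//; apply/forallP => j; rewrite mxE.
by case: (_ && _); rewrite ?normr1 ?normr0.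
Qed.

(** The second difference on the left is symmetric in [i] and [j]. Two mean values express it by a
    mixed derivative at a point within [2 * h] of [x]; letting [h] tend to 0 in both orders gives
    [pderivC]. *)
Lemma mixed_difference i j f (x : V) (h : R) : smooth f -> 0 < h ->
  exists2 y : V, `|y - x| <= 2 * h &
  f (x + h *: e_ i + h *: e_ j) - f (x + h *: e_ i) - (f (x + h *: e_ j) - f x) =
    h ^+ 2 * pd [:: j; i] f y.
Proof.
move=> sf h0; pose F y := f (y + h *: e_ j) - f y.
have sF : smooth F by apply: smoothB => //; exact: smooth_shift.
have [c /andP[c0 c1] ->] := line_mean_value x (h *: e_ i) (fun y => smooth_differentiable y sF).
rewrite derive_deltaZ; last exact: smooth_differentiable.
have -> : pd [:: i] F = fun y => pd [:: i] f (y + h *: e_ j) - pd [:: i] f y.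
  rewrite /F (pderivB_smooth _ (smooth_shift _ sf) sf).
  apply/funext => y; congr (_ - _).
  have := @pderiv_affine R n i f 1 (h *: e_ j) (fun y => smooth_differentiable y sf).
  under eq_fun do rewrite scale1r.
  by move=> ->; rewrite mul1r scale1r.
have si : smooth (pd [:: i] f) by exact: smooth_pderiv.
set z := x + _.
have [d /andP[d0 d1] ->] := line_mean_value z (h *: e_ j) (fun y => smooth_differentiable y si).
rewrite derive_deltaZ; last exact: smooth_differentiable.
exists (z + d *: (h *: e_ j)); last by rewrite -pderiv_cat expr2 mulrA.
rewrite /z addrC !addrA addNr add0r.
apply: le_trans (ler_normD _ _) _; rewrite !normrZ !gtr0_norm//.
have a (t : R) k : 0 < t -> t < 1 -> t * (h * `|e_ k|) <= h.
  move=> t0 t1; rewrite mulrA; apply: le_trans (_ : t * h * 1 <= _).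
    by rewrite ler_wpM2l ?norm_delta_le// mulr_ge0// ltW.
  by rewrite mulr1 ler_piMl// ltW.
by rewrite mulrDl !mul1r lerD ?a.
Qed.

Lemma continuous_eq_at (a b : V -> R) (x : V) : {for x, continuous a} ->
  {for x, continuous b} ->
  (forall h, 0 < h -> exists y z, [/\ `|y - x| <= 2 * h, `|z - x| <= 2 * h & b y = a z]) ->
  a x = b x.
Proof.
move=> ca cb H; apply/eqP; apply: contraT => ne.
have e0 : 0 < `|a x - b x| / 2 by rewrite divr_gt0// normr_gt0 subr_eq0.
have /cvgrPdist_lt/(_ _ e0)/nbhs_ballP[r1 /= r10 h1] := ca.
have /cvgrPdist_lt/(_ _ e0)/nbhs_ballP[r2 /= r20 h2] := cb.
pose h := Num.min r1 r2 / 4.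
have h0 : 0 < h by rewrite divr_gt0// lt_min r10.
have hr : 2 * h < Num.min r1 r2 by rewrite /h; have : 0 < Num.min r1 r2; [rewrite lt_min r10|lra].
have [y [z [yx zx yz]]] := H _ h0.
have := h1 z; rewrite -ball_normE /= distrC => /(_ (le_lt_trans zx _)).
have := h2 y; rewrite -ball_normE /= distrC => /(_ (le_lt_trans yx _)).
rewrite yz; move: hr; rewrite lt_min => /andP[hr1 hr2] /(_ hr2) + /(_ hr1).
move: (a x) (b x) (a z) => A B C k2 k1.
exfalso; have : `|A - B| < `|A - B|; last by rewrite ltxx.
rewrite [ltRHS]splitr (le_lt_trans _ (ltrD k1 k2))//.
by rewrite (distrC B) (le_trans _ (ler_normD _ _))// addrA subrK.
Qed.

Lemma pderivC i j f : smooth f -> pd [:: i; j] f = pd [:: j; i] f.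
Proof.
move=> sf; apply/funext => x; apply: continuous_eq_at.
- by apply: smooth_continuous; exact: smooth_pderiv.
- by apply: smooth_continuous; exact: smooth_pderiv.
move=> h h0; have [y yx ey] := mixed_difference i j x sf h0.
have [z zx ez] := mixed_difference j i x sf h0.
exists y, z; split; [exact: yx|exact: zx|].
have h2 : h ^+ 2 != 0 by rewrite expf_neq0// gt_eqF.
have E (p q r t : R) : p - q - (r - t) = p - r - (q - t) by ring.
apply: (mulfI h2 (etrans (esym ey) (etrans (E _ _ _ _) (etrans _ ez)))).
by rewrite [x + h *: e_ j + _]addrAC.
Qed.

End schwarz.

(** * Smooth functions with bounded support *)

Section compact_support.
Variables (R : realType) (n : nat).
Local Notation V := 'rV[R]_n.
Implicit Types (f g : V -> R).

(** A radius instead of a compact closure: it passes directly to derivatives, products, reflections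
    and mollifications. The radius may be negative, hence the later uses of its absolute value. *)
Definition bounded_support f := exists r, forall x, r < `|x| -> f x = 0.

Definition csmooth f := smooth f /\ bounded_support f.

Lemma csmooth_pderiv s f : csmooth f -> csmooth (pd s f).
Proof.
move=> [sf [r fr]]; split; first exact: smooth_pderiv.
exists r; elim: s => [|i s ih] x rx; first by rewrite pderiv0; exact: fr.
rewrite -[i :: s]cat1s pderiv_cat pderiv1E -(derive_cst (0 : R) x (delta_mx 0 i)).
apply: near_eq_derive; near=> y; apply: ih; near: y.
have := @norm_continuous _ V x; move/cvgr_gt; exact.
Unshelve. all: by end_near. Qed.

Lemma csmoothM f g : csmooth f -> smooth g -> csmooth (fun x => g x * f x).
Proof.
move=> [sf [r fr]] sg; split; first exact: smoothM.
by exists r => x /fr ->; rewrite mulr0.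
Qed.

Lemma csmoothD f g : csmooth f -> csmooth g -> csmooth (fun x => f x + g x).
Proof.
move=> [sf [r fr]] [sg [r' gr]]; split; first exact: smoothD.
exists (Num.max r r') => x; rewrite gt_max => /andP[xr xr'].
by rewrite fr// gr// addr0.
Qed.

Lemma csmoothZ (c : R) f : csmooth f -> csmooth (fun x => c * f x).
Proof. by move=> cf; apply: csmoothM => //; exact: smooth_cst. Qed.

Lemma csmoothB f g : csmooth f -> csmooth g -> csmooth (fun x => f x - g x).
Proof.
move=> cf cg; rewrite (_ : (fun _ => _) = fun x => f x + (-1) * g x).
  by apply: csmoothD => //; exact: csmoothZ.
by apply/funext => x; rewrite mulN1r.
Qed.

Lemma csmooth_reflect f (a : V) : csmooth f -> csmooth (fun y => f (a - y)).
Proof.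
move=> [sf [r fr]]; split; first exact: smooth_reflect.
exists (r + `|a|) => y ry; apply: fr.
rewrite -(ltrD2r `|a|) (lt_le_trans ry)// distrC.
by rewrite -{1}(subrK a y) (le_trans (ler_normD _ _)).
Qed.

Lemma csmooth_bounded f : csmooth f -> exists M, forall x, `|f x| <= M.
Proof.
move=> [sf [r fr]].
have cb : compact [set x : V | `|x| <= `|r|].
  apply: bounded_closed_compact.
    exists `|r|; split; first exact: num_real.
    by move=> M rM x /= /le_trans; apply; exact: ltW.
  by apply: (closed_comp (f := fun x : V => `|x|)) (@closed_le _ `|r|) => x _; exact: norm_continuous.
have [||c _ hc] := @compact_EVT_max V R (fun x => `|f x|) [set x : V | `|x| <= `|r|] _ cb.
- by exists 0; rewrite /= normr0.
- apply: continuous_subspaceT => x; apply: continuous_comp; last exact: norm_continuous.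
  exact: smooth_continuous.
exists `|f c| => x; have [xr|xr] := leP `|x| `|r|; first by apply: hc; rewrite inE.
by rewrite fr ?normr0// (le_lt_trans _ xr)// ler_norm.
Qed.

Lemma csmooth_bounded_pderiv2 f : csmooth f ->
  exists M, forall i j x, `|pd [:: i; j] f x| <= M.
Proof.
move=> cf; have /choice[M hM] : forall p : 'I_n * 'I_n, exists M,
    forall x, `|pd [:: p.1; p.2] f x| <= M.
  by move=> p; apply: csmooth_bounded; exact: csmooth_pderiv.
exists (\sum_p `|M p|) => i j x; apply: le_trans (hM (i, j) x) _.
apply: le_trans (ler_norm _) _.
by rewrite (bigD1 (i, j))//= lerDl sumr_ge0.
Qed.

Lemma csmooth_sqint f : csmooth f -> sqint (lebesgue_rV R n) f.
Proof.
move=> cf; have [M hM] := csmooth_bounded cf; have [sf [r fr]] := cf.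
have mf : measurable_fun setT f by apply: measurable_fun_cont; exact: smooth_continuous.
pose B : set V := ball (0 : V) (`|r| + 1).
have sB : sqint (lebesgue_rV R n) (\1_B : V -> R).
  apply: sqint_indic; first exact: measurable_rV_ball.
  apply: (@rV_measure_bounded _ _ _ (`|r| + 1)); first exact: measurable_rV_ball.
  by move=> x; rewrite /B -ball_normE /= sub0r normrN.
apply: (sqint_le mf (sqintZ M sB)) => x; rewrite indicE.
case: (boolP (x \in B)) => xB.
  by rewrite mulr1 (le_trans (hM x))// ler_norm.
rewrite fr ?normr0// ltNge; apply/negP => xr; move/negP : xB; apply.
rewrite inE /B -ball_normE /= sub0r normrN (le_lt_trans xr)//.
by rewrite (le_lt_trans (ler_norm r))// ltrDl.
Qed.

End compact_support.

(** * A flat function and smooth bumps *)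

Section flat_function.
Variable R : realType.
Implicit Types (k : nat) (t : R).

(* The family [theta k t = t^-k exp(-1/t)] is closed under differentiation up
   to linear combinations, hence every member is smooth. *)
Definition theta k t : R := if 0 < t then t ^- k * expR (- t^-1) else 0.

Lemma theta_ge0 k t : 0 <= theta k t.
Proof.
rewrite /theta; case: ifPn => // t0.
by rewrite mulr_ge0 ?expR_ge0// invr_ge0 exprn_ge0// ltW.
Qed.

Lemma theta_gt0 t : 0 < t -> 0 < theta 0 t.
Proof. by move=> t0; rewrite /theta t0 expr0 invr1 mul1r expR_gt0. Qed.

(** For positive [t], one term of the exponential series at [t^-1], the one of degree [k.+2],
    absorbs [t ^- k] and leaves a factor [t ^+ 2]. *)
Lemma theta_quadratic k t : `|theta k t| <= (k.+2)`!%:R * `|t| ^+ 2.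
Proof.
rewrite ger0_norm ?theta_ge0// /theta; case: ifPn => t0; last first.
  by rewrite mulr_ge0// exprn_ge0.
rewrite gtr0_norm//.
have i0 : 0 < t^-1 by rewrite invr_gt0.
have := expR_ge1Dxn k.+1 (ltW i0) => h.
have {}h : t^-1 ^+ k.+2 / (k.+2)`!%:R <= expR t^-1 by apply: le_trans h; rewrite lerDr.
rewrite expRN ler_pdivrMr ?expR_gt0//.
have F0 : 0 < (k.+2)`!%:R :> R by rewrite ltr0n fact_gt0.
rewrite ler_pdivrMr// in h.
have -> : t ^- k = t ^+ 2 * t^-1 ^+ k.+2.
  rewrite -[k.+2]/(2 + k)%N exprD !exprVn mulrA mulfV ?mul1r//.
  by rewrite gt_eqF// exprn_gt0.
apply: le_trans (ler_wpM2l _ h) _; first by rewrite exprn_ge0// ltW.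
by rewrite le_eqVlt; apply/orP; left; apply/eqP; ring.
Qed.

Lemma is_derive_theta k t :
  is_derive t (1 : R) (theta k) (- k%:R * theta k.+1 t + theta k.+2 t).
Proof.
case: (ltgtP t 0) => [t0|t0|->].
- rewrite {2 3}/theta !ltNge (ltW t0)/= mulr0 addr0.
  apply: (near_eq_is_derive (f := fun=> 0) _ (is_derive_cst _ _ _)).
  near=> s; rewrite /theta (_ : 0 < s = false)//; apply/negbTE; rewrite -leNgt ltW//.
  by near: s; exact: lt_nbhsl.
- have tn : t != 0 by rewrite gt_eqF.
  have tE j : t ^- (2 + j) = t ^- 2 * t ^- j by rewrite exprD invfM.
  have d1 : is_derive t (1 : R) (fun s : R => s^-1) (- t ^- 2).
    by have := @is_deriveV R id t 1 1 tn _; rewrite /GRing.scale /= mulr1; apply.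
  have d2 : is_derive t (1 : R) (fun s : R => expR (- s^-1)) (expR (- t^-1) * t ^- 2).
    apply: (@is_derive1_comp R expR (fun s => - s^-1)).
    by have := @is_deriveN _ _ _ _ _ _ _ d1; rewrite opprK.
  have d3 : is_derive t (1 : R) (fun s : R => s^-1 ^+ k) (- k%:R * t ^- k.+1).
    rewrite (_ : (fun s : R => s^-1 ^+ k) = (fun s : R => s^-1) ^+ k); last by rewrite exprfctE.
    apply: (is_derive_eq (@is_deriveX _ _ _ k _ _ _ d1)).
    rewrite /GRing.scale /=; case: k => [|k]; first by rewrite !mul0r oppr0 mul0r.
    rewrite /= exprVn -[k.+2]/(2 + k)%N tE mulrN mulNr -mulrA.
    by rewrite [t ^- k * _]mulrC.
  have d4 : is_derive t (1 : R) (fun s : R => s^-1 ^+ k * expR (- s^-1))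
      (- k%:R * theta k.+1 t + theta k.+2 t).
    apply: (is_derive_eq (@is_deriveM _ _ _ _ _ _ _ _ d3 d2)).
    rewrite /theta t0 /GRing.scale /= exprVn -[k.+2]/(2 + k)%N tE.
    move: (t ^- 2) (t ^- k) (t ^- k.+1) (expR _) => p q r s; ring.
  apply: near_eq_is_derive d4.
  near=> s; rewrite /theta (_ : 0 < s) ?exprVn//.
  by near: s; exact: lt_nbhsr.
(* At 0 the quadratic bound makes [theta k] differentiable with zero derivative. *)
- have z j : theta j 0 = 0 by rewrite /theta ltxx.
  rewrite !z mulr0 addr0.
  have [||//|h _|df dE] := @quadratic_remainder_differentiable R R (theta k)
     (fun=> 0) 0 (k.+2)`!%:R 1.
  - by move=> a u v; rewrite /= scaler0 addr0.
  - by move=> x; exact: cvg_cst.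
  - by rewrite add0r z !subr0; exact: theta_quadratic.
  by split; [exact: diff_derivable|exact: dE].
Unshelve. all: by end_near. Qed.

End flat_function.

Section bump.
Variables (R : realType) (n : nat).
Local Notation V := 'rV[R]_n.
Local Notation mu := (lebesgue_rV R n).

Lemma diff_coord_comp (h : R -> R) (dh c b : R) i (x v : V) :
  is_derive (c * x 0 i + b) (1 : R) h dh ->
  differentiable (fun y : V => h (c * y 0 i + b)) x /\
  'D_v (fun y : V => h (c * y 0 i + b)) x = c * v 0 i * dh.
Proof.
move=> hd; pose g (y : V) := c * y 0 i + b.
have dc : differentiable (fun y : V => y 0 i) x by exact: differentiable_coord.
have dg : differentiable g x.
  apply: differentiableD => //; apply: (@differentiableM _ _ (cst c)) => //.
have dhd : differentiable h (g x) by apply/derivable1_diffP; exact: (@ex_derive _ _ _ _ _ _ _ hd).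
have D : differentiable (h \o g) x by exact: differentiable_comp.
split => //.
have gv : 'D_v g x = c * v 0 i.
  rewrite /derive; apply: cvg_lim => //.
  apply: (@cvg_trans _ ((fun=> c * v 0 i) @ (0 : R)^')); last exact: cvg_cst.
  apply: near_eq_cvg; near=> t.
  have t0 : t != 0 by near: t; exact: nbhs_dnbhs_neq.
  rewrite /g /= !mxE /GRing.scale /=; by field.
rewrite (_ : (fun y : V => h (c * y 0 i + b)) = h \o g)// deriveE// diff_comp//.
have gv' : 'd g x v = c * v 0 i by rewrite -deriveE.
rewrite /= gv'; transitivity ((c * v 0 i) *: 'd h (g x) (1 : R)).
  by rewrite -linearZ; congr ('d h (g x) _); rewrite /GRing.scale /= mulr1.
by rewrite -deriveE// (@derive_val _ _ _ _ _ _ _ hd).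
Unshelve. all: by end_near. Qed.

Definition theta_coord : set (V -> R) :=
  [set f | exists (k : nat) (c b : R) (i : 'I_n), f = fun x : V => theta k (c * x 0 i + b)].

Lemma theta_coord_smooth : alg_closure theta_coord `<=` @smooth R n.
Proof.
apply: alg_closure_smooth => _ [k [c [b [i ->]]]].
have H (x v : V) := diff_coord_comp v (is_derive_theta k (c * x 0 i + b)).
split=> [x|j]; first by have [] := H x 0.
rewrite (_ : pd _ _ = fun x => (c * (delta_mx 0 j : V) 0 i) *
    (- k%:R * theta k.+1 (c * x 0 i + b) + theta k.+2 (c * x 0 i + b))).
  apply: alg_mul; first exact: alg_cst.
  apply: alg_add; last by apply: alg_base; exists k.+2, c, b, i.
  by apply: alg_mul; [exact: alg_cst|apply: alg_base; exists k.+1, c, b, i].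
by apply/funext => x; rewrite pderiv1E; have [_ ->] := H x (delta_mx 0 j).
Qed.

(** Coordinatewise product of [theta 0 (r + s)] and [theta 0 (r - s)] with [s = x 0 i - c 0 i]: for
    positive [r], nonzero exactly on the sup-norm ball. The factors [1] and [-1] put both in the
    form required by [theta_coord]. *)
Definition bump (c : V) (r : R) (x : V) : R :=
  \prod_(i < n) (theta 0 (1 * x 0 i + (r - c 0 i)) * theta 0 ((-1) * x 0 i + (r + c 0 i))).

Lemma bump_smooth c r : smooth (bump c r).
Proof.
apply: theta_coord_smooth; rewrite /bump.
elim: (index_enum _) => [|i s ih].
  by under eq_fun do rewrite big_nil; exact: alg_cst.
under eq_fun do rewrite big_cons; apply: alg_mul => //.
by apply: alg_mul; apply: alg_base; [exists 0%N, 1, (r - c 0 i), i|exists 0%N, (-1), (r + c 0 i), i].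
Qed.

Lemma bump_ge0 c r x : 0 <= bump c r x.
Proof. by apply: prodr_ge0 => i _; rewrite mulr_ge0 ?theta_ge0. Qed.

Lemma bump_gt0 c r x : 0 < r -> `|x - c| < r -> 0 < bump c r x.
Proof.
move=> r0; rewrite rV_norm_lt// => /forallP h; apply: prodr_gt0 => i _.
have := h i; rewrite !mxE ltr_norml => /andP[h1 h2].
by rewrite mulr_gt0// theta_gt0//; lra.
Qed.

Lemma bump_neq0 c r x : 0 < r -> bump c r x != 0 -> `|x - c| < r.
Proof.
move=> r0; rewrite rV_norm_lt// => /prodf_neq0 h; apply/forallP => i.
have := h i isT; rewrite mulf_eq0 negb_or /theta => /andP[].
case: ifPn => [h1 _|_ /eqP//]; case: ifPn => [h2 _|_ /eqP//].
by rewrite !mxE ltr_norml; apply/andP; split; lra.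
Qed.

Lemma bump_csmooth c r : 0 < r -> csmooth (bump c r).
Proof.
move=> r0; split; first exact: bump_smooth.
exists (`|c| + r) => x xr; apply/eqP; apply: contraTT xr => /(bump_neq0 r0) h.
rewrite -leNgt -[x](subrK c) addrC (le_trans (ler_normD _ _))// lerD2l ltW//.
Qed.

End bump.

(** * Mollification *)

Section kernels.
Variables (R : realType) (n : nat).
Local Notation V := 'rV[R]_n.
Local Notation mu := (lebesgue_rV R n).
Implicit Types (k z : V -> R) (x y v : V).

Lemma sqint_indic_ball x (r : R) : sqint mu (\1_(ball x r) : V -> R).
Proof.
apply: sqint_indic; first exact: measurable_rV_ball.
apply: (@rV_measure_bounded _ _ _ (r + `|x|)); first exact: measurable_rV_ball.
move=> y; rewrite -ball_normE /= => h.
by rewrite -(subrK x y) (le_lt_trans (ler_normD _ _))// distrC ltrD2r.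
Qed.

Lemma csmooth_integrable k : csmooth k -> mu.-integrable setT (EFin \o k).
Proof.
move=> ck; have [_ [r kr]] := ck.
have := sqint_integrable (csmooth_sqint ck) (sqint_indic_ball 0 (`|r| + 1)).
apply: eq_integrable => // x _ /=; congr (_%:E); rewrite indicE.
case: (boolP (x \in _)) => [_|/negP h]; first by rewrite mulr1.
rewrite mulr0 kr// ltNge; apply/negP => xr; apply: h.
rewrite inE -ball_normE /= sub0r normrN (le_lt_trans xr)//.
by rewrite (le_lt_trans (ler_norm r))// ltrDl.
Qed.

(** The centre [c] is free so that a kernel can also push into the domain. The mass is normalized
    for [k (- y)], the weight that appears in [mollify_shiftE]; invariance of the measure under
    reflection is thus avoided. *)
Definition kernel_in k (c : V) (r : R) := [/\ csmooth k, forall x, 0 <= k x,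
  forall x, k x != 0 -> `|x - c| < r & \int[mu]_y k (- y) = 1].

Lemma csmooth_opp k : csmooth k -> csmooth (fun y => k (- y)).
Proof.
move=> ck; rewrite (_ : (fun y => _) = fun y => k (0 - y)); first exact: csmooth_reflect.
by apply/funext => y; rewrite sub0r.
Qed.

Lemma kernel_exists (c : V) (r : R) : 0 < r -> exists k, kernel_in k c r.
Proof.
move=> r0; pose b := @bump R n c r.
have cb : csmooth b by exact: bump_csmooth.
have cb' := csmooth_opp cb; have ib := csmooth_integrable cb'.
pose I := \int[mu]_y b (- y).
have I0 : 0 < I.
  rewrite lt_neqAle eq_sym Rintegral_ge0 ?andbT; last by move=> y _; exact: bump_ge0.
  apply/eqP => I0.
  have := integrable_fin_num measurableT ib; move=> /fineK; rewrite [fine _]I0 => /esym i0.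
  (* A zero integral would make the nonnegative bump vanish almost everywhere, but it is positive on
     the ball around [- c], which has positive measure. *)
  have /ae_eq_integral_abs : (\int[mu]_y `|(b (- y))%:E| = 0)%E.
    by rewrite -[RHS]i0; apply: eq_integral => y _; rewrite gee0_abs// lee_fin bump_ge0.
  case=> //; first exact: measurable_int ib.
  move=> N [mN N0 hN].
  have : (mu (ball (- c)%R r) <= 0)%E.
    rewrite -N0; apply: le_measure; rewrite ?inE//; first exact: measurable_rV_ball.
    move=> y yb; apply: hN => /= /(_ Logic.I); apply/eqP; rewrite gt_eqF// lte_fin.
    apply: bump_gt0 => //; move: yb; rewrite -ball_normE /=.
    by rewrite -opprB opprK normrN addrC -opprD normrN addrC.
  by rewrite lebesgue_rV_ball// lee_fin leNgt exprn_gt0// mulrn_wgt0.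
exists (fun x => I^-1 * b x); split.
- exact: csmoothZ.
- by move=> x; rewrite mulr_ge0 ?bump_ge0// invr_ge0 ltW.
- by move=> x; rewrite mulf_eq0 negb_or => /andP[_]; exact: bump_neq0.
- by rewrite RintegralZl// mulVf// gt_eqF.
Qed.

Definition mollify k z x : R := \int[mu]_y (k (x - y) * z y).

Lemma csmooth_reflect_sqint k x : csmooth k -> sqint mu (fun y => k (x - y)).
Proof. by move=> ck; apply: csmooth_sqint; exact: csmooth_reflect. Qed.

Lemma lin_coord_linear (c : 'I_n -> R) : linear (fun v : V => \sum_(i < n) v 0 i * c i).
Proof.
move=> a u v; rewrite scaler_sumr -big_split; apply: eq_bigr => i _.
by rewrite !mxE mulrDl /GRing.scale /= mulrA.
Qed.

Lemma lin_coord_continuous (c : 'I_n -> R) : continuous (fun v : V => \sum_(i < n) v 0 i * c i).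
Proof.
move=> x; apply: differentiable_continuous.
rewrite (_ : (fun v => _) = \sum_(i < n) (fun v : V => v 0 i * c i)); last first.
  by apply/funext => v; rewrite fct_sumE.
apply: differentiable_sum => i; apply: (@differentiableM _ _ _ (cst (c i))) => //.
exact: differentiable_coord.
Qed.

(** The Taylor remainder of [k] at [x - y] is quadratic in [h], uniformly in [y], and vanishes for
    [y] outside a fixed ball; Cauchy-Schwarz against [z] keeps it quadratic. *)
Lemma mollify_derive k z x : csmooth k -> sqint mu z ->
  differentiable (mollify k z) x /\
  forall v, 'D_v (mollify k z) x = \sum_(i < n) v 0 i * mollify (pd [:: i] k) z x.
Proof.
move=> ck sz; have [sk [r kr]] := ck.
have [M hM] := csmooth_bounded_pderiv2 ck.
have [r' kr'] : exists r', forall i y, r' < `|y| -> pd [:: i] k y = 0.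
  have /choice[s hs] : forall i, exists s, forall y, s < `|y| -> pd [:: i] k y = 0.
    by move=> i; have [] := csmooth_pderiv [:: i] ck.
  exists (\sum_i `|s i|) => i y ry; apply: hs; apply: le_lt_trans ry.
  by rewrite (le_trans (ler_norm _))// (bigD1 i)//= lerDl sumr_ge0.
(* Outside the ball of radius [rho] around [x], and for [h] of norm below 1, the three terms of the
   remainder vanish: [rho - 1] exceeds [r] and [rho] exceeds [r']. *)
pose rho := `|r| + `|r'| + 2.
pose B : set V := ball x rho.
have sB : sqint mu (\1_B : V -> R) by exact: sqint_indic_ball.
pose C := n%:R * (n%:R * M).
apply: (@quadratic_remainder_differentiable R V _ _ x
  (`|C| * Num.sqrt (sqn mu \1_B) * Num.sqrt (sqn mu z)) 1) => //.
- exact: lin_coord_linear.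
- exact: lin_coord_continuous.
move=> h h1; pose rem y := k (x + h - y) - k (x - y) - \sum_(i < n) h 0 i * pd [:: i] k (x - y).
have s1 := csmooth_reflect_sqint (x + h) ck; have s2 := csmooth_reflect_sqint x ck.
have s3 i := csmooth_reflect_sqint x (csmooth_pderiv [:: i] ck).
have s3h i := sqintZ (h 0 i) (s3 i).
have s4 : sqint mu (fun y => \sum_(i < n) h 0 i * pd [:: i] k (x - y)) by exact: sqint_sum.
have srem : sqint mu rem by apply: sqintB => //; exact: sqintB.
have -> : mollify k z (x + h) - mollify k z x - \sum_(i < n) h 0 i * mollify (pd [:: i] k) z x =
    dot mu rem z.
  rewrite /rem dotBl//; last exact: sqintB.
  rewrite dotBl// dot_suml//; congr (_ - _); apply: eq_bigr => i _.
  by rewrite dotZl.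
have remE y : `|rem y| <= `|C| * `|h| ^+ 2 * \1_B y.
  rewrite indicE; case: (boolP (y \in B)) => yB.
    rewrite mulr1; have := taylor_pderiv sk hM (x - y) h.
    rewrite [x - y + h]addrAC => /le_trans; apply.
    by rewrite ler_wpM2r ?exprn_ge0// ler_norm.
  have xy : rho <= `|x - y|.
    by rewrite leNgt; apply/negP => xy; move/negP: yB; apply; rewrite inE /B -ball_normE.
  rewrite mulr0 /rem kr; last first.
    rewrite -(ltrD2r `|h|) (@lt_le_trans _ _ `|x - y|)//; last first.
      by rewrite -[in leLHS](addrK h (x - y)) (addrAC x) (le_trans (ler_normB _ _)).
    by apply: lt_le_trans xy; have := ler_norm r; have := normr_ge0 r'; rewrite /rho; lra.
  rewrite kr; last by apply: lt_le_trans xy; have := ler_norm r; have := normr_ge0 r'; rewrite /rho; lra.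
  rewrite big1 ?subrr ?subr0 ?normr0// => i _; rewrite kr' ?mulr0//.
  by apply: lt_le_trans xy; have := ler_norm r'; have := normr_ge0 r; rewrite /rho; lra.
apply: (le_trans (norm_dot_le srem sz)).
rewrite mulrAC ler_wpM2r ?sqrtr_ge0//.
have D0 : 0 <= `|C| * `|h| ^+ 2 by rewrite mulr_ge0// exprn_ge0.
have -> : `|C| * Num.sqrt (sqn mu \1_B) * `|h| ^+ 2 =
    Num.sqrt (sqn mu (fun y => (`|C| * `|h| ^+ 2) * \1_B y)).
  by rewrite sqnZ// sqrtrM ?sqr_ge0// sqrtr_sqr (ger0_norm D0) mulrAC.
rewrite ler_sqrt ?sqn_ge0//; apply: le_sqn => //; first exact: sqintZ.
by move=> y; rewrite [leRHS]ger0_norm// mulr_ge0// indicE.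
Qed.

Lemma pderiv_mollify1 i k z : csmooth k -> sqint mu z ->
  pd [:: i] (mollify k z) = mollify (pd [:: i] k) z.
Proof.
move=> ck sz; apply/funext => x;
  rewrite pderiv1E.
have [_ ->] := mollify_derive x ck sz.
rewrite (bigD1 i)//= big1 ?addr0.
  by rewrite mxE !eqxx mul1r.
by move=> j ji; rewrite mxE (negbTE ji) andbF mul0r.
Qed.

Lemma mollify_smooth k z : csmooth k -> sqint mu z -> smooth (mollify k z).
Proof.
move=> ck sz.
apply: (@smooth_coind R n [set f | exists2 k, csmooth k & f = mollify k z]); last by exists k.
move=> _ [{}k {}ck ->]; split=> [x|i]; first by have [] := mollify_derive x ck sz.
by exists (pd [:: i] k); [exact: csmooth_pderiv|exact: pderiv_mollify1].
Qed.

Lemma pderiv_mollify s k z : csmooth k -> sqint mu z ->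
  pd s (mollify k z) = mollify (pd s k) z.
Proof.
move=> ck sz; elim: s => [|i s ih]; first by rewrite !pderiv0.
by rewrite -cat1s !pderiv_cat ih pderiv_mollify1//; exact: csmooth_pderiv.
Qed.

Lemma mollify_neq0 k z x : mollify k z x != 0 -> exists y, z y != 0 /\ k (x - y) != 0.
Proof.
move=> h; apply: contrapT => hN; move/negP: h; apply; apply/eqP.
transitivity (\int[mu]_(y in setT) (0 : R)); last by rewrite Rintegral_cst//= mul0r.
apply: eq_Rintegral => y _; apply/eqP; apply: contraT; rewrite mulf_eq0 negb_or => /andP[h1 h2].
by exfalso; apply: hN; exists y.
Qed.

Lemma mollify_csmooth k z : csmooth k -> sqint mu z -> bounded_support z ->
  csmooth (mollify k z).
Proof.
move=> ck sz [r zr]; split; first exact: mollify_smooth.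
have [_ [r' kr']] := ck; exists (r + r') => x xr; apply/eqP; apply: contraTT xr.
move=> /mollify_neq0[y [zy ky]]; rewrite -leNgt -[x](subrK y) addrC.
apply: le_trans (ler_normD _ _) _; apply: lerD.
  by rewrite leNgt; apply: contra zy => /zr ->.
by rewrite leNgt; apply: contra ky => /kr' ->.
Qed.

(** Jensen for the square, through the variance: [key] gives the weighted integral of [(w - b) ^+ 2]
    as a polynomial in [b]. Its nonnegativity at the mean [b = dot nu p w] yields the inequality at
    [b = a]. *)
Lemma jensen_sqr d (T : measurableType d) (nu : {measure set T -> \bar R})
    (p w : T -> R) (M a : R) :
  (forall t, 0 <= p t <= M) -> sqint nu p -> nu.-integrable setT (EFin \o p) ->
  \int[nu]_t p t = 1 -> sqint nu w ->
  nu.-integrable setT (EFin \o (fun t => p t * (w t - a) ^+ 2)) /\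
  (dot nu p w - a) ^+ 2 <= \int[nu]_t (p t * (w t - a) ^+ 2).
Proof.
move=> pM sp ip p1 sw.
have spw : sqint nu (fun t => p t * w t).
  apply: (sqint_bnd sp.1 (M := M)) => // t; have /andP[p0 pm] := pM t.
  by rewrite ger0_norm.
have i1 := sqint_integrable spw sw; have i2 := sqint_integrable sp sw.
pose q := \int[nu]_t (p t * w t * w t).
have key b : nu.-integrable setT (EFin \o (fun t => p t * (w t - b) ^+ 2)) /\
    \int[nu]_t (p t * (w t - b) ^+ 2) = q - 2 * b * dot nu p w + b ^+ 2.
  have E : (fun t => p t * (w t - b) ^+ 2) =
      (fun t => p t * w t * w t - (2 * b) * (p t * w t) + b ^+ 2 * p t).
    by apply/funext => t; ring.
  have i3 : nu.-integrable setT (EFin \o (fun t => (2 * b) * (p t * w t))).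
    rewrite (_ : _ \o _ = fun t => ((2 * b)%:E * (p t * w t)%:E)%E)//; exact: integrableZl.
  have i4 : nu.-integrable setT (EFin \o (fun t => b ^+ 2 * p t)).
    rewrite (_ : _ \o _ = fun t => ((b ^+ 2)%:E * (p t)%:E)%E)//; exact: integrableZl.
  have i5 : nu.-integrable setT (EFin \o (fun t => p t * w t * w t - (2 * b) * (p t * w t))).
    exact: (integrableB measurableT i1 i3).
  rewrite E; split; first exact: (integrableD measurableT i5 i4).
  rewrite RintegralD// RintegralB// !RintegralZl// p1 mulr1//.
have [ia ea] := key a; split => //; rewrite ea.
have [_] := key (dot nu p w).
have : 0 <= \int[nu]_t (p t * (w t - dot nu p w) ^+ 2).
  apply: Rintegral_ge0 => t _; have /andP[p0 _] := pM t.
  by apply: mulr_ge0 => //; exact: sqr_ge0.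
by move=> h1 h2; rewrite h2 in h1; move: h1; move: (dot nu p w) => m; nra.
Qed.

Lemma measurable_rV_add : measurable_fun setT (fun p : V * V => p.1 + p.2).
Proof.
apply: measurable_fun_rV => i.
rewrite (_ : _ \o _ = fun p : V * V => @rV_coord R n i p.1 + @rV_coord R n i p.2).
  by apply: measurable_funD; (apply: measurableT_comp; [exact: measurable_rV_coord|]).
by apply/funext => p; rewrite /rV_coord /= mxE.
Qed.

Lemma mollify_shiftE k z x : csmooth k -> measurable_fun setT z ->
  mollify k z x = dot mu (fun v => k (- v)) (fun v => z (v + x)).
Proof.
move=> ck mz; rewrite /mollify /dot.
rewrite -(@Rintegral_rV_shift _ _ x (fun y => k (x - y) * z y)).
  by apply: eq_Rintegral => v _; rewrite opprD addrCA subrr addr0.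
by apply: measurable_funM => //; exact: (csmooth_reflect_sqint x ck).1.
Qed.

(** Jensen pointwise, then Tonelli: the error is at most the average, with weight [k (- v)], of the
    squared L^2 distances between [z] and its translates by [v]. Square-integrability of
    [mollify k z] then follows from that of the error. *)
Lemma mollify_approx k c r z (D e : R) : kernel_in k c r -> `|c| + r <= D -> 0 <= e ->
  sqint mu z -> (forall v, `|v| < D -> sqn mu (fun x => z (x + v) - z x) <= e) ->
  sqint mu (mollify k z) /\ sqn mu (fun x => mollify k z x - z x) <= e.
Proof.
move=> [ck k0 kc k1] cr e0 sz hD.
have [M hM] := csmooth_bounded ck.
have ck' := csmooth_opp ck; have mk' := (csmooth_sqint ck').1.
pose m := mollify k z.
have mm : measurable_fun setT m.
  by apply: measurable_fun_cont; apply: smooth_continuous; exact: mollify_smooth.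
pose F (p : V * V) := (k (- p.2) * (z (p.2 + p.1) - z p.1) ^+ 2)%:E.
have F0 p : (0 <= F p)%E by rewrite lee_fin mulr_ge0// sqr_ge0.
have mF : measurable_fun setT F.
  apply/measurable_EFinP; apply: measurable_funM.
    by apply: (measurableT_comp mk').
  apply: measurable_funX; apply: measurable_funB; last exact: (measurableT_comp sz.1).
  rewrite (_ : (fun p : V * V => z (p.2 + p.1)) = z \o (fun p : V * V => p.1 + p.2)).
    apply: (measurableT_comp sz.1); exact: measurable_rV_add.
  by apply/funext => p /=; rewrite addrC.
have pt x : (((m x - z x) ^+ 2)%:E <= \int[mu]_v F (x, v))%E.
  have := @jensen_sqr _ _ mu (fun v => k (- v)) (fun v => z (v + x)) M (z x).
  case.
  - by move=> t; rewrite k0 (le_trans (ler_norm _))//.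
  - exact: csmooth_sqint.
  - exact: csmooth_integrable.
  - exact: k1.
  - exact: sqint_shift.
  move=> iF; rewrite -(mollify_shiftE _ ck sz.1) => h.
  have fk : (\int[mu]_v F (x, v))%E = (\int[mu]_t (k (- t) * (z (t + x) - z x) ^+ 2))%:E.
    exact: esym (fineK (integrable_fin_num measurableT iF)).
  by rewrite fk lee_fin.
have le : (\int[mu]_x ((m x - z x) ^+ 2)%:E <= e%:E)%E.
  apply: (@le_trans _ _ (\int[mu]_x \int[mu]_v F (x, v))%E).
    apply: ge0_le_integral => //.
    - by move=> x _; rewrite lee_fin sqr_ge0.
    - by apply/measurable_EFinP; apply: measurable_funX; apply: measurable_funB => //; exact: sz.1.
    - exact: (measurable_fun_fubini_tonelli_F F mF F0).
  rewrite (fubini_tonelli F mF F0).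
  apply: (@le_trans _ _ (\int[mu]_v (k (- v) * e)%:E)%E).
    apply: ge0_le_integral => //.
    - by move=> v _; apply: integral_ge0.
    - exact: (measurable_fun_fubini_tonelli_G F mF F0).
    - by apply/measurable_EFinP; apply: measurable_funM.
    (* Only translations [v] with nonzero weight count, and these satisfy [|v| < |c| + r <= D]. *)
    move=> v _; rewrite /F /=; have [kv|kv] := eqVneq (k (- v)) 0.
      rewrite kv mul0r; under eq_integral do rewrite mul0r; by rewrite integral0.
    have vC : (fun x => z (v + x) - z x) = (fun x => z (x + v) - z x).
      by apply/funext => x; rewrite [v + x]addrC.
    have svz : sqint mu (fun x => z (v + x) - z x).
      by rewrite vC; apply: sqintB => //; exact: sqint_shift.
    under eq_integral do rewrite EFinM.
    rewrite ge0_integralZl//; last 3 first.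
    - by apply/measurable_EFinP; apply: measurable_funX; exact: svz.1.
    - by move=> x _; rewrite lee_fin sqr_ge0.
    - by rewrite lee_fin.
    rewrite -sqnE// EFinM lee_wpmul2l ?lee_fin//.
    rewrite vC; apply: hD.
    apply: lt_le_trans cr; rewrite -normrN -[- v](subrK c) addrC.
    by apply: le_lt_trans (ler_normD _ _) _; rewrite ltrD2l; exact: kc.
  under eq_integral do rewrite EFinM.
  have ik := csmooth_integrable ck'.
  rewrite integralZr//; have := integrable_fin_num measurableT ik => /fineK <-.
  by rewrite [fine _]k1 mul1e.
have smz : sqint mu (fun x => m x - z x).
  apply/sqintP; split; first by apply: measurable_funB => //; exact: sz.1.
  by apply: le_lt_trans le _; rewrite ltry.
split; last by rewrite -lee_fin sqnE.
have := sqintD smz sz; rewrite (_ : (fun x => _) = m)//.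
by apply/funext => x; rewrite subrK.
Qed.

End kernels.

(** * Convergence of sequences in L^2 *)

Section l2cvg.
Context d (T : measurableType d) (R : realType) (mu : {measure set T -> \bar R}).
Implicit Types (f h : nat -> T -> R) (l g : T -> R).

Definition l2cvg f l := [/\ forall n, sqint mu (f n), sqint mu l &
  sqn mu (fun x => f n x - l x) @[n --> \oo] --> (0 : R)].

Lemma l2cvg_dot f l g : l2cvg f l -> sqint mu g ->
  dot mu (f n) g @[n --> \oo] --> dot mu l g.
Proof.
move=> [sf sl fl] sg; apply/subr_cvg0; apply/norm_cvg0P.
have h : Num.sqrt (sqn mu (fun x => f n x - l x)) * Num.sqrt (sqn mu g) @[n --> \oo] --> (0 : R).
  rewrite -[X in _ --> X](mul0r (Num.sqrt (sqn mu g))); apply: cvgM; last exact: cvg_cst.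
  by rewrite -[X in _ --> X](@sqrtr0 R); apply: continuous_cvg fl; exact: sqrt_continuous.
apply: (squeeze_cvgr _ (cvg_cst 0) h); apply: nearW => n.
rewrite normr_ge0/= -dotBl//; apply: norm_dot_le => //; exact: sqintB.
Qed.

Lemma l2cvg_sqn f l : l2cvg f l -> sqn mu (f n) @[n --> \oo] --> sqn mu l.
Proof.
move=> fl; have [sf sl h] := fl.
have E n : sqn mu (f n) = sqn mu (fun x => f n x - l x) + 2 * dot mu (f n) l - sqn mu l.
  by rewrite sqnBE//; ring.
rewrite (_ : (fun n => _) = fun n => sqn mu (fun x => f n x - l x) + 2 * dot mu (f n) l - sqn mu l); last exact/funext.
rewrite [X in _ --> X](_ : _ = 0 + 2 * dot mu l l - sqn mu l); last by rewrite /sqn; ring.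
apply: cvgB; last exact: cvg_cst.
by apply: cvgD => //; apply: cvgM; [exact: cvg_cst|exact: l2cvg_dot].
Qed.

Lemma l2cvgD f h l g : l2cvg f l -> l2cvg h g ->
  l2cvg (fun n x => f n x + h n x) (fun x => l x + g x).
Proof.
move=> [sf sl fl] [sh sg hg]; split; [by move=> n; exact: sqintD|exact: sqintD|].
have b : 2 * sqn mu (fun x => f n x - l x) + 2 * sqn mu (fun x => h n x - g x) @[n --> \oo] --> (0 : R).
  rewrite [X in _ --> X](_ : 0 = 2 * 0 + 2 * 0); last by rewrite mulr0 addr0.
  by apply: cvgD; apply: cvgM => //; exact: cvg_cst.
apply: (squeeze_cvgr _ (cvg_cst 0) b); apply: nearW => n; rewrite sqn_ge0/=.
rewrite (_ : (fun x => _) = fun x => (f n x - l x) + (h n x - g x)).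
  by apply: sqnD_le; exact: sqintB.
by apply/funext => x; ring.
Qed.

Lemma l2cvg_sum m (f : 'I_m -> nat -> T -> R) (l : 'I_m -> T -> R) :
  (forall i, l2cvg (f i) (l i)) ->
  l2cvg (fun n x => \sum_(i < m) f i n x) (fun x => \sum_(i < m) l i x).
Proof.
elim: m f l => [|m ih] f l fl.
  have E (g : 'I_0 -> T -> R) : (fun x => \sum_(i < 0) g i x) = cst 0.
    by apply/funext => x; rewrite big_ord0.
  rewrite E; under [X in l2cvg X]eq_fun do rewrite E.
  split=> [_||]; [exact: sqint0|exact: sqint0|].
  rewrite (_ : (fun n => _) = fun=> 0); first exact: cvg_cst.
  apply/funext => n; rewrite -[RHS](dot0l mu (fun=> 0)) /sqn.
  by congr dot; apply/funext => x; rewrite /= subr0.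
rewrite (_ : (fun x => _) = fun x => (\sum_(i < m) l (widen_ord (leqnSn m) i) x) + l ord_max x); last first.
  by apply/funext => x; rewrite big_ord_recr.
rewrite (_ : (fun n x => _) = fun n x => (\sum_(i < m) f (widen_ord (leqnSn m) i) n x) + f ord_max n x); last first.
  by apply/funext => n; apply/funext => x; rewrite big_ord_recr.
apply: l2cvgD => //.
exact: (ih (fun i => f (widen_ord (leqnSn m) i)) (fun i => l (widen_ord (leqnSn m) i))).
Qed.

Lemma l2cvg_bnd f l (b : T -> R) (M : R) : measurable_fun setT b -> (forall x, `|b x| <= M) ->
  l2cvg f l -> l2cvg (fun n x => b x * f n x) (fun x => b x * l x).
Proof.
move=> mb bM [sf sl fl]; split; [by move=> n; exact: (sqint_bnd mb bM)|exact: (sqint_bnd mb bM)|].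
have h : M ^+ 2 * sqn mu (fun x => f n x - l x) @[n --> \oo] --> (0 : R).
  by rewrite -[X in _ --> X](mulr0 (M ^+ 2)); apply: cvgM => //; exact: cvg_cst.
apply: (squeeze_cvgr _ (cvg_cst 0) h); apply: nearW => n; rewrite sqn_ge0/=.
have s := sqintB (sf n) sl.
rewrite (_ : (fun x => _) = fun x => b x * (f n x - l x)); last by apply/funext => x; ring.
rewrite -sqnZ//; apply: le_sqn; [exact: (sqint_bnd mb bM)|exact: sqintZ|].
by move=> x; rewrite !normrM ler_wpM2r// (le_trans (bM x))// ler_norm.
Qed.

Lemma l2_cauchy_cvg f : (forall n, sqint mu (f n)) ->
  (forall e, 0 < e -> exists N, forall m n, (N <= m)%N -> (N <= n)%N ->
    sqn mu (fun x => f m x - f n x) < e) -> exists l, l2cvg f l.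
Proof.
move=> sf /(sqint_complete sf)[g [sg hg]]; exists g; split => //.
apply/cvgr0Pnorm_lt => e e0; have [N hN] := hg _ e0; exists N => // n /= Nn.
by rewrite ger0_norm ?sqn_ge0//; exact: hN.
Qed.

Lemma l2cvg_cauchy f l : l2cvg f l -> forall e, 0 < e -> exists N, forall m n,
  (N <= m)%N -> (N <= n)%N -> sqn mu (fun x => f m x - f n x) < e.
Proof.
move=> [sf sl fl] e e0; have e4 : 0 < e / 4 by rewrite divr_gt0.
have /cvgr0_norm_lt/(_ _ e4)[N _ hN] := fl; exists N => m n Nm Nn.
have := hN m Nm; have := hN n Nn; rewrite /= !ger0_norm ?sqn_ge0// => h1 h2.
have := sqnB_tri (sf m) sl (sf n); rewrite [X in _ + 2 * X](sqnBC mu l) => h3.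
by apply: le_lt_trans h3 _; lra.
Qed.

End l2cvg.

(** * Integration by parts and energy identities *)

Section integration_by_parts.
Variables (R : realType) (n : nat).
Local Notation V := 'rV[R]_n.
Local Notation mu := (lebesgue_rV R n).
Implicit Types (f g : V -> R).

(* By translation invariance the integral of each difference quotient of [f]
   vanishes; they converge to the derivative uniformly, with supports in a
   common ball. *)
Lemma integral_pderiv0 i f : csmooth f -> \int[mu]_x pd [:: i] f x = 0.
Proof.
move=> cf; have [sf [r fr]] := cf.
have [M hM] := csmooth_bounded_pderiv2 cf.
have cdf := csmooth_pderiv [:: i] cf; have [_ [r' dfr]] := cdf.
pose rho := `|r| + `|r'| + 2.
pose B : set V := ball 0 rho.
have mB : measurable B by exact: measurable_rV_ball.
have iB : mu.-integrable setT (EFin \o (\1_B : V -> R)).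
  have := sqint_integrable (sqint_indic_ball (0 : V) rho) (sqint_indic_ball (0 : V) rho).
  apply: eq_integrable => // x _ /=; rewrite !indicE.
  by case: (_ \in _); rewrite ?mulr1 ?mulr0.
pose J := \int[mu]_x pd [:: i] f x.
pose C := `|n%:R * (n%:R * M)|.
have key (t : R) : 0 < t -> t < 1 -> `|J| <= t * (C * \int[mu]_x \1_B x).
  move=> t0 t1; pose e : V := t *: delta_mx 0 i.
  have e1 : `|e| <= t.
    by rewrite normrZ gtr0_norm// ler_piMr ?norm_delta_le// ltW.
  pose D x := f (x + e) - f x - t * pd [:: i] f x.
  have i1 : mu.-integrable setT (EFin \o (fun x => f (x + e))).
    apply: csmooth_integrable; split; first exact: smooth_shift.
    exists (r + `|e|) => x rx; apply: fr; rewrite -(ltrD2r `|e|) (lt_le_trans rx)//.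
    by rewrite -[in leLHS](addrK e x) (le_trans (ler_normB _ _)).
  have i2 := csmooth_integrable cf; have i3 := csmooth_integrable cdf.
  have i4 := csmooth_integrable (csmoothZ t cdf).
  have i12 : mu.-integrable setT (EFin \o (fun x => f (x + e) - f x)).
    exact: (integrableB measurableT i1 i2).
  have iD : mu.-integrable setT (EFin \o D) by exact: (integrableB measurableT i12 i4).
  have JD : \int[mu]_x D x = - (t * J).
    rewrite /D RintegralB// RintegralB// RintegralZl// (@Rintegral_rV_shift _ _ e f).
      by rewrite subrr sub0r.
    exact: (csmooth_sqint cf).1.
  have DB x : `|D x| <= C * t ^+ 2 * \1_B x.
    have := taylor_pderiv sf hM x e.
    rewrite (bigD1 i)//= big1 ?addr0; last first.
      by move=> j ji; rewrite !mxE (negbTE ji) andbF mulr0 mul0r.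
    rewrite !mxE !eqxx mulr1 -/(D x) => h.
    rewrite indicE; case: (boolP (x \in B)) => xB.
      rewrite mulr1; apply: le_trans h _; apply: (@le_trans _ _ (C * `|e| ^+ 2)).
        by rewrite ler_wpM2r ?exprn_ge0// ler_norm.
      by rewrite ler_wpM2l ?normr_ge0// lerXn2r ?nnegrE// ltW.
    have xr : rho <= `|x|.
      rewrite leNgt; apply/negP => xr; move/negP : xB; apply.
      by rewrite inE /B -ball_normE /= sub0r normrN.
    rewrite mulr0 /D fr; last first.
      rewrite -(ltrD2r `|e|) (@lt_le_trans _ _ `|x|)//; last first.
        by rewrite -[in leLHS](addrK e x) (le_trans (ler_normB _ _)).
      by apply: lt_le_trans xr; have := ler_norm r; have := normr_ge0 r'; rewrite /rho; lra.
    rewrite fr; last by apply: lt_le_trans xr; have := ler_norm r; have := normr_ge0 r'; rewrite /rho; lra.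
    rewrite dfr ?mulr0 ?subrr ?normr0//.
    by apply: lt_le_trans xr; have := ler_norm r'; have := normr_ge0 r; rewrite /rho; lra.
  have : `|t * J| <= C * t ^+ 2 * \int[mu]_x \1_B x.
    rewrite -normrN -JD; apply: le_trans (le_normr_Rintegral measurableT iD) _.
    rewrite -RintegralZl//; apply: le_Rintegral => //.
    - by apply: integrable_norm.
    - rewrite (_ : _ \o _ = fun x => ((C * t ^+ 2)%:E * (\1_B x)%:E)%E)//; exact: integrableZl.
  rewrite normrM (gtr0_norm t0) (_ : C * t ^+ 2 * _ = t * (t * (C * \int[mu]_x \1_B x))).
    by rewrite ler_pM2l.
  by ring.
apply/eqP; rewrite -normr_le0 -/J; apply/ler_addgt0Pr => e e0; rewrite add0r.
pose K := `|C * \int[mu]_x \1_B x| + 1; have K0 : 0 < K by rewrite ltr_wpDl.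
pose t := Num.min (e / K) (2^-1).
have t0 : 0 < t by rewrite lt_min divr_gt0// invr_gt0 ltr0n.
have t1 : t < 1 by rewrite gt_min invf_lt1// ltr1n orbT.
apply: le_trans (key t t0 t1) _.
apply: (@le_trans _ _ (t * K)); first by rewrite (ler_wpM2l (ltW t0))// (le_trans (ler_norm _))// lerDl.
by rewrite -ler_pdivlMr// ge_min lexx.
Qed.

Lemma dot_pderiv i f g : csmooth f -> smooth g ->
  dot mu (pd [:: i] f) g = - dot mu f (pd [:: i] g).
Proof.
move=> cf sg; have [sf _] := cf.
have := integral_pderiv0 i (csmoothM cf sg).
rewrite pderivM_smooth// RintegralD//; last 2 first.
- by apply: csmooth_integrable; apply: csmoothM => //; exact: smooth_pderiv.
- by apply: csmooth_integrable; apply: csmoothM => //; exact: csmooth_pderiv.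
move=> /eqP; rewrite addr_eq0 => /eqP h; rewrite dotC [in RHS]dotC /dot h opprK.
by [].
Qed.

Lemma pderiv_cons2 i j f : pd [:: i; j] f = pd [:: i] (pd [:: j] f).
Proof. exact: (pderiv_cat [:: i] [:: j]). Qed.

Lemma dot_pderiv2 i j f g : csmooth f -> smooth g ->
  dot mu (pd [:: i; j] f) g = dot mu f (pd [:: j; i] g).
Proof.
move=> cf sg; have cj := csmooth_pderiv [:: j] cf; have si := smooth_pderiv [:: i] sg.
by rewrite pderiv_cons2 (dot_pderiv i cj sg) (dot_pderiv j cf si) opprK -pderiv_cons2.
Qed.

(** Two integrations by parts, with partial derivatives commuted in between. Summed over [i] and
    [j], the right side becomes the squared norm of the Laplacian. *)
Lemma dot_mixed_pderiv i j f : csmooth f ->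
  sqn mu (pd [:: i; j] f) = dot mu (pd [:: j; j] f) (pd [:: i; i] f).
Proof.
move=> cf; have [sf _] := cf.
have cj := csmooth_pderiv [:: j] cf; have sij := smooth_pderiv [:: i; j] sf.
have sii := smooth_pderiv [:: i; i] sf.
rewrite /sqn [X in dot _ X _]pderiv_cons2 (dot_pderiv i cj sij).
have -> : pd [:: i] (pd [:: i; j] f) = pd [:: j] (pd [:: i; i] f).
  rewrite (pderivC i j sf) pderiv_cons2 -pderiv_cons2.
  by rewrite (pderivC i j (smooth_pderiv [:: i] sf)) pderiv_cons2 -(pderiv_cons2 i i).
by rewrite [pd [:: j; j] f]pderiv_cons2 (dot_pderiv j cj sii).
Qed.

Lemma laplacianE f : laplacian f = fun x => \sum_(i < n) pd [:: i; i] f x.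
Proof. by apply/funext => x; apply: eq_bigr => i _; rewrite pdE. Qed.

Lemma csmooth_laplacian f : csmooth f -> csmooth (laplacian f).
Proof.
move=> cf; rewrite laplacianE; elim: (index_enum _) => [|i s ih].
  under eq_fun do rewrite big_nil; split; first exact: smooth_cst.
  by exists 0.
by under eq_fun do rewrite big_cons; apply: csmoothD => //; exact: csmooth_pderiv.
Qed.

Lemma dot_laplacian f g : csmooth f -> sqint mu g ->
  dot mu (laplacian f) g = \sum_(i < n) dot mu (pd [:: i; i] f) g.
Proof.
move=> cf sg; rewrite laplacianE (@dot_suml _ _ _ _ _ (fun i => pd [:: i; i] f))// => i.
exact: (csmooth_sqint (csmooth_pderiv [:: i; i] cf)).
Qed.

Lemma sum_sqn_hessian f : csmooth f ->
  \sum_(i < n) \sum_(j < n) sqn mu (pd [:: i; j] f) = sqn mu (laplacian f).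
Proof.
move=> cf; have c i := csmooth_sqint (csmooth_pderiv [:: i; i] cf).
have cL := csmooth_sqint (csmooth_laplacian cf).
rewrite /sqn (dot_laplacian cf cL) exchange_big; apply: eq_bigr => j _.
rewrite dotC (dot_laplacian cf (c j)); apply: eq_bigr => i _.
by rewrite dotC -dot_mixed_pderiv.
Qed.

Lemma sum_sqn_gradient f : csmooth f ->
  \sum_(i < n) sqn mu (pd [:: i] f) = - dot mu f (laplacian f).
Proof.
move=> cf; have [sf _] := cf; have sqf := csmooth_sqint cf.
rewrite dotC (dot_laplacian cf sqf) -sumrN; apply: eq_bigr => i _.
by rewrite /sqn (dot_pderiv i cf (smooth_pderiv [:: i] sf)) -pderiv_cons2 dotC.
Qed.

End integration_by_parts.

(** * Weak derivatives on the whole space *)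

Section weak_derivatives.
Variables (R : realType) (n : nat).
Local Notation V := 'rV[R]_n.
Local Notation mu := (lebesgue_rV R n).
Implicit Types (z g : V -> R) (G : 'I_n -> V -> R) (H : 'I_n -> 'I_n -> V -> R).

(** The gradient is recorded because the product rule for the Hessian needs it. Test functions range
    over the whole space, so reflected kernels [k (x - y)] qualify for every [x]. *)
Definition weak_derivs z G H := [/\ sqint mu z, forall i, sqint mu (G i),
  forall i j, sqint mu (H i j),
  forall i psi, csmooth psi -> dot mu z (pd [:: i] psi) = - dot mu (G i) psi &
  forall i j psi, csmooth psi -> dot mu z (pd [:: i; j] psi) = dot mu (H i j) psi].

Lemma csmooth_sqintM chi z : csmooth chi -> sqint mu z -> sqint mu (fun x => chi x * z x).
Proof.
move=> cc sz; have [M hM] := csmooth_bounded cc.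
exact: (sqint_bnd (csmooth_sqint cc).1 hM).
Qed.

Lemma dot_mulA chi z psi : dot mu (fun x => chi x * z x) psi = dot mu z (fun x => chi x * psi x).
Proof. by apply: eq_Rintegral => x _; rewrite mulrCA mulrA. Qed.

Lemma weak_derivsM chi z G H : csmooth chi -> weak_derivs z G H ->
  weak_derivs (fun x => chi x * z x)
    (fun i x => chi x * G i x + pd [:: i] chi x * z x)
    (fun i j x => chi x * H i j x + pd [:: i] chi x * G j x + pd [:: j] chi x * G i x
       + pd [:: j; i] chi x * z x).
Proof.
move=> cc [sz sG sH wG wH]; have [sc _] := cc.
have ci i : csmooth (pd [:: i] chi) by exact: csmooth_pderiv.
have cij i j : csmooth (pd [:: i; j] chi) by exact: csmooth_pderiv.
have sM c w : csmooth c -> sqint mu w -> sqint mu (fun x => c x * w x) by exact: csmooth_sqintM.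
split.
- exact: sM.
- by move=> i; apply: sqintD; apply: sM.
- by move=> i j; do !apply: sqintD; apply: sM.
- move=> i psi cp; have [sp _] := cp.
  have cpsi := csmoothM cp sc; have spi := csmooth_sqint (csmooth_pderiv [:: i] cp).
  rewrite dot_mulA dotDl//; [|exact: sM|exact: sM|exact: csmooth_sqint].
  rewrite !dot_mulA -[dot mu (G i) _]opprK -(wG i _ cpsi) (pderivM_smooth i sc sp).
  rewrite [X in dot mu z X = _](_ : _ = fun x => (pd [:: i] chi x * psi x + chi x * pd [:: i] psi x)
     - pd [:: i] chi x * psi x); last by apply/funext => x; rewrite addrAC subrr add0r.
  have s1 : sqint mu (fun x => pd [:: i] chi x * psi x) by apply: sM => //; exact: csmooth_sqint.
  rewrite dotBr//; last by apply: sqintD => //; apply: sM.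
  by rewrite opprD opprK.
- move=> i j psi cp; have [sp _] := cp.
  have sqp := csmooth_sqint cp.
  have cpsi := csmoothM cp sc.
  have c1 := csmoothM cp (smooth_pderiv [:: i] sc).
  have c2 := csmoothM cp (smooth_pderiv [:: j] sc).
  have c3 := csmoothM cp (smooth_pderiv [:: j; i] sc).
  have s1 := csmooth_sqint (csmooth_pderiv [:: i; j] cpsi).
  have s2 := csmooth_sqint (csmooth_pderiv [:: j] c1).
  have s3 := csmooth_sqint (csmooth_pderiv [:: i] c2).
  have s4 := csmooth_sqint c3.
  (* The product rule backwards: every term becomes a derivative of a test function, to which [wH]
     or [wG] applies, except the last, which contains [psi] itself. *)
  have E : (fun x => chi x * pd [:: i; j] psi x) =
     (fun x => pd [:: i; j] (fun x => chi x * psi x) x - pd [:: j] (fun x => pd [:: i] chi x * psi x) x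
       - pd [:: i] (fun x => pd [:: j] chi x * psi x) x + pd [:: j; i] chi x * psi x).
    apply/funext => x.
    have e1 := pderivM_smooth j sc sp.
    have e2 := pderivM_smooth j (smooth_pderiv [:: i] sc) sp.
    have e3 := pderivM_smooth i (smooth_pderiv [:: j] sc) sp.
    have sjc := smooth_pderiv [:: j] sc; have sjp := smooth_pderiv [:: j] sp.
    have e4 := pderivD_smooth i (smoothM sjc sp) (smoothM sc sjp).
    have e5 := pderivM_smooth i sc sjp.
    rewrite (pderiv_cons2 i j (fun x => chi x * psi x)) e1 e4 e3 e5 e2 -!pderiv_cons2.
    ring.
  rewrite dot_mulA E.
  rewrite dotDr//; [|by do 2?apply: sqintB].
  rewrite dotBr//; [|exact: sqintB].
  rewrite dotBr// (wH i j _ cpsi) (wG j _ c1) (wG i _ c2) !opprK.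
  rewrite dotDl//; [|by do 2?[apply: sqintD]; apply: sM|exact: sM].
  rewrite dotDl//; [|by apply: sqintD; apply: sM|exact: sM].
  rewrite dotDl//; [|exact: sM|exact: sM].
  by rewrite !dot_mulA.
Qed.

Lemma weak_derivsB z z' G G' H H' : weak_derivs z G H -> weak_derivs z' G' H' ->
  weak_derivs (fun x => z x - z' x) (fun i x => G i x - G' i x)
    (fun i j x => H i j x - H' i j x).
Proof.
move=> [sz sG sH wG wH] [sz' sG' sH' wG' wH']; split.
- exact: sqintB.
- by move=> i; exact: sqintB.
- by move=> i j; exact: sqintB.
- move=> i psi cp; have s1 := csmooth_sqint (csmooth_pderiv [:: i] cp).
  have s2 := csmooth_sqint cp.
  by rewrite !dotBl// wG// wG'// opprB opprK addrC.
- move=> i j psi cp; have s1 := csmooth_sqint (csmooth_pderiv [:: i; j] cp).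
  have s2 := csmooth_sqint cp.
  by rewrite !dotBl// wH// wH'.
Qed.

Lemma pderiv2_reflect i j k (x : V) : smooth k ->
  pd [:: i; j] (fun y => k (x - y)) = fun y => pd [:: i; j] k (x - y).
Proof.
move=> sk; rewrite pderiv_cons2 (pderiv_reflect j x sk).
have sj := smooth_pderiv [:: j] sk; have sr := smooth_reflect x sj.
have -> : (fun y => - pd [:: j] k (x - y)) = (fun y => (-1) * pd [:: j] k (x - y)).
  by apply/funext => y; rewrite mulN1r.
rewrite (pderivZ_smooth i (-1) sr) (pderiv_reflect i x sj) -pderiv_cons2.
by apply/funext => y; rewrite mulN1r opprK.
Qed.

(** Differentiating the kernel twice in [x] or in [y] gives the same sign, and as a function of [y]
    the reflected kernel is a test function. *)
Lemma pderiv2_mollify i j k z G H : csmooth k -> weak_derivs z G H ->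
  pd [:: i; j] (mollify k z) = mollify k (H i j).
Proof.
move=> ck [sz sG sH wG wH]; rewrite pderiv_mollify//; apply/funext => x.
have := wH i j _ (csmooth_reflect x ck).
rewrite (pderiv2_reflect i j x ck.1) dotC => h.
by rewrite /mollify -/(dot _ _ _) h dotC.
Qed.

Lemma laplacian_mollify k z g : csmooth k -> sqint mu z -> sqint mu g ->
  (forall psi, csmooth psi -> dot mu z (laplacian psi) = dot mu g psi) ->
  laplacian (mollify k z) = mollify k g.
Proof.
move=> ck sz sg zg; apply/funext => x.
have := zg _ (csmooth_reflect x ck); rewrite [RHS]dotC => h.
rewrite /mollify -/(dot _ _ g) -h [RHS]dotC dot_laplacian//; last exact: csmooth_reflect.
rewrite laplacianE; apply: eq_bigr => i _.
by rewrite pderiv_mollify// (pderiv2_reflect i i x ck.1).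
Qed.

Lemma exists_common_radius (I : finType) (P : I -> R -> Prop) :
  (forall i r r', P i r -> r' <= r -> P i r') ->
  (forall i, exists2 r, 0 < r & P i r) -> exists2 r, 0 < r & forall i, P i r.
Proof.
move=> mono ex; have /choice[r hr] : forall i, exists r, 0 < r /\ P i r.
  by move=> i; have [r] := ex i; exists r.
have s0 : 0 < \sum_i (r i)^-1 + 1.
  by rewrite ltr_wpDl// sumr_ge0// => i _; rewrite invr_ge0 ltW// (hr i).1.
(* Its inverse exceeds every [(r i)^-1]; the summand 1 keeps it positive for an empty index type. *)
exists (\sum_i (r i)^-1 + 1)^-1; first by rewrite invr_gt0.
move=> i; apply: mono (hr i).2 _; have ri := (hr i).1.
rewrite -[leRHS]invrK lef_pV2 ?posrE ?invr_gt0//.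
rewrite (bigD1 i)//= -addrA lerDl addr_ge0// sumr_ge0// => j _.
by rewrite invr_ge0 ltW// (hr j).1.
Qed.

Lemma mollify_cvg (z : V -> R) (e : R) : sqint mu z -> 0 < e -> exists2 D, 0 < D &
  forall k c r, kernel_in k c r -> `|c| + r <= D ->
    sqint mu (mollify k z) /\ sqn mu (fun x => mollify k z x - z x) < e.
Proof.
move=> sz e0; have e2 : 0 < e / 2 by rewrite divr_gt0.
have [D D0 hD] := sqint_shift_continuous sz e2; exists D => // k c r kk cr.
have hD' v : `|v| < D -> sqn mu (fun x => z (x + v) - z x) <= e / 2 by move=> /hD /ltW.
have [h1 h2] := mollify_approx kk cr (ltW e2) sz hD'.
by split => //; apply: le_lt_trans h2 _; lra.
Qed.

(** Square-integrability comes from [mollify_approx] with the crude bound [4 * sqn mu z] on the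
    distance to any translate. *)
Lemma mollify_sqint k c r z : kernel_in k c r -> sqint mu z -> sqint mu (mollify k z).
Proof.
move=> kk sz; have h v : `|v| < `|c| + r -> sqn mu (fun x => z (x + v) - z x) <= 4 * sqn mu z.
  move=> _; have := sqnD_le (sqint_shift v sz) (sqintN sz).
  by rewrite sqnN sqn_shift//; [move=> /le_trans; apply; lra|exact: sz.1].
have e0 : 0 <= 4 * sqn mu z by rewrite mulr_ge0// sqn_ge0.
by have [] := mollify_approx kk (lexx _) e0 sz h.
Qed.

(** One sequence of kernels for all functions: [weak_derivs_exist] mollifies [z] and its Laplacian
    simultaneously, so that one is the Laplacian of the other at every stage. *)
Lemma mollify_seq_cvg : exists k : nat -> V -> R,
  (forall m, kernel_in (k m) 0 m.+1%:R^-1) /\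
  forall z, sqint mu z -> l2cvg mu (fun m => mollify (k m) z) z.
Proof.
have /choice[k hk] : forall m : nat, exists k, kernel_in k (0 : V) (m.+1%:R^-1 : R).
  by move=> m; apply: kernel_exists; rewrite invr_gt0.
exists k; split => // z sz; split => //; first by move=> m; exact: mollify_sqint (hk m) sz.
apply/cvgr0Pnorm_lt => e e0; have [D D0 hD] := mollify_cvg sz e0.
near=> m; rewrite ger0_norm ?sqn_ge0//.
apply: (hD _ _ _ (hk m) _).2; rewrite normr0 add0r ltW//.
near: m; exact: (near_infty_natSinv_lt (PosNum D0)).
Unshelve. all: by end_near. Qed.

Lemma oppr_dot_le f g : sqint mu f -> sqint mu g -> - dot mu f g <= (sqn mu f + sqn mu g) / 2.
Proof.
move=> sf sg; have := sqn_ge0 mu (fun x => f x + g x); rewrite (sqnDE sf sg); lra.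
Qed.

Lemma eq_cvg_unique (a b : nat -> R) (l l' : R) : a =1 b ->
  a n @[n --> \oo] --> l -> b n @[n --> \oo] --> l' -> l = l'.
Proof. by move=> /funext <-; exact: cvg_unique. Qed.

Lemma weak_derivs_exist z g : sqint mu z -> bounded_support z -> sqint mu g ->
  (forall psi, csmooth psi -> dot mu z (laplacian psi) = dot mu g psi) ->
  exists G H, weak_derivs z G H.
Proof.
move=> sz bz sg zg; have [k [hk kcvg]] := mollify_seq_cvg.
pose w m := mollify (k m) z.
have ck m : csmooth (k m) by have [] := hk m.
have cw m : csmooth (w m) by exact: mollify_csmooth.
have sw m := (cw m).1.
have lw m : laplacian (w m) = mollify (k m) g by exact: laplacian_mollify.
have cd m p : csmooth (fun x => w m x - w p x) by exact: csmoothB.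
have d1 i m p : pd [:: i] (fun x => w m x - w p x) = fun x => pd [:: i] (w m) x - pd [:: i] (w p) x.
  exact: pderivB_smooth.
have d2 i j m p : pd [:: i; j] (fun x => w m x - w p x)
    = fun x => pd [:: i; j] (w m) x - pd [:: i; j] (w p) x.
  rewrite pderiv_cons2 (d1 j m p) (pderivB_smooth i (smooth_pderiv _ (sw m)) (smooth_pderiv _ (sw p))).
  by rewrite -!pderiv_cons2.
have dl m p : laplacian (fun x => w m x - w p x) = fun x => mollify (k m) g x - mollify (k p) g x.
  rewrite -!lw !laplacianE; apply/funext => x; rewrite -sumrB; apply: eq_bigr => i _.
  by rewrite d2.
have wC := l2cvg_cauchy (kcvg z sz); have gC := l2cvg_cauchy (kcvg g sg).
have /choice[G hG] : forall i, exists G : V -> R, l2cvg mu (fun m => pd [:: i] (w m)) G.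
  move=> i; apply: l2_cauchy_cvg => [m|e e0].
    by apply: csmooth_sqint; exact: csmooth_pderiv.
  have [N hN] := wC _ e0; have [N' hN'] := gC _ e0.
  exists (maxn N N') => m p; rewrite !geq_max => /andP[m1 m2] /andP[p1 p2].
  have h1 := hN _ _ m1 p1; have h2 := hN' _ _ m2 p2.
  have := sum_sqn_gradient (cd m p); rewrite dl => h3.
  have s1 := csmooth_sqint (cd m p).
  have s2 : sqint mu (fun x => mollify (k m) g x - mollify (k p) g x).
    by apply: sqintB; exact: mollify_sqint (hk _) sg.
  (* For a difference [d] of two mollifications the gradient energy is minus the product of [d] with
     its Laplacian, at most half the sum of their squared norms, both of which are below [e]. *)
  have h4 := oppr_dot_le s1 s2.
  have h5 : sqn mu (pd [:: i] (fun x => w m x - w p x)) <=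
      \sum_(i < n) sqn mu (pd [:: i] (fun x => w m x - w p x)).
    by rewrite [leRHS](bigD1 i)//= lerDl; apply: sumr_ge0 => *; exact: sqn_ge0.
  rewrite -d1; apply: le_lt_trans h5 _; rewrite h3; apply: le_lt_trans h4 _.
  by rewrite ltr_pdivrMr// mulr_natr mulr2n ltrD.
have /choice[H hH] : forall ij : 'I_n * 'I_n,
    exists H : V -> R, l2cvg mu (fun m => pd [:: ij.1; ij.2] (w m)) H.
  move=> [i j]; apply: l2_cauchy_cvg => [m|e e0] /=.
    by apply: csmooth_sqint; exact: csmooth_pderiv.
  have [N hN] := gC _ e0.
  exists N => m p m1 p1; apply: le_lt_trans _ (hN _ _ m1 p1).
  rewrite -dl -(sum_sqn_hessian (cd m p)) -d2 (bigD1 i)//= (bigD1 j)//= -addrA lerDl.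
  by rewrite addr_ge0// sumr_ge0// => *; rewrite ?sumr_ge0// => *; exact: sqn_ge0.
exists G, (fun i j => H (i, j)); split => //.
- by move=> i; have [] := hG i.
- by move=> i j; have [] := hH (i, j).
- move=> i psi cp.
  have s1 := csmooth_sqint (csmooth_pderiv [:: i] cp); have s2 := csmooth_sqint cp.
  have h1 := l2cvg_dot (kcvg z sz) s1.
  have h2 : - dot mu (pd [:: i] (w m)) psi @[m --> \oo] --> - dot mu (G i) psi.
    by apply: cvgN; exact: l2cvg_dot.
  by apply: eq_cvg_unique h1 h2 => m; rewrite (dot_pderiv i (cw m) cp.1) opprK.
- move=> i j psi cp.
  have s1 := csmooth_sqint (csmooth_pderiv [:: i; j] cp); have s2 := csmooth_sqint cp.
  have h1 := l2cvg_dot (kcvg z sz) s1.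
  have h2 := l2cvg_dot (hH (i, j)) s2.
  by apply: eq_cvg_unique h1 h2 => m; rewrite (dot_pderiv2 i j (cw m) cp.1) (pderivC j i cp.1).
Qed.

End weak_derivatives.

(** * The spaces over the domain *)

Section l2_norm.
Context d (T : measurableType d) (R : realType) (mu : {measure set T -> \bar R}).
Implicit Types f : T -> R.

Lemma Lnorm2E f : ('N[mu]_2%:E[EFin \o f] = (\int[mu]_x (f x ^+ 2)%:E) `^ 2^-1)%E.
Proof.
rewrite unlock; congr (_ `^ _)%E; apply: eq_integral => x _ /=.
by rewrite powR_mulrn ?normr_ge0// real_normK ?num_real.
Qed.

Lemma Lfun2P f : f \in Lfun mu 2%:E <-> sqint mu f.
Proof.
split=> [lf|sf].
  by split; [have /sub_Lfun_mfun := lf; rewrite inE|exact: Lfun2_integrable_sqr].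
rewrite inE; apply/andP; split; rewrite inE /=; first exact: sf.1.
by rewrite /finite_norm Lnorm2E -sqnE// poweR_EFin ltry.
Qed.

Lemma fine_Lnorm2 f : sqint mu f -> fine 'N[mu]_2%:E[EFin \o f]%E = Num.sqrt (sqn mu f).
Proof. by move=> sf; rewrite Lnorm2E -sqnE// poweR_EFin/= powR12_sqrt// sqn_ge0. Qed.

End l2_norm.

Section interface.
Variables (R : realType) (n : nat) (Omega : set 'rV[R]_n).
Local Notation V := 'rV[R]_n.
Local Notation mu := (lebesgue_rV R n).
Hypothesis oO : open Omega.
Implicit Types (u v z g f phi psi : V -> R) (H : V -> 'M[R]_n).

Let mO : measurable Omega. Proof. exact: open_measurable_rV. Qed.

Lemma L2P z : L2 Omega z <-> sqint mu (z \_ Omega).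
Proof. exact: Lfun2P. Qed.

Lemma normL2E z : L2 Omega z -> normL2 Omega z = Num.sqrt (sqn mu (z \_ Omega)).
Proof. by move=> /L2P; exact: fine_Lnorm2. Qed.

Lemma sqr_normL2 z : L2 Omega z -> normL2 Omega z ^+ 2 = sqn mu (z \_ Omega).
Proof. by move=> lz; rewrite normL2E// sqr_sqrtr// sqn_ge0. Qed.

Lemma restrictMl u v : (fun x => u x * v x) \_ Omega = fun x => (u \_ Omega) x * v x.
Proof. by apply/funext => x; rewrite !patchE; case: ifP; rewrite ?mul0r. Qed.

Lemma dotL2E u v : dotL2 Omega u v = dot mu (u \_ Omega) v.
Proof. by rewrite /dotL2 Rintegral_mkcond restrictMl. Qed.

Lemma dot_restrictr u v : dot mu (u \_ Omega) (v \_ Omega) = dot mu (u \_ Omega) v.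
Proof.
by apply: eq_Rintegral => x _; rewrite !patchE; case: ifP; rewrite ?mul0r.
Qed.

Lemma restrict_support f : (forall x, f x != 0 -> Omega x) -> f \_ Omega = f.
Proof.
move=> h; apply/funext => x; rewrite patchE; case: ifPn => // /negP xO.
by apply/esym/eqP; apply: contra_notT xO => /h; rewrite inE.
Qed.

Lemma restrictB f g : (fun x => f x - g x) \_ Omega = fun x => (f \_ Omega) x - (g \_ Omega) x.
Proof. by apply/funext => x; rewrite !patchE; case: ifP; rewrite ?subrr. Qed.

Lemma pderiv_support s f x : pd s f x != 0 -> closure [set y | f y != 0] x.
Proof.
move=> h; apply: contrapT => nx; move/eqP: h; apply; move: x nx.
elim: s => [|i s ih] x nx.
  by apply/eqP; apply: contra_notT nx; rewrite pderiv0 => h; exact: subset_closure.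
rewrite -[i :: s]cat1s pderiv_cat pderiv1E -(derive_cst (0 : R) x (delta_mx 0 i)).
apply: near_eq_derive; near=> y; apply: ih; near: y.
by apply: open_nbhs_nbhs; split => //; exact/closed_openC/closed_closure.
Unshelve. all: by end_near. Qed.

Lemma test_csmooth phi : test_function Omega phi -> csmooth phi.
Proof.
move=> [sphi /compact_bounded[M [_ hM]] _]; split => //; exists (M + 1) => x Mx.
apply/eqP; apply: contraTT Mx => px; rewrite -leNgt.
have M1 : M < M + 1 by rewrite ltrDl.
by apply: (hM _ M1 x); exact: (@subset_closure _ [set y | phi y != 0]).
Qed.

Lemma test_support s phi x : test_function Omega phi -> pd s phi x != 0 -> Omega x.
Proof. by move=> [_ _ h] /pderiv_support /h. Qed.

Lemma closure_bounded (A : set V) (r : R) : (forall x, A x -> `|x| <= r) ->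
  forall x, closure A x -> `|x| <= r.
Proof.
move=> hr x; have cr : closed [set x : V | `|x| <= r].
  by apply: closed_comp (@closed_le R r) => y _; exact: norm_continuous.
move/closure_id: cr => cr h; suff : [set x : V | `|x| <= r] x by [].
by rewrite cr; exact: closureS h.
Qed.

Lemma test_functionI phi (K : set V) : csmooth phi -> closed K -> K `<=` Omega ->
  (forall x, phi x != 0 -> K x) -> test_function Omega phi.
Proof.
move=> [sphi [r hr]] cK KO phiK; have cl := @closed_closure _ [set x | phi x != 0].
have cK' : closure [set x | phi x != 0] `<=` K.
  by move/closure_id: cK => ->; exact: closureS.
split => //; last exact: subset_trans KO.
apply: bounded_closed_compact => //.
exists r; split; first exact: num_real.
move=> M rM x cx; apply: le_trans (ltW rM); apply: closure_bounded cx => y /=.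
by apply: contraNT; rewrite -ltNge => /hr ->.
Qed.

(** The fundamental lemma of the calculus of variations. At a point of Omega, a small reflected
    kernel is a test function, so the mollification of [h] vanishes there eventually. *)
Lemma sqn0_of_dot_test h : sqint mu h -> (forall x, h x != 0 -> Omega x) ->
  (forall phi, test_function Omega phi -> dot mu h phi = 0) -> sqn mu h = 0.
Proof.
move=> sh hO h0; have [k [hk kcvg]] := mollify_seq_cvg R n.
have [sm _ mh] := kcvg h sh.
(* This sequence tends to [h] at every point, while its norm is at most that of
   [h - mollify (k m) h], which tends to 0; Fatou then gives [sqn mu h <= e] for every positive
   [e]. *)
pose f m x := \1_Omega x * (h x - mollify (k m) h x).
have mI : measurable_fun setT (\1_Omega : V -> R) by exact: measurable_indic.
have I1 x : `|\1_Omega x : R| <= 1 by rewrite indicE; case: (_ \in _); rewrite ?normr1 ?normr0.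
have sf m : sqint mu (f m).
  by apply: (sqint_bnd mI I1); apply: sqintB => //; exact: sm.
have fh x : f m x @[m --> \oo] --> h x.
  have [Ox|nOx] := pselect (Omega x); last first.
    have hx : h x = 0 by apply/eqP; apply: contra_notT nOx; exact: hO.
    rewrite (_ : (fun m => _) = fun=> h x); first exact: cvg_cst.
    by apply/funext => m; rewrite /f indicE hx memNset// mul0r.
  have /nbhs_ballP[r /= r0 rO] : nbhs x Omega by exact: open_nbhs_nbhs.
  apply: cvg_near_cst; near=> m; rewrite /f indicE mem_set// mul1r.
  rewrite (_ : mollify _ _ _ = 0) ?subr0//.
  rewrite /mollify -/(dot mu _ h) dotC; apply: h0.
  have [ck _ kr _] := hk m.
  apply: (@test_functionI _ (closed_ball x m.+1%:R^-1)).
  - exact: csmooth_reflect.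
  - exact: closed_ball_closed.
  - apply: subset_trans rO => y; rewrite closed_ballE ?invr_gt0//.
    rewrite /closed_ball_ -ball_normE /= => xy; apply: le_lt_trans xy _.
    by near: m; exact: (near_infty_natSinv_lt (PosNum r0)).
  - move=> y /kr; rewrite subr0 => xy.
    rewrite closed_ballE ?invr_gt0// /closed_ball_/=; exact: ltW.
have e0 e : 0 < e -> sqn mu h <= e.
  move=> e0; apply: (@fatou_sqn _ _ _ mu f h e sf sh.1 _ _).2.
    exact: aeW.
  move/cvgr0_norm_lt: mh => /(_ _ e0); apply: filterS => m /=.
  rewrite ger0_norm ?sqn_ge0// => /ltW; apply: le_trans.
  rewrite [leRHS]sqnBC; apply: le_sqn => //; first exact: sqintB.
  by move=> x; rewrite /f normrM ler_piMl.
apply/eqP; rewrite eq_le sqn_ge0 andbT leNgt; apply/negP => hp.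
have := e0 _ (divr_gt0 hp (ltr0n R 2)); lra.
Unshelve. all: by end_near. Qed.

(** Uniqueness of weak derivatives, which frees all norms from the choice made by [xget]. *)
Lemma restrict_ae_eq g g' : L2 Omega g -> L2 Omega g' ->
  (forall phi, test_function Omega phi -> dotL2 Omega g phi = dotL2 Omega g' phi) ->
  sqn mu (fun x => (g \_ Omega) x - (g' \_ Omega) x) = 0.
Proof.
move=> /L2P sg /L2P sg' h; apply: sqn0_of_dot_test; first exact: sqintB.
  by move=> x; apply: contraNP => nO; rewrite !patchE memNset// subrr.
move=> phi tphi; have sphi := csmooth_sqint (test_csmooth tphi).
by rewrite dotBl// -!dotL2E h// subrr.
Qed.

Lemma weak_laplacianP z g : is_weak_laplacian Omega z g ->
  is_weak_laplacian Omega z (weak_laplacian Omega z).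
Proof. by move=> zg; apply: (@xgetPex _ _ [set g | is_weak_laplacian Omega z g]); exists g. Qed.

Lemma weak_laplacian_ae z g : is_weak_laplacian Omega z g ->
  sqn mu (fun x => ((weak_laplacian Omega z) \_ Omega) x - (g \_ Omega) x) = 0.
Proof.
move=> zg; have [lz hz] := weak_laplacianP zg; have [lg hg] := zg.
by apply: restrict_ae_eq => // phi tphi; rewrite -hz// -hg.
Qed.

Lemma weak_hessianP z H : is_weak_hessian Omega z H ->
  is_weak_hessian Omega z (weak_hessian Omega z).
Proof. by move=> zH; apply: (@xgetPex _ _ [set H | is_weak_hessian Omega z H]); exists H. Qed.

Lemma weak_hessian_sqn z H i j : is_weak_hessian Omega z H ->
  normL2 Omega (fun x => weak_hessian Omega z x i j) ^+ 2 =
  sqn mu ((fun x => H x i j) \_ Omega).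
Proof.
move=> zH; have [lz hz] := weak_hessianP zH i j; have [lH hH] := zH i j.
rewrite sqr_normL2//; apply: sqn_eq; [exact/L2P|exact/L2P|].
by apply: restrict_ae_eq => // phi tphi; rewrite -hz// -hH.
Qed.

Lemma normL2_weak_laplacian z g : is_weak_laplacian Omega z g ->
  normL2 Omega (weak_laplacian Omega z) = Num.sqrt (sqn mu (g \_ Omega)).
Proof.
move=> zg; have [lz _] := weak_laplacianP zg; rewrite normL2E//; congr Num.sqrt.
by apply: sqn_eq; [exact/L2P|exact/L2P/zg.1|exact: weak_laplacian_ae].
Qed.

Lemma dot_weak_laplacian z g w : is_weak_laplacian Omega z g -> L2 Omega w ->
  dotL2 Omega w (weak_laplacian Omega z) = dot mu (w \_ Omega) g.
Proof.
move=> zg /L2P lw; have [/L2P lz _] := weak_laplacianP zg; have [/L2P lg _] := zg.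
rewrite dotL2E -dot_restrictr -[RHS]dot_restrictr; apply/eqP; rewrite -subr_eq0 -dotBr//.
rewrite dotC dot_sqn0//; [exact: sqintB|exact: weak_laplacian_ae].
Qed.

Lemma cutoff_exists (c : V) (r s : R) : 0 < r -> r < s -> exists chi : V -> R,
  [/\ csmooth chi, forall x, `|x - c| < r -> chi x = 1 & forall x, chi x != 0 -> `|x - c| < s].
Proof.
(* The cutoff is the indicator of the ball of radius [r + e] mollified at scale [e]: it equals 1 up
   to radius [r] and vanishes from [r + 2 * e = s] on. *)
move=> r0 rs; pose e := (s - r) / 2; have e0 : 0 < e by rewrite divr_gt0// subr_gt0.
have [k hk] := kernel_exists (0 : V) e0; have [ck k0 kr k1] := hk.
have sI := sqint_indic_ball c (r + e).
have e2 : e + e = s - r by rewrite /e; lra.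
have bI : bounded_support (\1_(ball c (r + e)) : V -> R).
  exists (`|c| + (r + e)) => x hx; rewrite indicE memNset// -ball_normE /= => h.
  have := ler_normB c (c - x); rewrite opprB addrC subrK; lra.
exists (mollify k (\1_(ball c (r + e)))); split.
- exact: mollify_csmooth.
- move=> x xr; rewrite -k1 mollify_shiftE//; last exact: sI.1.
  apply: eq_Rintegral => v _; rewrite indicE.
  have [->|/kr] := eqVneq (k (- v)) 0; first by rewrite mul0r.
  rewrite subr0 normrN => ve; rewrite mem_set ?mulr1// -ball_normE /= opprD addrA.
  have := ler_normB (- v) (x - c); rewrite normrN opprB addrA [- v + c]addrC => h.
  by apply: le_lt_trans h _; lra.
- move=> x /mollify_neq0[y [+ /kr]]; rewrite indicE subr0; case: (boolP (y \in _)) => [|_]; last by rewrite eqxx.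
  rewrite inE -ball_normE /= => h _ h'.
  have -> : x - c = (x - y) - (c - y) by rewrite opprB addrA subrK.
  have := ler_normB (x - y) (c - y); lra.
Qed.

Lemma csmooth_weak_laplacian psi : csmooth psi -> is_weak_laplacian Omega psi (laplacian psi).
Proof.
move=> cp; have sqp := csmooth_sqint cp; have cl := csmooth_laplacian cp.
split; first by apply/L2P; apply: sqint_restrict => //; exact: csmooth_sqint.
move=> phi tphi; have cphi := test_csmooth tphi.
have cut f (c : V -> R) : (forall x, c x != 0 -> Omega x) -> dot mu (f \_ Omega) c = dot mu c f.
  move=> cO; rewrite dotC -[X in dot mu X _](restrict_support cO) dot_restrictr.
  by rewrite restrict_support.
have lO x : laplacian phi x != 0 -> Omega x.
  rewrite laplacianE; apply: contraNP => nO; rewrite big1// => i _.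
  by apply/eqP; apply: contra_notT nO; exact: test_support.
have pO x : phi x != 0 -> Omega x by have := @test_support [::] phi x tphi; rewrite pderiv0.
rewrite !dotL2E (cut _ _ lO) (cut _ _ pO) (dot_laplacian cphi sqp).
rewrite dotC (dot_laplacian cp (csmooth_sqint cphi)); apply: eq_bigr => i _.
by rewrite (dot_pderiv2 i i cphi cp.1) dotC.
Qed.

(** The chosen weak Laplacian of zero may be nonzero on a null set, so uniqueness enters even
    here. *)
Lemma laplacian_norm0 : laplacian_norm Omega (cst 0) = 0.
Proof.
have c0 : csmooth (cst 0 : V -> R) by split; [exact: smooth_cst|exists 0].
have w0 := csmooth_weak_laplacian c0; have [l0 _] := w0.
have r0 : (cst 0 : V -> R) \_ Omega = cst 0.
  by apply/funext => x; rewrite patchE; case: ifP.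
have L0 : laplacian (cst 0 : V -> R) = cst 0.
  apply/funext => x; rewrite laplacianE big1// => i _.
  by rewrite pderiv_cons2 !pderiv_cst.
rewrite /laplacian_norm (normL2_weak_laplacian w0) L0 normL2E ?r0; last first.
  by apply/L2P; rewrite r0; exact: sqint0.
have -> : sqn mu (cst 0) = 0 :> R by exact: dot0l.
by rewrite sqrtr0 expr0n /= addr0 sqrtr0.
Qed.

Lemma csmooth_H_laplacian psi : csmooth psi -> H_laplacian Omega psi.
Proof.
move=> cp; have wp := csmooth_weak_laplacian cp; split.
  split; last by exists (laplacian psi).
  by apply/L2P; apply: sqint_restrict => //; exact: csmooth_sqint.
move=> e e0; exists psi; first exact: cp.1.
rewrite (_ : psi \- psi = cst 0) ?laplacian_norm0//.
by apply/funext => x /=; rewrite subrr.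
Qed.

(* Testing the boundary condition against C_c^oo(R^n), which contains functions that do not
   vanish on the boundary, shows that the extension of u by zero has its Laplacian in L^2(R^n). *)
Lemma H0_laplacian_extension u : H0_laplacian Omega u ->
  [/\ sqint mu (u \_ Omega), sqint mu (weak_laplacian Omega u \_ Omega) &
  forall psi, csmooth psi ->
    dot mu (u \_ Omega) (laplacian psi) = dot mu (weak_laplacian Omega u \_ Omega) psi].
Proof.
move=> [[[lu [g ug]] _] hu]; have [lg _] := weak_laplacianP ug.
split; [exact/L2P|exact/L2P|move=> psi cp].
have /eqP := hu _ (csmooth_H_laplacian cp); rewrite subr_eq0 => /eqP.
by rewrite (dot_weak_laplacian (csmooth_weak_laplacian cp) lu) dotL2E.
Qed.

End interface.

(** * Limits of test functions *)

Section approximation.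
Variables (R : realType) (n : nat) (Omega : set 'rV[R]_n).
Local Notation V := 'rV[R]_n.
Local Notation mu := (lebesgue_rV R n).
Hypothesis oO : open Omega.

Lemma cvgn_sum (I : finType) (f : I -> nat -> R) (l : I -> R) :
  (forall i, f i m @[m --> \oo] --> l i) -> \sum_i f i m @[m --> \oo] --> \sum_i l i.
Proof.
move=> fl; elim: (index_enum I) => [|i s ih].
  by rewrite big_nil; under eq_fun do rewrite big_nil; exact: cvg_cst.
by rewrite big_cons; under eq_fun do rewrite big_cons; exact: cvgD.
Qed.

(** Weak derivatives are closed under L^2 limits, which identifies [H] as the Hessian of [u]; then
    [hessian_norm] of [u - phi m] is exactly the square root of the sum [E m] of the squared L^2
    errors. *)
Lemma H20_of_l2cvg (u : V -> R) (phi : nat -> V -> R) (H : 'I_n -> 'I_n -> V -> R) :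
  (forall m, test_function Omega (phi m)) -> l2cvg mu phi (u \_ Omega) ->
  (forall i j, l2cvg mu (fun m => pd [:: i; j] (phi m)) (H i j \_ Omega)) ->
  is_weak_hessian Omega u (fun x => \matrix_(i, j) H i j x) /\ H20 Omega u.
Proof.
move=> tphi cu cH; have [sphi su hu] := cu.
have cphi m := test_csmooth (tphi m).
have uH : is_weak_hessian Omega u (fun x => \matrix_(i, j) H i j x).
  move=> i j; rewrite (_ : (fun x => _) = H i j); last by apply/funext => x; rewrite mxE.
  have [sd sH hH] := cH i j; split; first exact/L2P.
  move=> psi tpsi; rewrite !dotL2E -pdE; have cpsi := test_csmooth tpsi.
  have h1 := l2cvg_dot cu (csmooth_sqint (csmooth_pderiv [:: i; j] cpsi)).
  have h2 := l2cvg_dot (cH i j) (csmooth_sqint cpsi).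
  apply: eq_cvg_unique h1 h2 => m.
  by rewrite (dot_pderiv2 i j (cphi m) cpsi.1) (pderivC j i cpsi.1).
split => //; split; first by split; [exact/L2P|exists (fun x => \matrix_(i, j) H i j x)].
move=> e e0.
pose E m := sqn mu (fun x => phi m x - (u \_ Omega) x) +
  \sum_(i < n) \sum_(j < n) sqn mu (fun x => pd [:: i; j] (phi m) x - (H i j \_ Omega) x).
have E0 : E m @[m --> \oo] --> (0 : R).
  have -> : (0 : R) = 0 + \sum_(i < n) \sum_(j < n) 0.
    by rewrite add0r big1// => i _; rewrite big1.
  apply: cvgD => //; apply: cvgn_sum => i; apply: cvgn_sum => j.
  by have [] := cH i j.
have EE m : hessian_norm Omega (u \- phi m) = Num.sqrt (E m).
  have tr : phi m \_ Omega = phi m.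
    apply: restrict_support => x; have := @test_support _ _ _ [::] (phi m) x (tphi m).
    by rewrite pderiv0.
  have tr2 i j : pd [:: i; j] (phi m) \_ Omega = pd [:: i; j] (phi m).
    by apply: restrict_support => x; exact: test_support.
  have lr : (u \- phi m) \_ Omega = fun x => (u \_ Omega) x - phi m x.
    by rewrite restrictB tr.
  have wH : is_weak_hessian Omega (u \- phi m)
      (fun x => \matrix_(i, j) (H i j x - pd [:: i; j] (phi m) x)).
    move=> i j; rewrite (_ : (fun x => _) = fun x => H i j x - pd [:: i; j] (phi m) x); last first.
      by apply/funext => x; rewrite mxE.
    have sd := csmooth_sqint (csmooth_pderiv [:: i; j] (cphi m)).
    have [_ sH _] := cH i j; have [_ hH] := uH i j.
    split; first by apply/L2P; rewrite restrictB tr2; exact: sqintB.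
    move=> psi tpsi; have cpsi := test_csmooth tpsi; have := hH _ tpsi.
    rewrite (_ : (fun x => _) = H i j); last by apply/funext => x; rewrite mxE.
    rewrite !dotL2E lr restrictB tr2 -pdE => h.
    have s1 := csmooth_sqint (csmooth_pderiv [:: i; j] cpsi); have s2 := csmooth_sqint cpsi.
    have s3 := csmooth_sqint (cphi m).
    rewrite !dotBl// h; congr (_ - _).
    by rewrite (dot_pderiv2 i j (cphi m) cpsi.1) (pderivC j i cpsi.1).
  rewrite /hessian_norm; congr Num.sqrt; congr (_ + _).
    rewrite sqr_normL2 ?lr; first exact: sqnBC.
    by apply/L2P; rewrite lr; apply: sqintB => //; exact: csmooth_sqint.
  rewrite /normL2_tensor sqr_sqrtr; last by do 2!apply: sumr_ge0 => ? _; exact: sqr_ge0.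
  apply: eq_bigr => i _; apply: eq_bigr => j _; rewrite (weak_hessian_sqn oO i j wH).
  under [X in X \_ _]eq_fun do rewrite mxE.
  by rewrite restrictB tr2 sqnBC.
have /cvgr0_norm_lt/(_ _ (exprn_gt0 2 e0))[N _ /(_ N (leqnn N)) hN] := E0.
exists (phi N); first exact: tphi.
rewrite EE -(gtr0_norm e0) -sqrtr_sqr ltr_sqrt ?exprn_gt0//.
exact: le_lt_trans (ler_norm _) hN.
Qed.

Lemma norm_laplacian_hessian (u g : V -> R) (phi : nat -> V -> R) (H : 'I_n -> 'I_n -> V -> R) :
  is_weak_laplacian Omega u g ->
  (forall m, test_function Omega (phi m)) -> l2cvg mu phi (u \_ Omega) ->
  (forall i j, l2cvg mu (fun m => pd [:: i; j] (phi m)) (H i j \_ Omega)) ->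
  normL2 Omega (weak_laplacian Omega u) = normL2_tensor Omega (weak_hessian Omega u).
Proof.
move=> ug tphi cu cH; have [uH _] := H20_of_l2cvg tphi cu cH.
have cphi m := test_csmooth (tphi m).
have lE : l2cvg mu (fun m => laplacian (phi m)) (fun x => \sum_(i < n) (H i i \_ Omega) x).
  rewrite (_ : (fun m => _) = fun m x => \sum_(i < n) pd [:: i; i] (phi m) x).
    exact: (l2cvg_sum (fun i => cH i i)).
  by apply/funext => m; rewrite laplacianE.
have sE : (fun x => \sum_(i < n) H i i x) \_ Omega = fun x => \sum_(i < n) (H i i \_ Omega) x.
  by apply/funext => x; rewrite patchE; case: ifPn => h; [apply: eq_bigr|rewrite big1//] => i _;
    rewrite patchE ?h// (negbTE h).
have [_ sL _] := lE.
(* The trace of the limit Hessian is a weak Laplacian of [u], so by uniqueness its norm is that of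
   the chosen one; it is also the limit of the Laplacians of [phi m]. *)
have uL : is_weak_laplacian Omega u (fun x => \sum_(i < n) H i i x).
  split; first by apply/L2P; rewrite sE.
  move=> psi tpsi; have cpsi := test_csmooth tpsi; rewrite !dotL2E sE.
  have h1 := l2cvg_dot cu (csmooth_sqint (csmooth_laplacian cpsi)).
  have h2 := l2cvg_dot lE (csmooth_sqint cpsi).
  apply: eq_cvg_unique h1 h2 => m; have sp := csmooth_sqint (cphi m).
  rewrite (dot_laplacian (cphi m) (csmooth_sqint cpsi)) dotC (dot_laplacian cpsi sp).
  by apply: eq_bigr => i _; rewrite dotC (dot_pderiv2 i i (cphi m) cpsi.1).
rewrite (normL2_weak_laplacian oO uL) sE; congr Num.sqrt.
transitivity (\sum_(i < n) \sum_(j < n) sqn mu (H i j \_ Omega)).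
  have h1 := l2cvg_sqn lE.
  have h2 : \sum_(i < n) \sum_(j < n) sqn mu (pd [:: i; j] (phi m)) @[m --> \oo] -->
      \sum_(i < n) \sum_(j < n) sqn mu (H i j \_ Omega).
    by apply: cvgn_sum => i; apply: cvgn_sum => j; exact: l2cvg_sqn.
  by apply: eq_cvg_unique h1 h2 => m; rewrite sum_sqn_hessian.
apply: eq_bigr => i _; apply: eq_bigr => j _; rewrite (weak_hessian_sqn oO i j uH).
by congr (sqn mu (_ \_ _)); apply/funext => x; rewrite mxE.
Qed.

End approximation.

(** * The cone property of Lipschitz domains *)

Section cone.
Variables (R : realType) (n : nat) (Omega : set 'rV[R]_n).
Local Notation V := 'rV[R]_n.

(* Some arbitrarily small translations push closure Omega, near x, inside Omega. *)
Definition cone_point (x : V) (del : R) := 0 < del /\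
  forall eta, 0 < eta -> exists c r, [/\ 0 < r, `|c| + r <= eta &
    forall y v, closure Omega y -> `|y - x| < del -> `|v - c| < r -> Omega (y + v)].

(** The sup norm is not invariant under orthogonal matrices, hence a constant for the change of
    coordinates. *)
Lemma mulmx_norm_bound m (Q : 'M[R]_(n, m)) : exists2 K, 0 <= K & forall s : V, `|s *m Q| <= K * `|s|.
Proof.
pose K := \sum_j \sum_i `|Q i j|.
have K0 : 0 <= K by do 2!apply: sumr_ge0 => ? _.
exists K => // s; rewrite rV_normE ?mulr_ge0//; apply/forallP => j.
rewrite mxE; apply: le_trans (ler_norm_sum _ _ _) _.
apply: (@le_trans _ _ ((\sum_i `|Q i j|) * `|s|)).
  rewrite mulr_suml; apply: ler_sum => i _.
  by rewrite normrM mulrC ler_wpM2l// mx_entry_le.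
apply: ler_wpM2r => //; rewrite /K (bigD1 j)//= lerDl.
by do 2!apply: sumr_ge0 => ? _.
Qed.

Lemma col'_norm_le k (w : V) : `|col' k w| <= `|w|.
Proof. by rewrite rV_normE//; apply/forallP => j; rewrite mxE mx_entry_le. Qed.

Lemma interior_cone_point x : open Omega -> Omega x -> exists del, cone_point x del.
Proof.
move=> oO Ox; have /nbhs_ballP[r /= r0 rO] : nbhs x Omega by exact: open_nbhs_nbhs.
have r2 : 0 < r / 2 by rewrite divr_gt0.
exists (r / 2); split => // eta eta0; exists 0, (Num.min (r / 2) eta); split.
- by rewrite lt_min r2.
- by rewrite normr0 add0r ge_min lexx orbT.
- move=> y v _ xy; rewrite subr0 lt_min => /andP[vr _]; apply: rO.
  rewrite -ball_normE /= distrC -addrA addrC -addrA [- x + y]addrC.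
  by apply: le_lt_trans (ler_normD _ _) _; lra.
Qed.

(** [F] is the height above the graph in the rotated coordinates. It is nonnegative on the closure
    near [x], a translation by [t *: ek] raises it by exactly [t], and a perturbation of size [r]
    lowers it by at most [C * r]. *)
Lemma boundary_cone_point x : lipschitz_boundary Omega -> (closure Omega `\` Omega°) x ->
  exists del, cone_point x del.
Proof.
move=> lipO /lipO[Q [k [gamma [QQ lipg /nbhs_ballP[rho /= rho0 hrho]]]]].
have [L L0 hL] : exists2 L, 0 <= L & forall a b, `|gamma a - gamma b| <= L * `|a - b|.
  case: lipg => M [_ hM]; exists (`|M| + 1); first by rewrite addr_ge0.
  move=> a b; apply: (hM (`|M| + 1) _ (a, b)); last by [].
  by have := ler_norm M; lra.
have [K K0 hK] := mulmx_norm_bound Q.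
pose F y := (y *m Q) 0 k - gamma (col' k (y *m Q)).
have FO y : `|y - x| < rho -> Omega y <-> 0 < F y.
  by move=> yx; rewrite subr_gt0; apply: hrho; rewrite -ball_normE /= distrC.
have linF a b : `|F a - F b| <= (K + L * K) * `|a - b|.
  rewrite /F (_ : _ - _ = ((a *m Q) 0 k - (b *m Q) 0 k)
    - (gamma (col' k (a *m Q)) - gamma (col' k (b *m Q)))); last by lra.
  apply: le_trans (ler_normB _ _) _; rewrite mulrDl; apply: lerD.
    apply: le_trans _ (hK _); rewrite mulmxBl.
    by have := mx_entry_le (a *m Q - b *m Q) k; rewrite !mxE.
  apply: le_trans (hL _ _) _; rewrite -mulrA ler_wpM2l//.
  apply: le_trans _ (hK _); rewrite mulmxBl; apply: le_trans _ (col'_norm_le k _).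
  by rewrite [X in _ <= `|X|]linearB.
have C0 : 0 <= K + L * K by rewrite addr_ge0// mulr_ge0.
set C := K + L * K in C0 linF.
have Fcl y : closure Omega y -> `|y - x| < rho -> 0 <= F y.
  move=> cy yx; rewrite leNgt; apply/negP => Fy.
  (* Within [e] of [y] a point stays in the chart and, by the Lipschitz bound, keeps a negative
     height; so it cannot belong to Omega. *)
  pose e := Num.min (rho - `|y - x|) (- F y / (C + 1)).
  have e0 : 0 < e.
    by rewrite lt_min subr_gt0 yx divr_gt0// ?oppr_gt0//; lra.
  have [y' [Oy' yy']] := cy _ (nbhsx_ballx y e e0).
  move: yy'; rewrite -ball_normE /= lt_min => /andP[h1 h2].
  have y'x : `|y' - x| < rho.
    have -> : y' - x = (y - x) - (y - y') by rewrite opprB [RHS]addrC addrA subrK.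
    by apply: le_lt_trans (ler_normB _ _) _; lra.
  have Fy' := (FO _ y'x).1 Oy'.
  have := linF y y'; rewrite ltr_pdivlMr in h2; last by lra.
  have := ler_norm (F y' - F y); rewrite distrC => h3 h4.
  have : C * `|y - y'| <= `|y - y'| * (C + 1) by rewrite mulrC ler_wpM2l//; lra.
  lra.
(* The vertical unit vector of the chart, written in the original coordinates. *)
pose ek : V := delta_mx 0 k *m Q^T.
have ekQ : ek *m Q = delta_mx 0 k by rewrite /ek -mulmxA (mulmx1C QQ) mulmx1.
have FC y t : F (y + t *: ek) = F y + t.
  rewrite /F mulmxDl -scalemxAl ekQ !mxE !eqxx mulr1.
  rewrite (_ : col' k (_ + _) = col' k (y *m Q)); first by lra.
  apply/rowP => j; rewrite !mxE eqxx (eq_sym (lift k j)) (negbTE (neq_lift _ _)) mulr0 addr0.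
  by [].
exists (rho / 2); split; first by rewrite divr_gt0.
move=> eta eta0; pose q := Num.min eta (rho / 2).
have q0 : 0 < q by rewrite lt_min eta0 divr_gt0.
pose t := q / 2 / (`|ek| + 1); have ek1 : 0 < `|ek| + 1 by rewrite ltr_wpDl.
have t0 : 0 < t by rewrite !divr_gt0.
have tq : t * (`|ek| + 1) = q / 2 by rewrite /t mulfVK// gt_eqF.
(* The translation and the radius each use at most [q / 2], which keeps the sum below both [eta] and
   [rho / 2]. Dividing by [C + 1] gives [C * r < t], so the height stays positive. *)
pose r := Num.min (q / 2) (t / (C + 1)); have C1 : 0 < C + 1 by lra.
have r0 : 0 < r by rewrite lt_min !divr_gt0.
have rq : r <= q / 2 by rewrite ge_min lexx.
have rt : r * (C + 1) <= t by rewrite -ler_pdivlMr// ge_min lexx orbT.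
have qe : q <= eta by rewrite ge_min lexx.
have qr : q <= rho / 2 by rewrite ge_min lexx orbT.
have cn : `|t *: ek| + r <= q.
  rewrite normrZ (gtr0_norm t0); have : t * `|ek| <= t * (`|ek| + 1) by rewrite ler_pM2l//; lra.
  lra.
exists (t *: ek), r; split => //; first exact: le_trans cn qe.
move=> y v cy yx vr.
have vn : `|v| < q.
  rewrite -[v](subrK (t *: ek)); apply: le_lt_trans (ler_normD _ _) _; lra.
have yvx : `|(y + v) - x| < rho.
  rewrite (_ : y + v - x = (y - x) + v); last by rewrite addrAC.
  by apply: le_lt_trans (ler_normD _ _) _; lra.
apply/(FO _ yvx); have Fy : 0 <= F y by apply: Fcl => //; lra.
have := linF (y + t *: ek) (y + v).
rewrite FC (_ : _ - (y + v) = - (v - t *: ek)); last by rewrite opprD addrACA subrr add0r opprB.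
rewrite normrN => h; have := ler_norm (F y + t - F (y + v)).
have : C * `|v - t *: ek| <= C * r by rewrite ler_wpM2l// ltW.
lra.
Qed.

Lemma exists_cone_point x : open Omega -> lipschitz_boundary Omega -> closure Omega x ->
  exists del, cone_point x del.
Proof.
move=> oO lO cx; have [Ox|nOx] := pselect (Omega x); first exact: interior_cone_point.
by apply: boundary_cone_point => //; split => // /interior_subset.
Qed.

(** Compactness of the closure. The halved radii leave room for cutoffs equal to 1 on each ball of
    the cover and supported in the ball of full radius. *)
Lemma finite_cone_cover : open Omega -> bounded_set Omega -> lipschitz_boundary Omega ->
  exists l : seq (V * R), (forall p, p \in l -> cone_point p.1 p.2) /\
    forall x, closure Omega x -> exists2 p, p \in l & `|x - p.1| < p.2 / 2.
Proof.
move=> oO bO lO.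
have cO : compact (closure Omega).
  apply: bounded_closed_compact; last exact: closed_closure.
  have [M [Mr hM]] := bO; exists M; split => // N MN x.
  by apply: closure_bounded => y /(hM _ MN).
have /choice[del hdel] : forall x, exists del, closure Omega x -> cone_point x del.
  move=> x; have [cx|ncx] := pselect (closure Omega x); last by exists 0.
  by have [del] := exists_cone_point oO lO cx; exists del.
rewrite compact_cover in cO.
have [||D DO Dc] := cO _ (closure Omega) (fun x => ball x (del x / 2)).
- by move=> x _; exact: ball_open.
- move=> x cx; exists x => //; apply: ballxx; rewrite divr_gt0//; exact: (hdel _ cx).1.
exists [seq (x, del x) | x <- finmap.enum_fset D]; split.
  by move=> p /mapP[x xD ->] /=; apply: hdel; rewrite -inE; exact: DO.
move=> x /Dc[y yD xy]; exists (y, del y); first by apply/mapP; exists y.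
by move: xy; rewrite -ball_normE /= distrC.
Qed.

End cone.

(** * Density of test functions *)

Section density.
Variables (R : realType) (n : nat) (Omega : set 'rV[R]_n).
Local Notation V := 'rV[R]_n.
Local Notation mu := (lebesgue_rV R n).
Hypothesis oO : open Omega.
Implicit Types (z : V -> R) (G : 'I_n -> V -> R) (H : 'I_n -> 'I_n -> V -> R).

Definition test_approx z H := forall e, 0 < e -> exists2 phi, test_function Omega phi &
  sqn mu (fun x => phi x - z x) < e /\
  forall i j, sqn mu (fun x => pd [:: i; j] phi x - H i j x) < e.

Lemma test_approxD z z' H H' : sqint mu z -> sqint mu z' ->
  (forall i j, sqint mu (H i j)) -> (forall i j, sqint mu (H' i j)) ->
  test_approx z H -> test_approx z' H' ->
  test_approx (fun x => z x + z' x) (fun i j x => H i j x + H' i j x).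
Proof.
move=> sz sz' sH sH' a a' e e0; have e4 : 0 < e / 4 by rewrite divr_gt0.
have [phi tp [hz hH]] := a _ e4; have [phi' tp' [hz' hH']] := a' _ e4.
have c := test_csmooth tp; have c' := test_csmooth tp'.
have sum2 (f f' g g' : V -> R) : sqint mu f -> sqint mu f' -> sqint mu g -> sqint mu g' ->
    sqn mu (fun x => f x - g x) < e / 4 -> sqn mu (fun x => f' x - g' x) < e / 4 ->
    sqn mu (fun x => (f x + f' x) - (g x + g' x)) < e.
  move=> sf sf' sg sg' h h'.
  rewrite (_ : (fun x => _) = fun x => (f x - g x) + (f' x - g' x)); last first.
    by apply/funext => x; lra.
  by apply: le_lt_trans (sqnD_le (sqintB sf sg) (sqintB sf' sg')) _; lra.
exists (fun x => phi x + phi' x).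
  have [_ _ K] := tp; have [_ _ K'] := tp'.
  apply: (@test_functionI _ _ _ _ (closure [set x | phi x != 0] `|` closure [set x | phi' x != 0])).
  - exact: csmoothD.
  - by apply: closedU; exact: closed_closure.
  - by move=> x [/K|/K'].
  - move=> x; have [p0|p0 _] := eqVneq (phi x) 0; last by left; exact: subset_closure.
    by rewrite p0 add0r => p0'; right; exact: subset_closure.
split; first by apply: sum2 => //; exact: csmooth_sqint.
move=> i j; have -> : pd [:: i; j] (fun x => phi x + phi' x) =
    fun x => pd [:: i; j] phi x + pd [:: i; j] phi' x.
  rewrite pderiv_cons2 (pderivD_smooth j c.1 c'.1).
  rewrite (pderivD_smooth i (smooth_pderiv [:: j] c.1) (smooth_pderiv [:: j] c'.1)).
  by rewrite -!pderiv_cons2.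
by apply: sum2 => //; apply: csmooth_sqint; exact: csmooth_pderiv.
Qed.

Lemma cone_test_approx x0 del z G H : cone_point Omega x0 del -> weak_derivs z G H ->
  (forall x, z x != 0 -> closure Omega x /\ `|x - x0| < del) -> test_approx z H.
Proof.
move=> [del0 cone] wz zO e e0; have [sz sG sH _ _] := wz.
have [D D0 hD] := mollify_cvg sz e0.
have [D' D'0 hD'] : exists2 D', 0 < D' & forall ij : 'I_n * 'I_n,
    forall k c r, kernel_in k c r -> `|c| + r <= D' ->
    sqint mu (mollify k (H ij.1 ij.2)) /\
    sqn mu (fun x => mollify k (H ij.1 ij.2) x - H ij.1 ij.2 x) < e.
  apply: (exists_common_radius (P := fun ij D' => forall k c r, kernel_in k c r -> `|c| + r <= D' ->
    sqint mu (mollify k (H ij.1 ij.2)) /\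
    sqn mu (fun x => mollify k (H ij.1 ij.2) x - H ij.1 ij.2 x) < e)).
    by move=> ij r r' h rr k c s /h{}h cs; apply: h; exact: le_trans cs rr.
  by move=> ij; exact: mollify_cvg.
have m0 : 0 < Num.min D D' by rewrite lt_min D0.
(* One translation, shorter than [D] and [D'], serves [z] and all entries of [H] at once. The kernel
   uses only half of the radius [r]. *)
have [c [r [r0 cr push]]] := cone _ m0; have r2 : 0 < r / 2 by rewrite divr_gt0.
have [k hk] := kernel_exists c r2; have [ck _ kc _] := hk.
have cr2 : `|c| + r / 2 <= Num.min D D' by lra.
have bz : bounded_support z.
  exists (`|x0| + del) => x hx; apply/eqP; apply: contraTT hx => /zO[_ xd]; rewrite -leNgt.
  have := ler_normD (x - x0) x0; rewrite subrK; lra.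
exists (mollify k z).
  (* A limit point of the support may lie [r / 2] away from it; together with the kernel radius
     [r / 2] this stays below the [r] that [push] allows. *)
  apply: (@test_functionI _ _ _ _ (closure [set x | exists y, z y != 0 /\ `|x - y - c| < r / 2])).
  - exact: mollify_csmooth.
  - exact: closed_closure.
  - move=> x cx; have [x' [[y [zy yc]] xx']] := cx _ (nbhsx_ballx x _ r2).
    have [cy yd] := zO _ zy; rewrite -[x](subrK y) addrC; apply: push => //.
    move: xx'; rewrite -ball_normE /= => xx'.
    rewrite (_ : x - y - c = (x - x') + (x' - y - c)); last by rewrite !addrA subrK.
    by apply: le_lt_trans (ler_normD _ _) _; lra.
  - move=> x /mollify_neq0[y [zy /kc ky]]; apply: subset_closure; exists y; split => //.
move: cr2; rewrite le_min => /andP[crD crD'].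
split; first exact: (hD _ _ _ hk crD).2.
by move=> i j; rewrite (pderiv2_mollify i j ck wz); exact: (hD' (i, j) _ _ _ hk crD').2.
Qed.

(** The fundamental lemma on the whole space. The base case of the cover induction needs it: with
    [z = 0], [H] is zero only almost everywhere. *)
Lemma weak_derivs0 z G H i j : weak_derivs z G H -> (forall x, z x = 0) -> sqn mu (H i j) = 0.
Proof.
move=> [sz sG sH wG wH] z0; apply: (sqn0_of_dot_test openT) => // phi tphi.
by rewrite -wH ?(funext z0) ?dot0l//; exact: test_csmooth tphi.
Qed.

(** Induction on the cover in place of a partition of unity: the piece [chi * z] lies in one cone
    neighbourhood, and [z - chi * z] vanishes on the first half ball, so the remaining balls cover
    its support. *)
Lemma cover_test_approx (l : seq (V * R)) z G H :
  (forall p, p \in l -> cone_point Omega p.1 p.2) -> weak_derivs z G H ->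
  (forall x, z x != 0 -> closure Omega x /\ exists2 p, p \in l & `|x - p.1| < p.2 / 2) ->
  test_approx z H.
Proof.
elim: l z G H => [|p l ih] z G H cl wz zO; have [sz sG sH _ _] := wz.
  have z0 x : z x = 0 by apply/eqP/negP => /negP /zO[_ [p]].
  have c0 : csmooth (cst 0 : V -> R) by split; [exact: smooth_cst|exists 0].
  move=> e e0; exists (cst 0).
    apply: (@test_functionI _ _ _ _ set0) => //; first exact: closed0.
    by move=> x; rewrite eqxx.
  split=> [|i j].
    rewrite (_ : (fun x => _) = cst 0); last by apply/funext => x; rewrite z0 subrr.
    by rewrite /sqn dot0l.
  rewrite (_ : (fun x => _) = fun x => - H i j x); last first.
    by apply/funext => x; rewrite pderiv_cons2 !pderiv_cst sub0r.
  by rewrite sqnN (weak_derivs0 i j wz z0).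
have cp : cone_point Omega p.1 p.2 by apply: cl; rewrite mem_head.
have p2 : 0 < p.2 / 2 by rewrite divr_gt0// cp.1.
have pp : p.2 / 2 < p.2 by have := cp.1; lra.
have [chi [cc c1 cs]] := cutoff_exists p.1 p2 pp.
have wc := weak_derivsM cc wz; have wr := weak_derivsB wz wc.
have [s1 _ s1H _ _] := wc; have [s2 _ s2H _ _] := wr.
have a1 := cone_test_approx cp wc; have a2 := ih _ _ _ _ wr.
have := test_approxD s1 s2 s1H s2H (a1 _) (a2 _ _).
rewrite (_ : (fun x => _ + (_ - _)) = z); last by apply/funext => x; rewrite addrC subrK.
rewrite (_ : (fun i j x => _ + (_ - _)) = H); last first.
  by apply/funext => i; apply/funext => j; apply/funext => x; rewrite addrC subrK.
apply.
- move=> x; rewrite mulf_eq0 negb_or => /andP[/cs xp /zO[cx _]]; by [].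
- by move=> q ql; apply: cl; rewrite in_cons ql orbT.
- move=> x h; have zx : z x != 0 by apply: contraNneq h => ->; rewrite mulr0 subrr.
  have [cx [q]] := zO _ zx; rewrite in_cons => /orP[/eqP -> xp|ql xq]; split => //.
    by move: h; rewrite c1// mul1r subrr eqxx.
  by exists q.
Qed.

End density.

(** * Regularity of u and equality of the norms *)

Section conclusion.
Variables (R : realType) (n : nat) (Omega : set 'rV[R]_n).
Local Notation V := 'rV[R]_n.
Local Notation mu := (lebesgue_rV R n).

Lemma H0_laplacian_H20 (u : V -> R) : open Omega -> bounded_set Omega ->
  lipschitz_boundary Omega -> H0_laplacian Omega u ->
  H20 Omega u /\ normL2 Omega (weak_laplacian Omega u) =
    normL2_tensor Omega (weak_hessian Omega u).
Proof.
move=> oO bO lO hu; have [su sg ug] := H0_laplacian_extension oO hu.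
have bu : bounded_support (u \_ Omega).
  have [M [_ hM]] := bO; exists (M + 1) => x Mx; rewrite patchE memNset// => /(hM (M + 1)).
  by rewrite ltrDl ltr01 => /(_ isT); rewrite /= leNgt Mx.
have [G [H wu]] := weak_derivs_exist su bu sg ug; have [_ _ sH _ _] := wu.
have [l [cl lc]] := finite_cone_cover oO bO lO.
have uO x : (u \_ Omega) x != 0 -> Omega x.
  by apply: contraNP => nO; rewrite patchE memNset.
have a : test_approx Omega (u \_ Omega) H.
  apply: (cover_test_approx cl wu) => x /uO Ox.
  by have cx := subset_closure Ox; split => //; exact: lc.
have /choice[phi hphi] : forall m : nat, exists phi, test_function Omega phi /\
    (sqn mu (fun x => phi x - (u \_ Omega) x) < m.+1%:R^-1 /\
     forall i j, sqn mu (fun x => pd [:: i; j] phi x - H i j x) < m.+1%:R^-1).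
  by move=> m; have [|phi] := a m.+1%:R^-1; [rewrite invr_gt0|exists phi].
have tphi m := (hphi m).1; have cphi m := test_csmooth (tphi m).
have small (f : nat -> V -> R) l' : (forall m, sqint mu (f m)) -> sqint mu l' ->
    (forall m, sqn mu (fun x => f m x - l' x) < m.+1%:R^-1) -> l2cvg mu f l'.
  move=> sf sl h; split => //; apply/cvgr0Pnorm_lt => e e0; near=> m.
  rewrite ger0_norm ?sqn_ge0//; apply: lt_trans (h m) _.
  by near: m; exact: (near_infty_natSinv_lt (PosNum e0)).
have cu : l2cvg mu phi (u \_ Omega).
  by apply: small => // m; [exact: csmooth_sqint|exact: (hphi m).2.1].
have mI : measurable_fun setT (\1_Omega : V -> R).
  by apply: measurable_indic; exact: open_measurable_rV.
have I1 x : `|\1_Omega x : R| <= 1 by rewrite indicE; case: (_ \in _); rewrite ?normr1 ?normr0.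
have IE (f : V -> R) : (fun x => \1_Omega x * f x) = f \_ Omega.
  by apply/funext => x; rewrite patchE indicE; case: (_ \in _); rewrite ?mul1r ?mul0r.
(* The approximation gives convergence to [H i j] on the whole space; multiplying by the indicator
   of Omega restricts the limit and leaves the derivatives of test functions unchanged. *)
have cH i j : l2cvg mu (fun m => pd [:: i; j] (phi m)) (H i j \_ Omega).
  have h : l2cvg mu (fun m => pd [:: i; j] (phi m)) (H i j).
    apply: small => // m; last exact: (hphi m).2.2.
    by apply: csmooth_sqint; exact: csmooth_pderiv.
  have := l2cvg_bnd mI I1 h; rewrite IE; congr l2cvg; apply/funext => m.
  by rewrite IE restrict_support// => x; exact: test_support.
have [_ H2] := H20_of_l2cvg oO tphi cu cH; split => //.
have [[[_ [g wg]] _] _] := hu.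
exact: norm_laplacian_hessian wg tphi cu cH.
Unshelve. all: by end_near. Qed.

End conclusion.

Theorem theorem19 (R : realType) (d : nat) (hd : d = 2%N \/ d = 3%N)
    (Omega : set 'rV[R]_d) (Omega_domain : domain Omega)
    (Omega_bounded : bounded_set Omega)
    (Omega_sc : simply_connected R Omega)
    (Omega_lipschitz : lipschitz_boundary Omega)
    (u : 'rV[R]_d -> R) (hu : H0_laplacian Omega u)
    (hDu : H_laplacian Omega (weak_laplacian Omega u)) :
  H20 Omega u /\
  normL2 Omega (weak_laplacian Omega u) =
    normL2_tensor Omega (weak_hessian Omega u).
Proof.
have [_ oO _] := Omega_domain.
exact: H0_laplacian_H20.
Qed.
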